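(* Let $\Omega\subset\subset\mathbb{C}^m$ be a bounded domain with Lipschitz boundary and let $p\in\partial\Omega$. Then at least one of the following two (not mutually exclusive) possibilities holds: (i) The point $p$ is in the envelope of holomorphy of $\Omega$. (ii) The point $p$ is in a local peak set for plurisubharmonic functions, i.e. there exist a neighborhood $U$ of $p$ and a continuous function $\rho:U\cap\overline{\Omega}\to\mathbb{R}$ such that $\rho<0$ on $U\cap\Omega$, $\rho$ is plurisubharmonic on $U\cap\Omega$, and $\rho(p)=0$.
   Context: A domain is a connected open set. A domain $\Omega\subset\mathbb{C}^m$ has Lipschitz boundary if near every boundary point, after a holomorphic rotation of coordinates (a unitary change of coordinates, composed with a translation), one can write $\Omega$ locally as $\Omega=\{\operatorname{Im} z_m<r(z_1,\dots,z_{m-1},\operatorname{Re} z_m)\}$, where $r$ is a real-valued function satisfying $|r(x)-r(y)|\le C\|x-y\|$ for some constant $C$. The envelope of holomorphy of $\Omega$ is the (possibly multisheeted) Riemann domain $\pi:\tilde\Omega\to\mathbb{C}^m$ with canonical embedding $j:\Omega\to\tilde\Omega$, $\pi\circ j=\mathrm{id}$, which is the maximal Riemann domain to which all holomorphic functions on $\Omega$ extend. A boundary point $p\in\partial\Omega$ is said to be in the envelope of holomorphy if there are a neighborhood $W$ of $p$ in $\mathbb{C}^m$ and a holomorphic section $\sigma:W\to\tilde\Omega$ of $\pi$ (that is, $\pi\circ\sigma=\mathrm{id}_W$) with $\sigma=j$ on $W\cap\Omega$; in particular every holomorphic function on $\Omega$ then extends holomorphically across $p$ to $W$. *)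

(* Defs.v *)
From HB Require Import structures.
From mathcomp Require Import all_boot all_order all_algebra spectral.
From mathcomp Require Import all_classical all_reals all_analysis.
From mathcomp Require Import complex.
Set Implicit Arguments.
Unset Strict Implicit.
Unset Printing Implicit Defensive.
Import Order.TTheory GRing.Theory Num.Theory.
Import numFieldNormedType.Exports.
Local Open Scope classical_set_scope.
Local Open Scope ring_scope.

(* R[i] packed as a numClosedFieldType: its topology is then the one given by
   the modulus, which is not inferred on R[i] itself. *)
Definition Cplx (R : realType) : numClosedFieldType := R[i].

(* Points of C^m are row vectors; m is written n.+1 wherever the last
   coordinate is singled out. *)
Notation CC R m := ('rV[Cplx R]_m).

(* [differentiable] is Frechet differentiability over the base field Cplx R,
   so on an open set this is holomorphy. *)
Definition holomorphic_on (R : realType) (m : nat) (D : set (CC R m))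
    (f : CC R m -> Cplx R) : Prop :=
  forall z, D z -> differentiable f z.

Definition domain (R : realType) (m : nat) (D : set (CC R m)) : Prop :=
  open D /\ connected D.

Definition boundary (T : topologicalType) (A : set T) : set T :=
  closure A `\` A^°.

Section LipschitzBoundary.
Variables (R : realType) (n : nat).

(* Euclidean norm on C^n x R *)
Definition graph_norm (x : CC R n) (t : R) : R :=
  Num.sqrt (\sum_(k < n)
     ((complex.Re (x ord0 k)) ^+ 2 + (complex.Im (x ord0 k)) ^+ 2) + t ^+ 2).

Definition lipschitz_graph (r : CC R n -> R -> R) : Prop :=
  exists K : R, forall x y s t,
    `|r x s - r y t| <= K * graph_norm (x - y) (s - t).

(* z |-> (z - a) *m U is a unitary change of coordinates composed with a
   translation; [col' ord_max w] drops the last coordinate of w. *)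
Definition lipschitz_boundary (D : set (CC R n.+1)) : Prop :=
  forall p, boundary D p ->
  exists (U : 'M[Cplx R]_n.+1) (a : CC R n.+1) (r : CC R n -> R -> R),
    [/\ U \is unitarymx, lipschitz_graph r &
      \forall z \near p,
        let w := (z - a) *m U in
        let wm : Cplx R := w ord0 ord_max in
        D z <-> complex.Im wm < r (col' ord_max w) (complex.Re wm)].

End LipschitzBoundary.

Section RiemannDomain.
Variables (R : realType) (m : nat).

(* pi restricts to a homeomorphism from the open set U onto the open set
   pi @` U, with inverse s; the values of s off pi @` U are irrelevant. *)
Definition chart_of (X : topologicalType) (pi : X -> CC R m)
    (U : set X) (s : CC R m -> X) : Prop :=
  [/\ open U, open (pi @` U), {within U, continuous pi},
      {within pi @` U, continuous s} & forall x, U x -> s (pi x) = x].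

Record riemann_domain := RiemannDomain {
  rd_space :> topologicalType;
  rd_proj : rd_space -> CC R m;
  rd_hausdorff : hausdorff_space rd_space;
  rd_connected : connected [set: rd_space];
  rd_charts : forall x : rd_space,
    exists U s, U x /\ chart_of rd_proj U s }.

Definition rd_holomorphic (X : riemann_domain) (F : X -> Cplx R) : Prop :=
  forall U s, chart_of (@rd_proj X) U s ->
    holomorphic_on (@rd_proj X @` U) (F \o s).

(* The complex structure of X is pulled back by its projection, so the
   holomorphic sections over an open set are the continuous ones. *)
Definition holomorphic_section (X : riemann_domain) (W : set (CC R m))
    (s : CC R m -> X) : Prop :=
  {within W, continuous s} /\ forall z, W z -> rd_proj (s z) = z.

(* Functions on D, including the embedding j, are total; only their values
   on D matter. *)
Definition holomorphic_extension (D : set (CC R m)) (X : riemann_domain)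
    (j : CC R m -> X) : Prop :=
  holomorphic_section D j /\
  forall f, holomorphic_on D f ->
    exists F : X -> Cplx R,
      rd_holomorphic F /\ forall z, D z -> F (j z) = f z.

(* Maximality: every extension (Y, k) of D maps to (X, j) over C^m,
   compatibly with the embeddings; this determines (X, j) up to isomorphism.
   Such a map h, being continuous and over C^m, is holomorphic. *)
Definition is_envelope (D : set (CC R m)) (X : riemann_domain)
    (j : CC R m -> X) : Prop :=
  holomorphic_extension D j /\
  forall (Y : riemann_domain) (k : CC R m -> Y), holomorphic_extension D k ->
    exists h : Y -> X,
      [/\ continuous h, forall y, rd_proj (h y) = rd_proj y &
          forall z, D z -> h (k z) = j z].

Definition in_envelope (D : set (CC R m)) (X : riemann_domain)
    (j : CC R m -> X) (p : CC R m) : Prop :=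
  exists (W : set (CC R m)) (s : CC R m -> X),
    [/\ open_nbhs p W, holomorphic_section W s &
        forall z, W z -> D z -> s z = j z].

End RiemannDomain.

Section Plurisubharmonic.
Variable R : realType.
Local Open Scope ereal_scope.

(* Upper semicontinuous with values in [-oo, +oo[ ; D is meant to be open. *)
Definition usc_on (T : topologicalType) (D : set T) (u : T -> \bar R) : Prop :=
  forall x, D x ->
    u x < +oo /\ forall a : R, u x < a%:E -> \forall y \near x, u y < a%:E.

Definition circle_pt (c : Cplx R) (r t : R) : Cplx R :=
  (c + Complex (r * cos t) (r * sin t))%R.

Definition subharmonic_on (D : set (Cplx R)) (u : Cplx R -> \bar R) : Prop :=
  usc_on D u /\
  forall (c : Cplx R) (r : R), (0 < r)%R ->
    (forall z : Cplx R, (`|z - c| <= (Complex r 0 : Cplx R))%R -> D z) ->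
    (2 * pi)%:E * u c <=
      \int[lebesgue_measure]_(t in `[0%R, (2 * pi)%R]) u (circle_pt c r t).

Definition psh_on (m : nat) (D : set (CC R m)) (u : CC R m -> \bar R) : Prop :=
  usc_on D u /\
  forall a b : CC R m,
    subharmonic_on [set z : Cplx R | D (a + z *: b)%R]
                   (fun z : Cplx R => u (a + z *: b)%R).

End Plurisubharmonic.

Definition in_local_psh_peak_set (R : realType) (m : nat) (D : set (CC R m))
    (p : CC R m) : Prop :=
  exists (U : set (CC R m)) (rho : CC R m -> R),
    [/\ open_nbhs p U, {within U `&` closure D, continuous rho},
        forall z, U z -> D z -> rho z < 0,
        psh_on (U `&` D) (fun z => (rho z)%:E) & rho p = 0].

(* Main.v *)
(** Let delta(z) <= 1 be the supremum of the radii r such that every function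
    holomorphic on Omega extends from a neighbourhood of z to the ball B(z,r).

    -log delta satisfies the sub-mean inequality on every disc c + s b in Omega.
    Let P_k(x,v) be the degree k homogeneous Taylor term of f at x; Cauchy's
    estimates give |P_k(x,v)| <= M (|v| / (q delta(x)))^k for x on the boundary
    circle, with M independent of x and k. Apply the maximum principle to
    s |-> prod_j P_k(c + w_j s b, v), where the w_j are the N-th roots of unity:
    its value at 0 is P_k(c,v)^N, so the Taylor series of f at c converges on the
    ball whose radius is the geometric mean of the numbers delta(c + w_j s b).
    Then let N tend to infinity.

    The Lipschitz condition provides a direction e along which every point of the
    closure near p can be pushed into Omega, with B(z - t e, c t) in Omega. If
    for some t all holomorphic functions extend to a ball about p - t e of a
    common radius r > t, then Omega together with a small ball about p is a schlicht
    extension, and the maximality of the envelope yields (i). Otherwise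
    delta(p - t e) <= t for all small t, while delta(z - t e) >= c t for all z.
    With t = eps_k -> 0 the functions
    (-log delta(z - eps_k e) + log (c eps_k) - 1) / (-log eps_k) are negative and
    plurisubharmonic, tend to 0 at p, and are eventually at most -1/2 near any
    point z with delta(z - eps_k e) > 2 eps_k for some k, in particular near any
    point of Omega. Their supremum, cut off below at -1/2, is the function of
    (ii). *)

Require Import Defs.
From HB Require Import structures.
From mathcomp Require Import all_boot all_order all_algebra spectral.
From mathcomp Require Import all_classical all_reals all_analysis.
From mathcomp Require Import complex.
From mathcomp Require Import ring lra.
Set Implicit Arguments.
Unset Strict Implicit.
Unset Printing Implicit Defensive.
Import Order.TTheory GRing.Theory Num.Theory.
Import numFieldNormedType.Exports.
Local Open Scope classical_set_scope.
Local Open Scope ring_scope.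

(** The maximum principle bears on finite products of holomorphic functions, so the sub-mean
    inequality is obtained over roots of unity and only afterwards compared with the Lebesgue
    integral. Contour integrals, circle means and sums of Taylor series are Banach limits: these
    exist for every bounded sequence, are linear, respect bounds, and by Cauchy's estimates preserve
    holomorphy. Convergence serves only to identify a Taylor series with [f] near its centre. The
    obstacle to a schlicht extension is multivaluedness: an extension to a ball about p - t e agrees
    with [f] only near the centre, and the ball can meet other parts of Omega. The cone condition
    joins each point of Omega near p to the centre by two segments inside Omega, which carry the
    agreement along. In the other case delta(p - eps_k e) lies between two multiples of eps_k, so
    its logarithm differs from log eps_k by a bounded amount, which the division by -log eps_k sends
    to 0. Where delta stays away from 0, the same quotient has upper limit at most -1; the cutoff
    -1/2 lies between these two values. *)

Section RealNorm.
Variable R : realType.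
Local Notation K := (Cplx R).

Definition rc (t : R) : K := Complex t 0.

Lemma rcD s t : rc (s + t) = rc s + rc t.
Proof. by rewrite -[rc s + rc t]/(Complex (s + t) (0 + 0)) addr0. Qed.

Lemma rcN t : rc (- t) = - rc t.
Proof. by rewrite -[- rc t]/(Complex (- t) (- 0)) oppr0. Qed.

Lemma rcM s t : rc (s * t) = rc s * rc t.
Proof.
rewrite -[rc s * rc t]/(Complex (s * t - 0 * 0) (s * 0 + 0 * t)).
by rewrite mulr0 mul0r subr0 addr0 mulr0.
Qed.

Lemma rc0 : rc 0 = 0. Proof. by []. Qed.

Lemma rc1 : rc 1 = 1. Proof. by []. Qed.

Lemma rc_inj : injective rc.
Proof. by move=> s t []. Qed.

Lemma rcV t : rc t^-1 = (rc t)^-1.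
Proof.
have [->|t0] := eqVneq t 0; first by rewrite invr0 rc0 invr0.
have rct0 : rc t != 0 by apply/eqP => /rc_inj/eqP; apply/negP.
by apply: (mulfI rct0); rewrite -rcM !divff.
Qed.

Lemma rcn (n : nat) : rc n%:R = n%:R.
Proof. by elim: n => // n IH; rewrite -!natr1 rcD IH rc1. Qed.

Lemma rc_le s t : (rc s <= rc t) = (s <= t).
Proof. exact: lecR. Qed.

Lemma rc_lt s t : (rc s < rc t) = (s < t).
Proof. exact: ltcR. Qed.

(* Norms over [Cplx R] take values in [Cplx R]; [rn] is the same norm in [R]. *)
Definition rn (V : normedZmodType K) (v : V) : R := complex.Re `|v|.

Lemma rnE (V : normedZmodType K) (v : V) : `|v| = rc (rn v).
Proof.
have := normr_ge0 v; rewrite lecE /rn => /andP[/eqP im0 _].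
by case: `|v| im0 => a b /= ->.
Qed.

Section Zmod.
Variable V : normedZmodType K.
Implicit Types u v w : V.

Lemma rn_ge0 v : 0 <= rn v.
Proof. by rewrite -rc_le -rnE normr_ge0. Qed.

Lemma rn0 : rn (0 : V) = 0.
Proof. by apply: rc_inj; rewrite -rnE normr0. Qed.

Lemma rn_eq0 v : rn v = 0 -> v = 0.
Proof. by move=> v0; apply/normr0_eq0; rewrite rnE v0. Qed.

Lemma rn_gt0 v : v != 0 -> 0 < rn v.
Proof.
by move=> v0; rewrite lt0r rn_ge0 andbT; apply: contra v0 => /eqP/rn_eq0 ->.
Qed.

Lemma rnD u v : rn (u + v) <= rn u + rn v.
Proof. by rewrite -rc_le rcD -!rnE ler_normD. Qed.

Lemma rnN v : rn (- v) = rn v.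
Proof. by rewrite /rn normrN. Qed.

Lemma rnBC u v : rn (u - v) = rn (v - u).
Proof. by rewrite -rnN opprB. Qed.

Lemma rnB u v : rn (u - v) <= rn u + rn v.
Proof. by rewrite -(rnN v) rnD. Qed.

Lemma rn_tri v u w : rn (u - w) <= rn (u - v) + rn (v - w).
Proof. by rewrite (le_trans _ (rnD _ _)) // addrA subrK. Qed.

Lemma rn_dist u v : rn u <= rn (u - v) + rn v.
Proof. by rewrite (le_trans _ (rnD _ _)) // subrK. Qed.

Lemma rn_sum (I : Type) (r : seq I) (P : pred I) (F : I -> V) :
  rn (\sum_(i <- r | P i) F i) <= \sum_(i <- r | P i) rn (F i).
Proof.
elim/big_ind2 : _ => [|u a v b ua vb|//]; first by rewrite rn0.
by rewrite (le_trans (rnD _ _)) ?lerD.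
Qed.

Lemma rn_sum_const (n : nat) (F : 'I_n -> V) (B : R) :
  (forall i, rn (F i) <= B) -> rn (\sum_(i < n) F i) <= n%:R * B.
Proof.
move=> FB; apply: le_trans (rn_sum _ _ _) _.
apply: le_trans (ler_sum _ (fun i _ => FB i)) _.
by rewrite sumr_const card_ord mulr_natl.
Qed.

End Zmod.

Lemma rnZ (V : normedModType K) (a : K) (v : V) : rn (a *: v) = rn a * rn v.
Proof. by apply: rc_inj; rewrite rcM -!rnE normrZ. Qed.

Implicit Types x y : K.

Lemma rnM x y : rn (x * y) = rn x * rn y.
Proof. by apply: rc_inj; rewrite rcM -!rnE normrM. Qed.

Lemma rn1 : rn (1 : K) = 1.
Proof. by apply: rc_inj; rewrite -rnE normr1. Qed.

Lemma rnX x n : rn (x ^+ n) = rn x ^+ n.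
Proof. by elim: n => [|n IH]; rewrite ?rn1// !exprS rnM IH. Qed.

Lemma rnV x : rn x^-1 = (rn x)^-1.
Proof. by apply: rc_inj; rewrite rcV -!rnE normfV. Qed.

Lemma rn_rc t : rn (rc t) = `|t|.
Proof.
rewrite /rn normc_def -[RHS]sqrtr_sqr /=; congr (Num.sqrt _).
by rewrite expr0n addr0.
Qed.

Lemma rn_sqr x : rn x ^+ 2 = complex.Re x ^+ 2 + complex.Im x ^+ 2.
Proof.
by rewrite /rn normc_def sqr_sqrtr// addr_ge0 ?sqr_ge0.
Qed.

Lemma rn_Re x : `|complex.Re x| <= rn x.
Proof.
by rewrite -(@ler_pXn2r _ 2) ?nnegrE ?rn_ge0// rn_sqr real_normK ?num_real// lerDl sqr_ge0.
Qed.

Lemma rn_Im x : `|complex.Im x| <= rn x.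
Proof.
by rewrite -(@ler_pXn2r _ 2) ?nnegrE ?rn_ge0// rn_sqr real_normK ?num_real// lerDr sqr_ge0.
Qed.

Lemma rn_ReIm x : rn x <= `|complex.Re x| + `|complex.Im x|.
Proof.
rewrite -(@ler_pXn2r _ 2) ?nnegrE ?rn_ge0 ?addr_ge0// rn_sqr sqrrD.
rewrite !real_normK ?num_real//; have := normr_ge0 (complex.Re x).
by move=> a; have := mulr_ge0 a (normr_ge0 (complex.Im x)); lra.
Qed.

Lemma nbhs_rn (V : normedModType K) (z : V) (P : V -> Prop) :
  (\forall w \near z, P w) <->
  exists2 e : R, 0 < e & forall w, rn (w - z) < e -> P w.
Proof.
split=> [/nbhs_ballP[e /= e0 eP]|[e e0 eP]].
  (* Positivity in the partial order of [Cplx R] forces a vanishing imaginary part, so a positive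
     radius is the image of a real one. *)
  have ere : e = rc (complex.Re e).
    move: e0; rewrite ltcE /= => /andP[/eqP + _].
    by case: e {eP} => a b /= ->.
  exists (complex.Re e) => [|w wz]; first by rewrite -rc_lt -ere.
  by apply: eP; rewrite -ball_normE /ball_ /= rnE ere rc_lt rnBC.
apply/nbhs_ballP; exists (rc e) => [/=|w]; first by rewrite -[0]rc0 rc_lt.
by rewrite -ball_normE /ball_ /= rnE rc_lt rnBC => /eP.
Qed.

Lemma open_rn (V : normedModType K) (D : set V) :
  open D <->
  forall z, D z -> exists2 e : R, 0 < e & forall w, rn (w - z) < e -> D w.
Proof.
rewrite openE; split=> oD z Dz; first by apply/nbhs_rn; exact: oD.
by apply/nbhs_rn; exact: oD.
Qed.

Lemma closure_rn (V : normedModType K) (D : set V) z :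
  closure D z <-> forall e : R, 0 < e -> exists2 w, D w & rn (w - z) < e.
Proof.
split=> [cD e e0|cD B /nbhs_rn[e e0 eB]].
  have /cD[w [Dw we]] : nbhs z [set w | rn (w - z) < e].
    by apply/nbhs_rn; exists e.
  by exists w.
by have [w Dw we] := cD _ e0; exists w; split=> //; exact: eB.
Qed.

(** The norm of a row vector is the largest modulus of its entries, so all balls in C^m below are
    polydiscs. *)
Lemma mx_rn_le m (v : 'rV[K]_m) (i : 'I_m) : rn (v ord0 i) <= rn v.
Proof.
rewrite -rc_le -!rnE [leRHS]/Num.norm /= mx_normE.
have -> : `|v ord0 i| = (`|v ord0 i|%:nng)%:num by [].
by rewrite num_le; exact: (le_bigmax _ (fun ij => `|v ij.1 ij.2|%:nng) (ord0, i)).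
Qed.

Lemma mx_le_rn m (v : 'rV[K]_m) (B : R) : 0 <= B ->
  (forall i, rn (v ord0 i) <= B) -> rn v <= B.
Proof.
move=> B0 vB; rewrite -rc_le -rnE {1}/Num.norm /= mx_normE.
have B0' : 0 <= rc B by rewrite -[0]rc0 rc_le.
have -> : rc B = (NngNum B0')%:num by [].
rewrite num_le; apply/bigmax_leP; split=> [|ij _]; first by rewrite -num_le.
by rewrite -num_le /= rnE rc_le (ord1 ij.1) vB.
Qed.

Lemma continuous_rn (V W : normedModType K) (f : V -> W) z :
  f @ z --> f z <-> forall e : R, 0 < e ->
    exists2 d, 0 < d & forall w, rn (w - z) < d -> rn (f w - f z) < e.
Proof.
split=> [cf e e0|cf P /nbhs_rn[e e0 eP]].
  have /cf : nbhs (f z) [set w | rn (w - f z) < e] by apply/nbhs_rn; exists e.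
  by move=> /nbhs_rn.
suff : \forall w \near z, P (f w) by [].
by apply/nbhs_rn; have [d d0 dP] := cf _ e0; exists d => // w /dP /eP.
Qed.

End RealNorm.

(** * Banach limits and compactness along an ultrafilter *)

Section UltraLimit.
Variable R : realType.

Lemma exists_ultra_nat : exists U : set_system nat, UltraFilter U /\ \oo `<=` U.
Proof. exact: ultraFilterLemma. Qed.

(** One fixed nonprincipal ultrafilter serves both as the limit behind [LIM] and in place of
    subsequences in [ucompact]. *)
Definition ultra_nat : set_system nat := sval (cid exists_ultra_nat).

Lemma ultra_natU : UltraFilter ultra_nat.
Proof. by rewrite /ultra_nat; case: cid => U []. Qed.

#[global] Instance ultra_nat_proper : ProperFilter ultra_nat := @ultra_proper _ _ ultra_natU.

Lemma ultra_nat_oo : \oo `<=` ultra_nat.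
Proof. by rewrite /ultra_nat; case: cid => U []. Qed.

Definition ulim (x : nat -> R) : R := lim (x @ ultra_nat).

(** Boundedness puts the image ultrafilter on a compact segment; it has a cluster point there, and
    an ultrafilter converges to each of its cluster points. *)
Lemma ulim_cvg (x : nat -> R) (B : R) : (forall n, `|x n| <= B) ->
  x @ ultra_nat --> ulim x.
Proof.
move=> xB; have /(_ (x @ ultra_nat) _) [] := @segment_compact R (- B) B.
  suff : ultra_nat [set n | `[- B, B]%classic (x n)] by [].
  by apply: filterE => n /=; rewrite in_itv /= -ler_norml.
move=> l [_ xl]; rewrite /ulim; apply: (cvgP l) => A lA.
have [//|UA] := in_ultra_setVsetC (x @^-1` A) ultra_natU.
have UA' : (x @ ultra_nat) (~` A) by [].
by have [? []] := xl _ _ UA' lA.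
Qed.

Lemma ulim_eq (x : nat -> R) (l : R) : x @ ultra_nat --> l -> ulim x = l.
Proof. by move=> xl; apply: cvg_lim. Qed.

(* Cesaro means make the ultrafilter limit invariant under shifts. *)
Definition cesaro (x : nat -> R) (N : nat) : R :=
  N.+1%:R^-1 * \sum_(n < N.+1) x n.

Lemma cesaro_le (x : nat -> R) (B : R) N :
  (forall n, `|x n| <= B) -> `|cesaro x N| <= B.
Proof.
move=> xB; rewrite /cesaro normrM gtr0_norm ?invr_gt0//.
rewrite mulrC ler_pdivrMr// (le_trans (ler_norm_sum _ _ _))//.
apply: (@le_trans _ _ (\sum_(n < N.+1) B)); first by apply: ler_sum => i _.
by rewrite sumr_const card_ord mulr_natr.
Qed.

Definition rLIM (x : nat -> R) : R := ulim (cesaro x).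

Lemma rLIM_cvg (x : nat -> R) (B : R) : (forall n, `|x n| <= B) ->
  cesaro x @ ultra_nat --> rLIM x.
Proof. by move=> xB; apply: (@ulim_cvg _ B) => N; exact: cesaro_le. Qed.

Lemma rLIM_lin (x y : nat -> R) (a b B : R) :
  (forall n, `|x n| <= B) -> (forall n, `|y n| <= B) ->
  rLIM (fun n => a * x n + b * y n) = a * rLIM x + b * rLIM y.
Proof.
move=> xB yB; apply: ulim_eq.
have -> : cesaro (fun n => a * x n + b * y n) =
    (fun N => a * cesaro x N + b * cesaro y N).
  apply/funext => N; rewrite /cesaro big_split /= -!mulr_sumr.
  by rewrite mulrDr mulrCA [X in _ + X]mulrCA.
by apply: cvgD; apply: cvgMr; [exact: rLIM_cvg xB|exact: rLIM_cvg yB].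
Qed.

Lemma rLIM_cst (c : R) : rLIM (fun=> c) = c.
Proof.
apply: ulim_eq; have -> : cesaro (fun=> c) = cst c.
  apply/funext => N; rewrite /cesaro sumr_const card_ord -(mulr_natr c) mulrCA.
  by rewrite mulVf ?mulr1// pnatr_eq0.
exact: cvg_cst.
Qed.

Lemma rLIM_le (x : nat -> R) (B : R) : (forall n, `|x n| <= B) ->
  `|rLIM x| <= B.
Proof.
move=> xB; have xl := rLIM_cvg xB.
rewrite leNgt; apply/negP => Bx.
have /filter_ex[N /=] : ultra_nat [set N | B < `|cesaro x N|].
  by apply: (cvgr_gt _ (cvg_norm xl)).
by apply/negP; rewrite -leNgt; exact: cesaro_le.
Qed.

(** The two Cesaro means differ by [(x N.+1 - x 0) / N.+1], at most [2 * B / N.+1] in absolute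
    value, which tends to 0 along [\oo] and so along the ultrafilter. *)
Lemma rLIM_shift (x : nat -> R) (B : R) : (forall n, `|x n| <= B) ->
  rLIM (fun n => x n.+1) = rLIM x.
Proof.
move=> xB; have xl := rLIM_cvg xB.
have xSB n : `|x n.+1| <= B by [].
have xSl := rLIM_cvg xSB.
have B0 : 0 <= B by apply: le_trans (xB 0%N).
have D0 : ulim (fun N => cesaro (fun n => x n.+1) N - cesaro x N) = 0.
  apply: ulim_eq.
  have hN : (fun N : nat => 2 * B * N.+1%:R^-1 : R) @ \oo --> (0 : R).
    by rewrite -[0](mulr0 (2 * B)); apply: cvgMr; exact: cvg_harmonic.
  apply: cvg_trans (_ : _ @ \oo --> 0); first by move=> A; exact: ultra_nat_oo.
  apply: norm_cvg0; apply: (squeeze_cvgr _ (cvg_cst 0) hN).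
  apply: nearW => N; rewrite normr_ge0 /= /cesaro -mulrBr.
  rewrite [X in _ * (X - _)]big_ord_recr [X in _ * (_ - X)]big_ord_recl /=.
  rewrite normrM gtr0_norm ?invr_gt0// mulrC ler_wpM2r ?invr_ge0//.
  rewrite (_ : _ - _ = x N.+1 - x 0%N); last by ring.
  by rewrite (le_trans (ler_normB _ _))// mulr_natl mulr2n lerD.
apply/eqP; rewrite -subr_eq0 -D0; apply/eqP/esym/ulim_eq.
exact: cvgB xSl xl.
Qed.

End UltraLimit.

Section BanachLimit.
Variable R : realType.
Local Notation K := (Cplx R).
Implicit Types x y : nat -> K.

Definition bnd x := exists B : R, forall n, rn (x n) <= B.

Definition LIM x : K :=
  Complex (rLIM (fun n => complex.Re (x n))) (rLIM (fun n => complex.Im (x n))).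

Lemma bnd_ReIm x (B : R) : (forall n, rn (x n) <= B) ->
  (forall n, `|complex.Re (x n)| <= B) /\ (forall n, `|complex.Im (x n)| <= B).
Proof.
by move=> xB; split=> n; apply: le_trans (xB n); [exact: rn_Re|exact: rn_Im].
Qed.

Lemma bnd_common x y : bnd x -> bnd y ->
  exists B : R, (forall n, rn (x n) <= B) /\ (forall n, rn (y n) <= B).
Proof.
move=> [B xB] [C yC]; exists (Num.max B C).
by split=> n; rewrite le_max ?xB ?yC ?orbT.
Qed.

Lemma LIMD x y : bnd x -> bnd y -> LIM (fun n => x n + y n) = LIM x + LIM y.
Proof.
move=> bx by_; have [B [xB yB]] := bnd_common bx by_.
have [xR xI] := bnd_ReIm xB; have [yR yI] := bnd_ReIm yB.
rewrite -[RHS]/(Complex (_ + _) (_ + _)); congr Complex.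
  have := rLIM_lin 1 1 xR yR; rewrite !mul1r => <-; congr rLIM.
  by apply/funext => n; rewrite !mul1r; case: (x n) (y n) => a b [].
have := rLIM_lin 1 1 xI yI; rewrite !mul1r => <-; congr rLIM.
by apply/funext => n; rewrite !mul1r; case: (x n) (y n) => a b [].
Qed.

Lemma LIMZ a x : bnd x -> LIM (fun n => a * x n) = a * LIM x.
Proof.
move=> [B xB]; have [xR xI] := bnd_ReIm xB; case: a => a b.
rewrite -[RHS]/(Complex (_ * _ - _ * _) (_ * _ + _ * _)); congr Complex.
  have := rLIM_lin a (- b) xR xI; rewrite mulNr => <-; congr rLIM.
  by apply/funext => n; case: (x n) => c d /=; rewrite mulNr.
have := rLIM_lin a b xI xR; rewrite /LIM => <-; congr rLIM.
by apply/funext => n; case: (x n).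
Qed.

Lemma LIM_cst c : LIM (fun=> c) = c.
Proof. by rewrite /LIM !rLIM_cst; case: c. Qed.

(** Bounding real and imaginary parts separately would lose a factor. Multiplying by the unimodular
    [a] makes the limit real and nonnegative, and then [rLIM_le] for the real parts is sharp. *)
Lemma LIM_le x (B : R) : (forall n, rn (x n) <= B) -> rn (LIM x) <= B.
Proof.
move=> xB; have B0 : 0 <= B by apply: le_trans (xB 0%N); exact: rn_ge0.
have [->|l0] := eqVneq (LIM x) 0; first by rewrite rn0.
pose a : K := rc (rn (LIM x)) / LIM x.
have ra : rn a = 1.
  by rewrite rnM rnV rn_rc ger0_norm ?rn_ge0// divff// gt_eqF// rn_gt0.
have : LIM (fun n => a * x n) = rc (rn (LIM x)).
  by rewrite LIMZ; [rewrite /a mulfVK|exists B].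
move=> /(congr1 (@complex.Re R)) /= <-.
apply: le_trans (ler_norm _) _; apply: rLIM_le => n.
by apply: le_trans (rn_Re _) _; rewrite rnM ra mul1r.
Qed.

Lemma LIM_shift x : bnd x -> LIM (fun n => x n.+1) = LIM x.
Proof.
move=> [B xB]; have [xR xI] := bnd_ReIm xB.
by rewrite /LIM; congr Complex; [exact: rLIM_shift xR|exact: rLIM_shift xI].
Qed.

Lemma bndD x y : bnd x -> bnd y -> bnd (fun n => x n + y n).
Proof.
move=> [B xB] [C yC]; exists (B + C) => n.
by rewrite (le_trans (rnD _ _)) ?lerD.
Qed.

Lemma bndZ a x : bnd x -> bnd (fun n => a * x n).
Proof.
by move=> [B xB]; exists (rn a * B) => n; rewrite rnM ler_wpM2l ?rn_ge0.
Qed.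

Lemma bndN x : bnd x -> bnd (fun n => - x n).
Proof. by move=> [B xB]; exists B => n; rewrite rnN. Qed.

Lemma bnd_cst c : bnd (fun=> c).
Proof. by exists (rn c). Qed.

Lemma LIMN x : bnd x -> LIM (fun n => - x n) = - LIM x.
Proof.
move=> bx; rewrite -mulN1r -LIMZ//; congr LIM.
by apply/funext => n; rewrite mulN1r.
Qed.

Lemma LIMB x y : bnd x -> bnd y -> LIM (fun n => x n - y n) = LIM x - LIM y.
Proof. by move=> bx by_; rewrite LIMD ?LIMN//; exact: bndN. Qed.

(** Shift invariance discards the first [N] terms, about which only boundedness is known; the
    remaining ones are within half of the supposed distance. *)
Lemma LIM_cvg x (l : K) : bnd x ->
  (forall e : R, 0 < e -> exists N, forall n, (N <= n)%N -> rn (x n - l) <= e) ->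
  LIM x = l.
Proof.
move=> bx xl; apply/eqP; rewrite -subr_eq0; apply/eqP/rn_eq0/eqP.
rewrite eq_le rn_ge0 andbT leNgt; apply/negP => e0.
have [N xN] := xl _ (divr_gt0 e0 (ltr0n R 2)).
have shiftN y : bnd y -> LIM (fun n => y (n + N)%N) = LIM y.
  elim: N {xN} => [|N IH] by_.
    by congr LIM; apply/funext => n; rewrite addn0.
  rewrite -[RHS]IH// -[RHS]LIM_shift; last first.
    by case: by_ => B yB; exists B.
  by congr LIM; apply/funext => n; rewrite addnS addSn.
have bxl : bnd (fun n => x n - l) by apply: bndD => //; exact: bnd_cst.
have := @LIM_le (fun n => x (n + N)%N - l) _ (fun n => xN _ (leq_addl n N)).
by rewrite (shiftN _ bxl) LIMB//; [rewrite LIM_cst; lra|exact: bnd_cst].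
Qed.

End BanachLimit.

Section UltraCompact.
Variable R : realType.
Local Notation K := (Cplx R).

(** Sequential compactness with convergence along [ultra_nat] itself: no subsequence has to be
    chosen, and only [rn] is involved, no topology. *)
Definition ucompact (V : normedZmodType K) (C : set V) :=
  forall w : nat -> V, (forall n, C (w n)) ->
  exists2 l, C l & forall e : R, 0 < e -> ultra_nat [set n | rn (w n - l) < e].

(** Points [w n] violating the bound [n] would converge along the ultrafilter to a point [l] of [C],
    and the local bound at [l] contradicts the violation for large [n]. Uniform bounds and uniform
    radii are both drawn from this. *)
Lemma ucompact_uniform (V : normedZmodType K) (C : set V) (Q : V -> R -> Prop) :
  ucompact C ->
  (forall w M M', M <= M' -> Q w M -> Q w M') ->
  (forall z, C z -> exists2 d : R, 0 < d &
     exists M, forall w, C w -> rn (w - z) < d -> Q w M) ->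
  exists M, forall w, C w -> Q w M.
Proof.
move=> cC Qmono Qloc; apply: contrapT => nM.
have /choice[w wP] : forall n : nat, exists w, C w /\ ~ Q w n%:R.
  move=> n; apply: contrapT => nw; apply: nM; exists n%:R => w Cw.
  by apply: contrapT => nQ; apply: nw; exists w.
have [l Cl wl] := cC w (fun n => (wP n).1).
have [d d0 [M QM]] := Qloc l Cl.
have Uge : ultra_nat [set n | M <= n%:R].
  apply: ultra_nat_oo; exists (Num.bound `|M|) => // n /= Mn.
  rewrite (le_trans (ler_norm M))// (le_trans (ltW (archi_boundP _)))//.
  by rewrite ler_nat.
have [n [/= wnl Mn]] := filter_ex (filterI (wl d d0) Uge).
by apply: (wP n).2; apply: Qmono Mn _; apply: QM => //; exact: (wP n).1.
Qed.

Lemma ucompact_closed (V : normedZmodType K) (C D : set V) :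
  ucompact C -> D `<=` C ->
  (forall z, (forall e : R, 0 < e -> exists2 w, D w & rn (w - z) < e) -> D z) ->
  ucompact D.
Proof.
move=> cC DC clD w wD; have [l Cl wl] := cC w (fun n => DC _ (wD n)).
exists l => //; apply: clD => e e0.
by have [n wnl] := filter_ex (wl e e0); exists (w n).
Qed.

Lemma ucompact_image (V W : normedZmodType K) (C : set V) (f : V -> W) :
  ucompact C ->
  (forall z, C z -> forall e : R, 0 < e -> exists2 d : R, 0 < d &
     forall w, C w -> rn (w - z) < d -> rn (f w - f z) < e) ->
  ucompact (f @` C).
Proof.
move=> cC cf w wfC.
have /choice[v vP] : forall n, exists v, C v /\ f v = w n.
  by move=> n; have [v Cv vw] := wfC n; exists v.
have [l Cl vl] := cC v (fun n => (vP n).1).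
exists (f l); first by exists l.
move=> e e0; have [d d0 dP] := cf l Cl e e0.
apply: filterS (vl d d0) => n /= vnl; rewrite -(vP n).2; apply: dP => //.
exact: (vP n).1.
Qed.

Lemma ulim_ultra (x : nat -> R) (B : R) : (forall n, `|x n| <= B) ->
  forall e, 0 < e -> ultra_nat [set n | `|x n - ulim x| < e].
Proof.
move=> /ulim_cvg xl e e0; have /cvgrPdist_lt/(_ e e0) := xl.
by apply: filterS => n /=; rewrite distrC.
Qed.

Lemma culim (x : nat -> K) (B : R) : (forall n, rn (x n) <= B) ->
  exists l : K, forall e : R, 0 < e -> ultra_nat [set n | rn (x n - l) < e].
Proof.
move=> xB; have [xR xI] := bnd_ReIm xB.
exists (Complex (ulim (fun n => complex.Re (x n))) (ulim (fun n => complex.Im (x n)))).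
move=> e e0; have e2 : 0 < e / 2 by rewrite divr_gt0.
apply: filterS (filterI (ulim_ultra xR e2) (ulim_ultra xI e2)) => n /= [].
case: (x n) => a b /= ra ib; apply: le_lt_trans (rn_ReIm _) _ => /=.
by rewrite [ltRHS](splitr e) ltrD.
Qed.

Lemma rn_limit_le (V : normedZmodType K) (x : nat -> V) (l c : V) (r : R) :
  (forall e : R, 0 < e -> ultra_nat [set n | rn (x n - l) < e]) ->
  (forall n, rn (x n - c) <= r) -> rn (l - c) <= r.
Proof.
move=> xl xr; rewrite leNgt; apply/negP => rl.
have e0 : 0 < rn (l - c) - r by rewrite subr_gt0.
have [n /= xnl] := filter_ex (xl _ e0).
by have := rn_tri (x n) l c; have := xr n; have := rnBC (x n) l; lra.
Qed.

Lemma ucompact_ball (c : K) (r : R) : ucompact [set z | rn (z - c) <= r].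
Proof.
move=> x xr; have [|l xl] := @culim x (rn c + r).
  by move=> n; have := rn_dist (x n) c; have := xr n; rewrite /=; lra.
exists l => //; exact: (rn_limit_le xl).
Qed.

Lemma ucompact_polyball m (c : 'rV[K]_m) (r : R) :
  ucompact [set z | rn (z - c) <= r].
Proof.
move=> x xr.
have xB n : rn (x n) <= rn c + r.
  by have := rn_dist (x n) c; have := xr n; rewrite /=; lra.
have /choice[l lP] : forall i : 'I_m, exists l : K, forall e : R, 0 < e ->
    ultra_nat [set n | rn (x n ord0 i - l) < e].
  move=> i; apply: (@culim _ (rn c + r)) => n.
  by apply: le_trans (xB n); exact: mx_rn_le.
have xl e : 0 < e -> ultra_nat [set n | rn (x n - \row_i l i) < e].
  move=> e0; have e2 : 0 < e / 2 by rewrite divr_gt0.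
  have : \forall n \near ultra_nat, forall i : 'I_m, rn (x n ord0 i - l i) < e / 2.
    by apply: filter_forall => i; exact: lP.
  apply: filterS => n /= xnl; apply: (@le_lt_trans _ _ (e / 2)); last by lra.
  apply: mx_le_rn => [|i]; first exact: ltW.
  by rewrite !mxE; apply/ltW/xnl.
by exists (\row_i l i) => //; exact: (rn_limit_le xl).
Qed.

End UltraCompact.

(** * Cauchy's theorem *)

Section Goursat.
Variable R : realType.
Local Notation K := (Cplx R).
Implicit Types (u v : R -> K) (a b x y w l : R).

Definition cdiff (f : K -> K) (z : K) := exists d : K,
  forall e : R, 0 < e -> exists2 s : R, 0 < s &
    forall w : K, rn w < s -> rn (f (z + w) - f z - d * w) <= e * rn w.

(** The midpoint of the [j]-th of [2 ^ n] equal parts. Midpoints make the sums exact on affine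
    functions, see [msum_affine]. *)
Definition node a b n j : R := a + (j%:R + 2^-1) * ((b - a) / 2 ^+ n).

Definition msum u a b n : K :=
  rc ((b - a) / 2 ^+ n) * \sum_(0 <= j < 2 ^ n) u (node a b n j).

Lemma natr2X n : (2 ^ n)%:R = 2 ^+ n :> R.
Proof. by rewrite natrX. Qed.

Lemma node_itv a b n j : a <= b -> (j < 2 ^ n)%N -> a <= node a b n j <= b.
Proof.
move=> ab jn; have p2 : (0 : R) < 2 ^+ n by rewrite exprn_gt0.
have q0 : 0 <= (b - a) / 2 ^+ n by rewrite divr_ge0 ?subr_ge0// ltW.
have jn' : j%:R + 2^-1 <= 2 ^+ n :> R.
  have : j.+1%:R <= (2 ^ n)%:R :> R by rewrite ler_nat.
  by rewrite -natr2X -natr1; lra.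
rewrite /node lerDl mulr_ge0 ?addr_ge0 ?invr_ge0//=.
rewrite -lerBrDl mulrCA -[leRHS]mulr1 ler_wpM2l ?subr_ge0//.
by rewrite ler_pdivrMr// mul1r.
Qed.

Lemma msum_le u a b n (B : R) : a <= b ->
  (forall t, a <= t <= b -> rn (u t) <= B) -> rn (msum u a b n) <= (b - a) * B.
Proof.
move=> ab uB; have p2 : (0 : R) < 2 ^+ n by rewrite exprn_gt0.
have q0 : 0 <= (b - a) / 2 ^+ n by rewrite divr_ge0 ?subr_ge0// ltW.
rewrite /msum rnM rn_rc ger0_norm//.
rewrite -[leLHS]mulrA ler_wpM2l ?subr_ge0// mulrC ler_pdivrMr// big_mkord.
rewrite (le_trans (@rn_sum_const _ _ _ _ B _))// ?natr2X 1?mulrC//.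
by move=> i; apply: uB; apply: node_itv.
Qed.

Lemma bnd_msum u a b (B : R) : a <= b ->
  (forall t, a <= t <= b -> rn (u t) <= B) -> bnd (msum u a b).
Proof. by move=> ab uB; exists ((b - a) * B) => n; exact: msum_le. Qed.

(** Level [n.+1] on the interval and level [n] on its two halves have the same step and the same
    nodes. *)
Lemma msum_split u a w n :
  msum u a (a + w) n.+1 = msum u a (a + w / 2) n + msum u (a + w / 2) (a + w) n.
Proof.
have p2 : (2 : R) ^+ n != 0 by rewrite expf_neq0.
have q2 : (2 : R) ^+ n.+1 = 2 * 2 ^+ n by rewrite exprS.
rewrite /msum.
have -> : (a + w - a) / 2 ^+ n.+1 = w / 2 / 2 ^+ n by rewrite q2; field.
have -> : (a + w / 2 - a) / 2 ^+ n = w / 2 / 2 ^+ n by field.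
have -> : (a + w - (a + w / 2)) / 2 ^+ n = w / 2 / 2 ^+ n by field.
rewrite -mulrDr; congr (_ * _).
rewrite (@big_cat_nat _ _ _ (2 ^ n)%N)//=; last by rewrite leq_exp2l.
congr (_ + _).
  by apply: eq_bigr => j _; congr u; rewrite /node q2; field.
rewrite -{1}[(2 ^ n)%N]add0n big_addn expnS mul2n -addnn addnK.
by apply: eq_bigr => j _; congr u; rewrite /node q2 natrD natr2X; field.
Qed.

Lemma msum_affine (c d : K) a b n :
  msum (fun t => c + d * rc t) a b n = rc (b - a) * (c + d * rc ((a + b) / 2)).
Proof.
elim: n a b => [|n IH] a b.
  rewrite /msum expn0 big_nat1 /node expr0 divr1 add0r.
  by congr (_ * (_ + _ * rc _)); field.
have {1}-> : b = a + (b - a) by ring.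
rewrite msum_split !IH.
have -> : rc (a + (b - a) / 2 - a) = rc (b - a) / 2.
  by rewrite -(rcn R 2) -rcV -rcM; congr rc; ring.
have -> : rc (a + (b - a) - (a + (b - a) / 2)) = rc (b - a) / 2.
  by rewrite -(rcn R 2) -rcV -rcM; congr rc; field.
have -> : rc ((a + b) / 2) =
    (rc ((a + (a + (b - a) / 2)) / 2) + rc ((a + (b - a) / 2 + (a + (b - a))) / 2)) / 2.
  by rewrite -rcD -[in RHS](rcn R 2) -rcV -rcM; congr rc; field.
by field.
Qed.

(* A Banach limit needs no convergence, hence no regularity of [u] beyond
   boundedness; its shift invariance gives additivity under bisection. *)
Definition intg u a b : K := LIM (msum u a b).

Lemma intg_le u a b (B : R) : a <= b ->
  (forall t, a <= t <= b -> rn (u t) <= B) -> rn (intg u a b) <= (b - a) * B.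
Proof. by move=> ab uB; apply: LIM_le => n; exact: msum_le. Qed.

Lemma intg_split u a w (B : R) : 0 <= w ->
  (forall t, a <= t <= a + w -> rn (u t) <= B) ->
  intg u a (a + w) = intg u a (a + w / 2) + intg u (a + w / 2) (a + w).
Proof.
move=> w0 uB; have aw : a <= a + w by lra.
rewrite /intg -LIM_shift; last exact: bnd_msum aw uB.
rewrite -LIMD.
- by congr LIM; apply/funext => n; rewrite msum_split.
- apply: (@bnd_msum _ _ _ B); first by lra.
  by move=> t t_ab; apply: uB; lra.
- apply: (@bnd_msum _ _ _ B); first by lra.
  by move=> t t_ab; apply: uB; lra.
Qed.

Lemma intg_affineD (c d : K) u v a b (B : R) : a <= b ->
  (forall t, a <= t <= b -> rn (v t) <= B) ->
  (forall t, u t = c + d * rc t + v t) ->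
  intg u a b = rc (b - a) * (c + d * rc ((a + b) / 2)) + intg v a b.
Proof.
move=> ab vB uE; rewrite /intg -[X in X + _]LIM_cst -LIMD; last 2 first.
- exact: bnd_cst.
- exact: bnd_msum vB.
congr LIM; apply/funext => n; rewrite -(msum_affine c d a b n) /msum -mulrDr.
by congr (_ * _); rewrite -big_split; apply: eq_bigr => j _.
Qed.

Variable h : K -> K.

(** The contour integral of [h(z) dz], counterclockwise around the rectangle with lower left corner
    [(x, y)], width [w] and height [l]: bottom, top, right and left side in this order. The factor
    [Complex 0 1] comes from [dz = i dt] on the vertical sides. *)
Definition rect_intg x y w l : K :=
  intg (fun t => h (Complex t y)) x (x + w)
  - intg (fun t => h (Complex t (y + l))) x (x + w)
  + Complex 0 1 * intg (fun t => h (Complex (x + w) t)) y (y + l)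
  - Complex 0 1 * intg (fun t => h (Complex x t)) y (y + l).

Definition in_rect x y w l (s t : R) := x <= s <= x + w /\ y <= t <= y + l.

(** Every inner edge is traversed twice in opposite directions and cancels. *)
Lemma rect_intg_split x y w l (B : R) : 0 <= w -> 0 <= l ->
  (forall s t, in_rect x y w l s t -> rn (h (Complex s t)) <= B) ->
  rect_intg x y w l =
    rect_intg x y (w / 2) (l / 2) + rect_intg (x + w / 2) y (w / 2) (l / 2) +
    rect_intg x (y + l / 2) (w / 2) (l / 2) +
    rect_intg (x + w / 2) (y + l / 2) (w / 2) (l / 2).
Proof.
move=> w0 l0 hB; rewrite /rect_intg.
have halfK a b : a + b / 2 + b / 2 = a + b by field.
rewrite !halfK.
have H t : y <= t <= y + l -> intg (fun s => h (Complex s t)) x (x + w) =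
    intg (fun s => h (Complex s t)) x (x + w / 2) +
    intg (fun s => h (Complex s t)) (x + w / 2) (x + w).
  by move=> yt; apply: (@intg_split _ _ _ B) => // s xs; apply: hB.
have V s : x <= s <= x + w -> intg (fun t => h (Complex s t)) y (y + l) =
    intg (fun t => h (Complex s t)) y (y + l / 2) +
    intg (fun t => h (Complex s t)) (y + l / 2) (y + l).
  by move=> yt; apply: (@intg_split _ _ _ B) => // t xs; apply: hB.
rewrite (H y) ?(H (y + l)) ?(V x) ?(V (x + w)); try by apply/andP; split; lra.
by ring.
Qed.

Lemma rect_arith (u v z a4 a3 a1 a2 e w l : R) :
  u <= v + a2 -> v <= z + a1 -> z <= a4 + a3 ->
  a4 <= w * (e * (w + l)) -> a3 <= w * (e * (w + l)) ->
  a1 <= l * (e * (w + l)) -> a2 <= l * (e * (w + l)) ->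
  u <= 2 * e * (w + l) ^+ 2.
Proof. by rewrite expr2; lra. Qed.

(** The affine part integrates to 0 around the rectangle, because the midpoint rule is exact on it
    and [i ^ 2 = -1]. The remainder is at most [e * (w + l)] on a boundary of length
    [2 * (w + l)]. *)
Lemma rect_intg_small x y w l s t (c d : K) (e : R) : 0 <= w -> 0 <= l ->
  in_rect x y w l s t -> 0 <= e ->
  (forall s' t', in_rect x y w l s' t' ->
    rn (h (Complex s' t') - c - d * (Complex s' t' - Complex s t))
      <= e * rn (Complex s' t' - Complex s t : K)) ->
  rn (rect_intg x y w l) <= 2 * e * (w + l) ^+ 2.
Proof.
move=> w0 l0 [xs yt] e0 hcd; pose z0 : K := Complex s t.
pose rho z := h z - c - d * (z - z0).
have ReIm p q : Complex p q = rc p + Complex 0 1 * rc q :> K.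
  rewrite /rc -[Complex 0 1 * _]/(Complex (_ - _) (_ + _)).
  rewrite -[RHS]/(Complex (_ + _) (_ + _)).
  by congr Complex => /=; ring.
have rhoB s' t' : in_rect x y w l s' t' -> rn (rho (Complex s' t')) <= e * (w + l).
  move=> st'; apply: le_trans (hcd _ _ st') _; rewrite ler_wpM2l//.
  apply: le_trans (rn_ReIm _) _ => /=; case: st' => xs' yt'.
  by apply: lerD; rewrite ler_norml; lra.
have xw : x <= x + w by lra.
have yl : y <= y + l by lra.
have hB t' : y <= t' <= y + l -> intg (fun s' => h (Complex s' t')) x (x + w) =
    rc w * (c - d * z0 + d * Complex 0 1 * rc t' + d * rc (x + w / 2)) +
    intg (fun s' => rho (Complex s' t')) x (x + w).
  move=> yt'; rewrite (@intg_affineD (c - d * z0 + d * Complex 0 1 * rc t') d _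
    (fun s' => rho (Complex s' t')) _ _ (e * (w + l)))//.
  - by congr (rc _ * (_ + _ * rc _) + _); field.
  - by move=> s' xs'; apply: rhoB.
  - by move=> s'; rewrite /rho (ReIm s' t'); ring.
have vB s' : x <= s' <= x + w -> intg (fun t' => h (Complex s' t')) y (y + l) =
    rc l * (c - d * z0 + d * rc s' + d * Complex 0 1 * rc (y + l / 2)) +
    intg (fun t' => rho (Complex s' t')) y (y + l).
  move=> xs'; rewrite (@intg_affineD (c - d * z0 + d * rc s') (d * Complex 0 1) _
    (fun t' => rho (Complex s' t')) _ _ (e * (w + l)))//.
  - by congr (rc _ * (_ + _ * rc _) + _); field.
  - by move=> t' yt'; apply: rhoB.
  - by move=> t'; rewrite /rho (ReIm s' t'); ring.
rewrite /rect_intg !hB ?vB; try by apply/andP; split; lra.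
have IhB t' : y <= t' <= y + l ->
    rn (intg (fun s' => rho (Complex s' t')) x (x + w)) <= w * (e * (w + l)).
  move=> yt'; rewrite -{2}(addrK x w) [w + x]addrC; apply: intg_le => // s' xs'.
  exact: rhoB.
have IvB s' : x <= s' <= x + w ->
    rn (intg (fun t' => rho (Complex s' t')) y (y + l)) <= l * (e * (w + l)).
  move=> xs'; rewrite -{2}(addrK y l) [l + y]addrC; apply: intg_le => // t' yt'.
  exact: rhoB.
have y1 : y <= y <= y + l by apply/andP; split; lra.
have y2 : y <= y + l <= y + l by apply/andP; split; lra.
have x1 : x <= x <= x + w by apply/andP; split; lra.
have x2 : x <= x + w <= x + w by apply/andP; split; lra.
move: (IhB _ y1) (IhB _ y2) (IvB _ x1) (IvB _ x2).
set A4 := intg _ _ _; set A3 := intg _ _ _; set A2 := intg _ _ _; set A1 := intg _ _ _.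
move=> A4B A3B A2B A1B.
rewrite (_ : _ - _ = A4 - A3 + Complex 0 1 * A1 - Complex 0 1 * A2); last first.
  have i2 : Complex 0 1 * Complex 0 1 = -1 :> K by have := @sqr_i R.
  rewrite !rcD; ring: i2.
have ri : rn (Complex 0 1 : K) = 1.
  apply/eqP; rewrite -(@eqrXn2 _ 2) ?rn_ge0//.
  by rewrite rn_sqr /= expr0n add0r expr1n.
have T1 := rnB A4 A3; have T2 := rnD (A4 - A3) (Complex 0 1 * A1).
have T3 := rnB (A4 - A3 + Complex 0 1 * A1) (Complex 0 1 * A2).
have U1 : rn (Complex 0 1 * A1) = rn A1 by rewrite rnM ri mul1r.
have U2 : rn (Complex 0 1 * A2) = rn A2 by rewrite rnM ri mul1r.
rewrite U1 in T2; rewrite U2 in T3.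
exact: rect_arith T3 T2 T1 A4B A3B A1B A2B.
Qed.

End Goursat.

Section GoursatTheorem.
Variable R : realType.
Local Notation K := (Cplx R).
Variable h : K -> K.
Implicit Types a x y w l : R.

Lemma geometric_lt (a q e : R) : 0 <= q < 1 -> 0 < e ->
  exists N : nat, forall n, (N <= n)%N -> a * q ^+ n < e.
Proof.
move=> /andP[q0 q1] e0; have nq1 : `|q| < 1 by rewrite ger0_norm.
have /cvgrPdist_lt/(_ e e0)[N _ NP] := cvg_geometric a nq1.
exists N => n /NP; rewrite /= sub0r normrN; exact: le_lt_trans (ler_norm _).
Qed.

Lemma half_pow_lt (a e : R) : 0 < e -> exists k : nat, a / 2 ^+ k < e.
Proof.
move=> e0; have [|N NP] := @geometric_lt a 2^-1 e _ e0; first by apply/andP; split; lra.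
by exists N; rewrite -exprVn; exact: NP.
Qed.

Lemma half_arith a x : 0 <= x ->
  [/\ a <= a + x / 2, a + x / 2 <= a + x & a + x / 2 + x / 2 <= a + x].
Proof. by move=> x0; split; lra. Qed.

Lemma sum4_lt_arith (u v z a b c d e : R) : u <= v + d -> v <= z + c -> z <= a + b ->
  a < e -> b < e -> c < e -> d < e -> u < 4 * e.
Proof. lra. Qed.

(** Goursat's subdivision: one of the quarters retains at least a quarter of the integral, so the
    [k]-th nested rectangle keeps [eta / 4 ^+ k], whereas differentiability at the common point
    bounds its integral by a smaller multiple of [4 ^- k]. *)
Lemma goursat x y w l (B : R) : 0 <= w -> 0 <= l ->
  (forall s t, in_rect x y w l s t -> rn (h (Complex s t)) <= B) ->
  (forall s t, in_rect x y w l s t -> cdiff h (Complex s t)) ->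
  rect_intg h x y w l = 0.
Proof.
move=> w0 l0 hB hd; apply: rn_eq0; apply/eqP; rewrite eq_le rn_ge0 andbT leNgt.
apply/negP; set eta := rn _ => eta0.
pose J k (p : R * R) := rect_intg h p.1 p.2 (w / 2 ^+ k) (l / 2 ^+ k).
pose good k (p : R * R) := [/\ x <= p.1, p.1 + w / 2 ^+ k <= x + w,
  y <= p.2, p.2 + l / 2 ^+ k <= y + l & eta / 4 ^+ k <= rn (J k p)].
pose next k (p q : R * R) := [/\ p.1 <= q.1, q.1 + w / 2 ^+ k.+1 <= p.1 + w / 2 ^+ k,
  p.2 <= q.2 & q.2 + l / 2 ^+ k.+1 <= p.2 + l / 2 ^+ k].
have pow0 (a : R) k : 0 <= a -> 0 <= a / 2 ^+ k.
  by move=> a0; rewrite divr_ge0// exprn_ge0.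
have powS (a : R) k : a / 2 ^+ k.+1 = a / 2 ^+ k / 2.
  have : (2 : R) ^+ k != 0 by rewrite expf_neq0.
  by move=> ?; rewrite exprS; field.
have /choice[step stepP] : forall kp : nat * (R * R), exists q,
    good kp.1 kp.2 -> good kp.1.+1 q /\ next kp.1 kp.2 q.
  move=> [k [p1 p2]] /=.
  have [[/= xp1 p1x yp2 p2y Jk]|ngood] := pselect (good k (p1, p2)); last by exists (0, 0).
  suff [q [gq nq]] : exists q, good k.+1 q /\ next k (p1, p2) q by exists q.
  have wk := pow0 w k w0; have lk := pow0 l k l0.
  apply: contrapT => nq.
  have small q : next k (p1, p2) q -> rn (J k.+1 q) < eta / 4 ^+ k.+1.
    move=> [/= n1 n2 n3 n4]; rewrite ltNge; apply/negP => Jq.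
    apply: nq; exists q; split; last by split.
    split; [exact: le_trans xp1 n1|exact: le_trans n2 p1x|exact: le_trans yp2 n3|
            exact: le_trans n4 p2y|exact: Jq].
  have Jsplit : J k (p1, p2) = J k.+1 (p1, p2) + J k.+1 (p1 + w / 2 ^+ k / 2, p2)
      + J k.+1 (p1, p2 + l / 2 ^+ k / 2)
      + J k.+1 (p1 + w / 2 ^+ k / 2, p2 + l / 2 ^+ k / 2).
    rewrite /J /= (@rect_intg_split _ _ _ _ _ _ B)// ?powS//.
    by move=> s t [ps pt]; apply: hB; split; lra.
  have e4 : eta / 4 ^+ k = 4 * (eta / 4 ^+ k.+1).
    have : (4 : R) ^+ k != 0 by rewrite expf_neq0.
    by move=> ?; rewrite exprS; field.
  move: Jk; rewrite e4 Jsplit; apply/negP; rewrite -ltNge.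
  set J1 := J _ _; set J2 := J _ _; set J3 := J _ _; set J4 := J _ _.
  have [a1 a2 a3] := half_arith p1 wk; have [b1 b2 b3] := half_arith p2 lk.
  have s1 : rn J1 < eta / 4 ^+ k.+1 by apply: small; split; rewrite /= ?powS ?lexx.
  have s2 : rn J2 < eta / 4 ^+ k.+1 by apply: small; split; rewrite /= ?powS ?lexx.
  have s3 : rn J3 < eta / 4 ^+ k.+1 by apply: small; split; rewrite /= ?powS ?lexx.
  have s4 : rn J4 < eta / 4 ^+ k.+1 by apply: small; split; rewrite /= ?powS ?lexx.
  exact: sum4_lt_arith (rnD (J1 + J2 + J3) J4) (rnD (J1 + J2) J3) (rnD J1 J2) s1 s2 s3 s4.
pose p := fix p k := if k is k'.+1 then step (k', p k') else (x, y).
have pgood k : good k (p k).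
  elim: k => [|k IH]; first by split; rewrite /= ?expr0 ?divr1 ?lexx// /J /= !expr0 !divr1.
  by have [] := stepP (k, p k) IH.
have pnext k : next k (p k) (p k.+1) by have [] := stepP (k, p k) (pgood k).
(* Nested intervals: left ends increase, right ends decrease, and the supremum of the left ends lies
   in all of them. *)
have mono (f : nat -> R) (c : R) : 0 <= c ->
    (forall k, f k <= f k.+1 /\ f k.+1 + c / 2 ^+ k.+1 <= f k + c / 2 ^+ k) ->
    exists s, forall k, f k <= s <= f k + c / 2 ^+ k.
  move=> c0 fP.
  have inc k j : f k <= f (k + j)%N.
    elim: j => [|j IH]; first by rewrite addn0.
    by rewrite addnS (le_trans IH)//; have [] := fP (k + j)%N.
  have dec k j : f (k + j)%N + c / 2 ^+ (k + j) <= f k + c / 2 ^+ k.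
    elim: j => [|j IH]; first by rewrite addn0.
    by rewrite addnS (le_trans _ IH)//; have [] := fP (k + j)%N.
  have ubf k : ubound (range f) (f k + c / 2 ^+ k).
    move=> _ [j _ <-]; have [kj|jk] := leqP k j.
      by have := dec k (j - k)%N; rewrite subnKC//; have := pow0 c j c0; lra.
    have := inc j (k - j)%N; rewrite subnKC ?(ltnW jk)//.
    by have := pow0 c k c0; lra.
  exists (sup (range f)) => k; apply/andP; split.
    by apply: ub_le_sup; [exists (f 0%N + c / 2 ^+ 0); exact: ubf|exists k].
  by apply: ge_sup; [exists (f 0%N), 0%N|exact: ubf].
have [s sP] : exists s, forall k, (p k).1 <= s <= (p k).1 + w / 2 ^+ k.
  by apply: mono => // k; have [] := pnext k.
have [t tP] : exists t, forall k, (p k).2 <= t <= (p k).2 + l / 2 ^+ k.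
  by apply: mono => // k; have [] := pnext k.
have st_in : in_rect x y w l s t.
  by have [xs sx ys sy _] := pgood 0%N; have := sP 0%N; have := tP 0%N; split; lra.
have [d hdP] := hd s t st_in.
(* Makes [2 * e * (w + l) ^+ 2] smaller than [eta]; the [+ 1] covers a rectangle reduced to a
   point. *)
pose e := eta / (4 * (w + l) ^+ 2 + 1).
have e0 : 0 < e by rewrite divr_gt0// ltr_wpDl// mulr_ge0 ?sqr_ge0.
have [r r0 rP] := hdP e e0.
have [k kP] := half_pow_lt (w + l) r0.
have [px xp py yp Jk] := pgood k.
have wk := pow0 w k w0; have lk := pow0 l k l0.
have Jk' : rn (J k (p k)) <= 2 * e * (w / 2 ^+ k + l / 2 ^+ k) ^+ 2.
  apply: (@rect_intg_small _ h _ _ _ _ s t (h (Complex s t)) d e) => //.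
    exact: ltW.
  move=> s' t' [ps' pt'].
  pose z1 : K := Complex s' t'; pose z0 : K := Complex s t.
  have zz : z0 + (z1 - z0) = z1 by rewrite addrC subrK.
  have := rP (z1 - z0); rewrite zz; apply.
  apply: le_lt_trans (rn_ReIm _) _; apply: le_lt_trans kP.
  rewrite mulrDl; have := sP k; have := tP k.
  by move=> ? ?; apply: lerD; rewrite ler_norml /=; lra.
have := le_trans Jk Jk'.
have -> : (w / 2 ^+ k + l / 2 ^+ k) ^+ 2 = (w + l) ^+ 2 / 4 ^+ k.
  rewrite -mulrDl exprMn exprVn -exprM mulnC exprM; congr (_ / _ ^+ _).
  by rewrite expr2; ring.
rewrite mulrA ler_pM2r ?invr_gt0 ?exprn_gt0//.
rewrite leNgt => /negP; apply; rewrite /e -mulrA mulrCA -[ltRHS]mulr1.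
rewrite -mulrA ltr_pM2l// mulrC ltr_pdivrMr ?mul1r.
  by have := sqr_ge0 (w + l); lra.
by rewrite ltr_wpDl// mulr_ge0 ?sqr_ge0.
Qed.

End GoursatTheorem.

(** * The complex exponential, which turns rectangles into annuli *)

Section ComplexExp.
Variable R : realType.
Local Notation K := (Cplx R).
Implicit Types (g f : K -> K) (r s t : R).

Lemma is_derive_eps (f : R -> R) (x df e : R) : is_derive x 1 f df -> 0 < e ->
  exists2 d : R, 0 < d &
    forall h : R, `|h| < d -> `|f (x + h) - f x - df * h| <= e * `|h|.
Proof.
move=> [fx dfE] e0.
have : (fun h : R => h^-1 *: ((f \o shift x) (h *: 1) - f x)) @ 0^' --> df.
  by rewrite -dfE; exact: fx.
move=> /cvgrPdist_le/(_ e e0)/nbhs_ballP[d /= d0 dP].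
exists d => // h hd; have [->|h0] := eqVneq h 0.
  by rewrite addr0 subrr mulr0 subrr normr0 mulr0.
have hb : ball (0 : R) d h by rewrite -ball_normE /ball_ /= sub0r normrN.
have := dP h hb h0.
rewrite /= [h *: 1]mulr1 -[_ *: _]/(_ * _) (addrC h x).
move=> H; rewrite (_ : _ - _ = h * (h^-1 * (f (x + h) - f x) - df)); last by field.
by rewrite normrM mulrC ler_wpM2r// distrC.
Qed.

Definition cis t : K := Complex (cos t) (sin t).

Lemma rn_cis t : rn (cis t) = 1.
Proof.
apply/eqP; rewrite -(@eqrXn2 _ 2) ?rn_ge0//.
by rewrite rn_sqr /= cos2Dsin2 expr1n.
Qed.

Lemma cisD s t : cis (s + t) = cis s * cis t.
Proof.
rewrite /cis cosD sinD -[RHS]/(Complex (_ * _ - _ * _) (_ * _ + _ * _)).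
by congr Complex; ring.
Qed.

Lemma cis0 : cis 0 = 1.
Proof. by rewrite /cis cos0 sin0. Qed.

Lemma cis2pi : cis (2 * pi) = 1.
Proof. by rewrite mulr_natl /cis cos2pi sin2pi. Qed.

Definition cexp (z : K) : K := rc (expR (complex.Re z)) * cis (complex.Im z).

Lemma cexpD z w : cexp (z + w) = cexp z * cexp w.
Proof.
rewrite /cexp; case: z w => a b [c d] /=.
by rewrite expRD cisD rcM; ring.
Qed.

Lemma rn_cexp z : rn (cexp z) = expR (complex.Re z).
Proof. by rewrite rnM rn_cis mulr1 rn_rc ger0_norm ?expR_ge0. Qed.

(** By the functional equation [cexpD] the derivative at 0 determines it everywhere, and at 0 the
    real derivatives of [expR], [cos] and [sin] suffice. *)
Lemma cexp0_deriv (e : R) : 0 < e -> exists2 d : R, 0 < d &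
  forall w, rn w < d -> rn (cexp w - 1 - w) <= e * rn w.
Proof.
(* The four error terms below add up to at most [6 * e1 * r], which [e / 8] absorbs; the cap 1
   serves to bound the factors [1 + a] and [sin b]. *)
move=> e0; pose e1 := Num.min (e / 8) 1.
have e10 : 0 < e1 by rewrite lt_min; apply/andP; split; lra.
have e1e : e1 <= e / 8 by rewrite ge_min lexx.
have e11 : e1 <= 1 by rewrite ge_min lexx orbT.
have [d1 d10 H1] := is_derive_eps (is_derive_expR 0) e10.
have [d2 d20 H2] := is_derive_eps (is_derive_cos 0) e10.
have [d3 d30 H3] := is_derive_eps (is_derive_sin 0) e10.
exists (Num.min (Num.min d1 d2) (Num.min d3 (e1 / 2))).
  by rewrite !lt_min d10 d20 d30 divr_gt0.
move=> [a b]; rewrite !lt_min => /andP[/andP[w1 w2] /andP[w3 w4]].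
have wa := rn_Re (Complex a b); have wb := rn_Im (Complex a b).
rewrite /= in wa wb.
have {}H1 := H1 a (le_lt_trans wa w1); have {}H2 := H2 b (le_lt_trans wb w2).
have {}H3 := H3 b (le_lt_trans wb w3).
move: H1 H2 H3; rewrite !add0r expR0 cos0 sin0 !subr0 oppr0 !mul1r mul0r !subr0 => H1 H2 H3.
rewrite (_ : cexp _ - 1 - _ =
  Complex ((expR a - 1 - a) * cos b + (1 + a) * (cos b - 1))
          ((expR a - 1) * sin b + (sin b - b))); last first.
  rewrite /cexp /rc /cis /= -[_ * _]/(Complex (_ * _ - _ * _) (_ * _ + _ * _)).
  rewrite -[LHS]/(Complex (_ - 1 - _) (_ - 0 - _)).
  by congr Complex; ring.
apply: le_trans (rn_ReIm _) _ => /=.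
set r := rn _ in w1 w2 w3 w4 wa wb *.
have E1 : `|(expR a - 1 - a) * cos b| <= e1 * r.
  rewrite normrM -[leRHS]mulr1 ler_pM// ?cos_max//.
  by rewrite (le_trans H1)// ler_wpM2l// ltW.
have E2 : `|(1 + a) * (cos b - 1)| <= 2 * (e1 * r).
  rewrite normrM ler_pM//; last by rewrite (le_trans H2)// ler_wpM2l// ltW.
  by have := ler_normD 1 a; rewrite normr1; lra.
have E3 : `|sin b - b| <= e1 * r by rewrite (le_trans H3)// ler_wpM2l// ltW.
have E4 : `|sin b| <= 2 * r.
  have := ler_normD (sin b - b) b; rewrite subrK.
  have : e1 * r <= r by rewrite ler_piMl// rn_ge0.
  by lra.
have E5 : `|expR a - 1| <= e1.
  have := ler_normD (expR a - 1 - a) a; rewrite subrK.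
  have : e1 * `|a| <= `|a| by rewrite ler_piMl.
  by lra.
have E6 : `|(expR a - 1) * sin b| <= e1 * (2 * r) by rewrite normrM ler_pM.
have E7 : e1 * r <= e / 8 * r by rewrite ler_wpM2r// rn_ge0.
have := ler_normD ((expR a - 1 - a) * cos b) ((1 + a) * (cos b - 1)).
have := ler_normD ((expR a - 1) * sin b) (sin b - b).
have r0 : 0 <= e * r by rewrite mulr_ge0 ?rn_ge0// ltW.
lra.
Qed.

Lemma cdiff_cexp z : cdiff cexp z.
Proof.
exists (cexp z) => e e0.
have p0 : 0 < rn (cexp z) by rewrite rn_cexp expR_gt0.
have [d d0 dP] := cexp0_deriv (divr_gt0 e0 p0).
exists d => // w /dP; rewrite cexpD.
rewrite (_ : _ - _ - _ * w = cexp z * (cexp w - 1 - w)); last by ring.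
by rewrite rnM => H; rewrite -ler_pdivlMl// mulrA (mulrC _^-1).
Qed.

End ComplexExp.

(** * Holomorphic functions *)

(* A box around [differentiable], which keeps [//] from trying the library hints
   for [differentiable]: they are very slow here. *)
Variant hol (K : numFieldType) (V W : normedModType K) (f : V -> W) (z : V) : Prop :=
  Hol of differentiable f z.

Lemma holP (K : numFieldType) (V W : normedModType K) (f : V -> W) (z : V) :
  hol f z <-> differentiable f z.
Proof. by split=> [[]|]. Qed.

Section HolAlgebra.
Variables (K : numFieldType) (V : normedModType K).
Implicit Types f g : V -> K.

Lemma hol_cst (c : K) z : hol (cst c : V -> K) z.
Proof. exact/holP/differentiable_cst. Qed.

Lemma hol_id z : hol (id : V -> V) z.
Proof. exact/holP/ex_diff. Qed.

Lemma holD f g z : hol f z -> hol g z -> hol (fun w => f w + g w) z.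
Proof. by move=> /holP df /holP dg; apply/holP; exact: differentiableD. Qed.

Lemma holB f g z : hol f z -> hol g z -> hol (fun w => f w - g w) z.
Proof. by move=> /holP df /holP dg; apply/holP; exact: differentiableB. Qed.

Lemma holM f g z : hol f z -> hol g z -> hol (fun w => f w * g w) z.
Proof. by move=> /holP df /holP dg; apply/holP; exact: differentiableM. Qed.

Lemma holZ f a z : hol f z -> hol (fun w => a * f w) z.
Proof. by move=> /holP df ; apply/holP; exact: differentiableZ. Qed.

Lemma holV f z : hol f z -> f z != 0 -> hol (fun w => (f w)^-1) z.
Proof. by move=> /holP df f0; apply/holP; exact: differentiableV. Qed.

Lemma holX f n z : hol f z -> hol (fun w => f w ^+ n) z.
Proof.
move=> hf; elim: n => [|n IH]; first by under eq_fun do rewrite expr0; exact: hol_cst.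
by under eq_fun do rewrite exprS; exact: holM.
Qed.

Lemma hol_comp (U W : normedModType K) (f : U -> V) (g : V -> W) z :
  hol f z -> hol g (f z) -> hol (g \o f) z.
Proof. by move=> /holP df /holP dg; apply/holP; exact: differentiable_comp. Qed.

End HolAlgebra.

Section DiffEps.
Variable R : realType.
Local Notation K := (Cplx R).
Variables V W : normedModType K.
Implicit Types f : V -> W.

Lemma diff_expand f z (e : R) : hol f z -> 0 < e ->
  exists2 d : R, 0 < d & forall w, rn w < d ->
    rn (f (z + w) - f z - 'd f z w) <= e * rn w.
Proof.
move=> /holP df e0; have [_ /eqaddoP H] := (diff_locallyP z f).1 df.
have e0' : 0 < rc e :> K by rewrite -[0]rc0 rc_lt.
have /nbhs_rn[d d0 dP] := H _ e0'.
exists d => // w wd; have := dP w; rewrite subr0 => /(_ wd).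
by rewrite /= !fctE /= !rnE -rcM rc_le opprD addrA [w + z]addrC.
Qed.

(** [L] is a bare function: linearity and the bound [C] make it a continuous linear map, which
    [diff_unique] then identifies with the differential. *)
Lemma diff_intro f z (L : V -> W) (C : R) :
  (forall a u v, L (a *: u + v) = a *: L u + L v) ->
  (forall v, rn (L v) <= C * rn v) ->
  (forall e : R, 0 < e -> exists2 d : R, 0 < d & forall w, rn w < d ->
    rn (f (z + w) - f z - L w) <= e * rn w) ->
  hol f z.
Proof.
move=> Llin Lbnd fL.
pose LH := GRing.isLinear.Build K V W *:%R L Llin.
pose LL : {linear V -> W} := HB.pack L LH.
have Lc : continuous LL.
  move=> v; apply/continuous_rn => e e0.
  exists (e / (`|C| + 1)); first by rewrite divr_gt0// ltr_wpDl.
  move=> w; rewrite ltr_pdivlMr ?ltr_wpDl// => wv.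
  rewrite -linearB; apply: le_lt_trans (Lbnd _) _; apply: le_lt_trans wv.
  by rewrite mulrC ler_wpM2l ?rn_ge0// (le_trans (ler_norm _))// lerDl.
have Lo : f \o shift z = cst (f z) + LL +o_ 0 id.
  apply/eqaddoP => e e0.
  have ere : e = rc (complex.Re e).
    move: e0; rewrite ltcE /= => /andP[/eqP + _].
    by case: e => a b /= ->.
  have [|d d0 dP] := fL (complex.Re e); first by rewrite -rc_lt -ere.
  apply/nbhs_rn; exists d => // w; rewrite subr0 => /dP.
  by rewrite !fctE /= ere !rnE -rcM rc_le opprD addrA [w + z]addrC.
apply/holP/diff_locallyP; have dL := diff_unique Lc Lo.
by split; [rewrite dL|rewrite dL].
Qed.

Lemma diff_bounded f z : hol f z ->
  exists C : R, 0 <= C /\ forall v, rn ('d f z v) <= C * rn v.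
Proof.
move=> /holP df.
have [k k0 kP] := linear_lipschitz (diff_continuous df).
have kre : k = rc (complex.Re k).
  move: k0; rewrite ltcE /= => /andP[/eqP + _].
  by case: k {kP} => a b /= ->.
exists (complex.Re k); split; first by rewrite -rc_le -kre ltW.
by move=> v; have := kP v; rewrite kre !rnE -rcM rc_le.
Qed.

Lemma hol_near f g z (d : R) : 0 < d ->
  (forall w, rn (w - z) < d -> f w = g w) ->
  hol f z -> hol g z.
Proof.
move=> d0 fg df; have [C [C0 CP]] := diff_bounded df.
have z0 : f z = g z by apply: fg; rewrite subrr rn0.
apply: (@diff_intro g z ('d f z) C _ CP) => [a u v|e e0]; first by rewrite linearP.
have [d' d'0 dP] := diff_expand df e0.
exists (Num.min d d'); first by rewrite lt_min d0.
move=> w; rewrite lt_min => /andP[wd /dP].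
by rewrite -z0 -fg// addrAC subrr add0r.
Qed.

Lemma diff_cont f z (e : R) : hol f z -> 0 < e ->
  exists2 d : R, 0 < d & forall w, rn (w - z) < d -> rn (f w - f z) < e.
Proof. by move=> /holP/differentiable_continuous /continuous_rn; exact. Qed.

End DiffEps.

Section DiffScalar.
Variable R : realType.
Local Notation K := (Cplx R).
Variables V : normedModType K.
Implicit Types f g : V -> K.

Lemma diff_slice f z v (t : K) : hol f (z + t *: v) ->
  hol (fun s : K => f (z + s *: v)) t.
Proof.
by move=> /holP df; apply/holP; apply: (@differentiable_comp _ _ _ _ (fun s : K => z + s *: v) f) => //.
Qed.

Lemma diff_translate (W : normedModType K) (f : V -> W) z v :
  hol f (z + v) -> hol (fun w => f (w + v)) z.
Proof.
by move=> /holP df; apply/holP; apply: (@differentiable_comp _ _ _ _ (fun w => w + v) f) => //.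
Qed.

Lemma diff_scale (W : normedModType K) (f : V -> W) (c z : V) (a : K) :
  hol f (c + a *: z) -> hol (fun w => f (c + a *: w)) z.
Proof.
by move=> /holP df; apply/holP; apply: (@differentiable_comp _ _ _ _ (fun w => c + a *: w) f) => //.
Qed.

Lemma hol_sum (I : Type) (r : seq I) (F : I -> V -> K) z :
  (forall i, hol (F i) z) ->
  hol (fun w => \sum_(i <- r) F i w) z.
Proof.
move=> dF; elim: r => [|i r IH].
  by under eq_fun do rewrite big_nil; exact: hol_cst.
by under eq_fun do rewrite big_cons; exact: holD.
Qed.

Lemma hol_prod (I : Type) (r : seq I) (F : I -> V -> K) z :
  (forall i, hol (F i) z) ->
  hol (fun w => \prod_(i <- r) F i w) z.
Proof.
move=> dF; elim: r => [|i r IH].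
  by under eq_fun do rewrite big_nil; exact: hol_cst.
by under eq_fun do rewrite big_cons; exact: holM.
Qed.

Lemma diff_cdiff (f : K -> K) z : hol f z -> cdiff f z.
Proof.
move=> df; exists ('d f z 1) => e e0.
have [d d0 dP] := diff_expand df e0; exists d => // w /dP.
have -> // : 'd f z w = 'd f z 1 * w.
have -> : 'd f z w = 'd f z (w *: (1 : K)) by congr ('d f z _); rewrite [RHS]mulr1.
by rewrite linearZ mulrC.
Qed.

Lemma cdiff_diff (f : K -> K) z : cdiff f z -> hol f z.
Proof.
move=> [d dP]; apply: (@diff_intro _ _ _ f z (fun w => d * w) (rn d)) => //.
  by move=> a u v; rewrite mulrDr -[a *: u]/(a * u) mulrCA.
by move=> v; rewrite rnM.
Qed.

End DiffScalar.

(** * Means over circles centred at 0 *)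

Section CircleMean.
Variable R : realType.
Local Notation K := (Cplx R).
Implicit Types (f g : K -> K) (r : R).

Lemma ucompact_diff_bounded (V : normedModType K) (C : set V) (f : V -> K) :
  ucompact C -> (forall z, C z -> hol f z) ->
  exists B : R, forall z, C z -> rn (f z) <= B.
Proof.
move=> cC df; apply: (@ucompact_uniform _ _ C (fun z M => rn (f z) <= M)) => //.
  by move=> w M M' MM' /le_trans; exact.
move=> z Cz; have [d d0 dP] := diff_cont (df z Cz) ltr01.
exists d => //; exists (rn (f z) + 1) => w _ /dP wz.
by have := rn_dist (f w) (f z); lra.
Qed.

Definition cnode r n j : K := rc r * cis (node 0 (2 * pi) n j).

Definition csum g r n : K := rc ((2 ^+ n)^-1) * \sum_(0 <= j < 2 ^ n) g (cnode r n j).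

(** Plays the role of the integral of [g(z) dz / (2 pi i z)] over the circle. The angles are the
    nodes of [intg], so that [intg_circle] compares the two term by term. *)
Definition mean g r : K := LIM (csum g r).

Definition cbnd g r := exists B : R, forall z, rn z = r -> rn (g z) <= B.

Lemma rn_cnode r n j : 0 <= r -> rn (cnode r n j) = r.
Proof. by move=> r0; rewrite rnM rn_rc rn_cis mulr1 ger0_norm. Qed.

Lemma csum_le g r n (B : R) : 0 <= r -> (forall z, rn z = r -> rn (g z) <= B) ->
  rn (csum g r n) <= B.
Proof.
move=> r0 gB; have p2 : (0 : R) < 2 ^+ n by rewrite exprn_gt0.
have q0 : 0 <= ((2 : R) ^+ n)^-1 by rewrite invr_ge0 ltW.
rewrite /csum rnM rn_rc ger0_norm// mulrC ler_pdivrMr// big_mkord.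
rewrite (le_trans (@rn_sum_const _ _ _ _ B _))// ?natr2X 1?mulrC//.
by move=> i; apply: gB; exact: rn_cnode.
Qed.

Lemma bnd_csum g r : 0 <= r -> cbnd g r -> bnd (csum g r).
Proof. by move=> r0 [B gB]; exists B => n; exact: csum_le. Qed.

Lemma mean_le g r (B : R) : 0 <= r -> (forall z, rn z = r -> rn (g z) <= B) ->
  rn (mean g r) <= B.
Proof. by move=> r0 gB; apply: LIM_le => n; exact: csum_le. Qed.

Lemma eq_mean g f r : 0 <= r -> (forall z, rn z = r -> g z = f z) ->
  mean g r = mean f r.
Proof.
move=> r0 gf; rewrite /mean; congr LIM; apply/funext => n; rewrite /csum.
by congr (_ * _); apply: eq_bigr => j _; apply: gf; exact: rn_cnode.
Qed.

Lemma meanD g f r : 0 <= r -> cbnd g r -> cbnd f r ->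
  mean (fun z => g z + f z) r = mean g r + mean f r.
Proof.
move=> r0 bg bf; rewrite /mean -LIMD; try exact: bnd_csum.
by congr LIM; apply/funext => n; rewrite /csum big_split mulrDr.
Qed.

Lemma meanZ g (a : K) r : 0 <= r -> cbnd g r ->
  mean (fun z => a * g z) r = a * mean g r.
Proof.
move=> r0 bg; rewrite /mean -LIMZ; last exact: bnd_csum.
by congr LIM; apply/funext => n; rewrite /csum -mulr_sumr mulrCA.
Qed.

Lemma cbndZ g a r : cbnd g r -> cbnd (fun z => a * g z) r.
Proof.
by move=> [B gB]; exists (rn a * B) => z zr; rewrite rnM ler_wpM2l ?rn_ge0 ?gB.
Qed.

Lemma meanB g f r : 0 <= r -> cbnd g r -> cbnd f r ->
  mean (fun z => g z - f z) r = mean g r - mean f r.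
Proof.
move=> r0 bg bf; rewrite -mulN1r -meanZ// -meanD//; last exact: cbndZ.
by apply: eq_mean => // z _; rewrite mulN1r.
Qed.

Lemma mean_cst (c : K) r : mean (fun=> c) r = c.
Proof.
rewrite /mean -[RHS]LIM_cst; congr LIM; apply/funext => n.
rewrite /csum big_const_nat subn0 iter_addr addr0 -(mulr_natl c) mulrA.
rewrite -rcn -rcM natr2X mulVf ?expf_neq0//; exact: mul1r.
Qed.

Lemma mean_sum (I : Type) (s : seq I) (F : I -> K -> K) r : 0 <= r ->
  (forall i, cbnd (F i) r) ->
  mean (fun z => \sum_(i <- s) F i z) r = \sum_(i <- s) mean (F i) r.
Proof.
move=> r0 bF; elim: s => [|i s IH].
  by under eq_fun do rewrite big_nil; rewrite big_nil mean_cst.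
under eq_fun do rewrite big_cons.
rewrite big_cons meanD ?IH//.
elim: s {IH} => [|j s [B IH]].
  by exists 0 => z _; rewrite big_nil rn0.
have [C CP] := bF j; exists (C + B) => z zr; rewrite big_cons.
by apply: le_trans (rnD _ _) _; rewrite lerD ?IH ?CP.
Qed.

Lemma cexp_ln r t : 0 < r -> cexp (Complex (ln r) t) = rc r * cis t.
Proof. by move=> r0; rewrite /cexp /= lnK. Qed.

Lemma intg_circle g r : 0 < r -> cbnd g r ->
  intg (fun t => g (cexp (Complex (ln r) t))) 0 (0 + 2 * pi) = rc (2 * pi) * mean g r.
Proof.
move=> r0 bg; rewrite /mean -LIMZ; last by apply: bnd_csum => //; exact: ltW.
rewrite /intg add0r; congr LIM; apply/funext => n.
rewrite /msum /csum subr0 rcM -mulrA; congr (_ * (_ * _)).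
by apply: eq_bigr => j _; rewrite cexp_ln.
Qed.

(** [cexp] maps the rectangle with sides [[ln r1, ln r2]] and [[0, 2 pi]] onto the annulus. In
    [goursat] for [g \o cexp] the horizontal sides cancel by periodicity, and the vertical ones are
    multiples of the two means. *)
Lemma mean_annulus g r1 r2 (B : R) : 0 < r1 -> r1 <= r2 ->
  (forall z, r1 <= rn z <= r2 -> hol g z) ->
  (forall z, r1 <= rn z <= r2 -> rn (g z) <= B) ->
  mean g r1 = mean g r2.
Proof.
move=> r10 r12 dg gB; have r20 : 0 < r2 by exact: lt_le_trans r12.
have pi0 : 0 < pi :> R := pi_gt0 R.
pose l := ln r2 - ln r1.
have l0 : 0 <= l by rewrite subr_ge0 ler_ln.
have annE s t : ln r1 <= s <= ln r1 + l -> r1 <= rn (cexp (Complex s t)) <= r2.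
  rewrite /l addrC subrK rn_cexp /= => /andP[s1 s2].
  have E1 : expR (ln r1) = r1 by rewrite lnK.
  have E2 : expR (ln r2) = r2 by rewrite lnK.
  by rewrite -[X in X <= _]E1 -[X in _ && (_ <= X)]E2 !ler_expR s1.
have G : rect_intg (g \o @cexp R) (ln r1) 0 l (2 * pi) = 0.
  apply: (@goursat _ _ _ _ _ _ B) => //; first by lra.
    by move=> s t [st _]; apply: gB; exact: annE.
  move=> s t [st _]; apply: diff_cdiff; apply: hol_comp.
    by apply: cdiff_diff; exact: cdiff_cexp.
  by apply: dg; exact: annE.
have [b1 b2] : cbnd g r1 /\ cbnd g r2.
  by split; exists B => z zr; apply: gB; rewrite zr ?lexx ?r12.
move: G; rewrite /rect_intg add0r.
rewrite (_ : (fun t => _ (Complex t (2 * pi))) =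
    (fun t => (g \o @cexp R) (Complex t 0))); last first.
  by apply/funext => t; rewrite /= /cexp /= cis2pi cis0.
rewrite subrr add0r -mulrBr => /eqP; rewrite mulf_eq0 => /orP[|].
  by rewrite eq_complex /= oner_eq0 andbF.
have lE : ln r1 + l = ln r2 by rewrite /l addrC subrK.
rewrite lE; have := intg_circle r10 b1; have := intg_circle r20 b2.
rewrite add0r /= => -> ->; rewrite -mulrBr mulf_eq0 => /orP[|].
  have : rc (2 * pi) != 0 :> K.
    by apply/eqP => /(@rc_inj R); apply/eqP; rewrite gt_eqF// mulr_gt0.
  by move=> /negbTE ->.
by rewrite subr_eq0 => /eqP.
Qed.

End CircleMean.

(** * Cauchy's formula and Taylor expansion on a disc *)

Section CauchyTaylor.
Variable R : realType.
Local Notation K := (Cplx R).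
Implicit Types (f g : K -> K) (r s : R).

Lemma ucompact_unif_cont (V W : normedZmodType K) (C : set V) (g : V -> W) (e : R) :
  ucompact C -> 0 < e ->
  (forall z, C z -> forall e : R, 0 < e -> exists2 d : R, 0 < d &
     forall w, C w -> rn (w - z) < d -> rn (g w - g z) < e) ->
  exists2 d : R, 0 < d &
    forall z w, C z -> C w -> rn (w - z) < d -> rn (g w - g z) < e.
Proof.
move=> cC e0 gc.
(* [M] stands for the reciprocal of a radius, since [ucompact_uniform] wants a property that
   persists when [M] grows. *)
pose Q z M := forall d, 0 < d -> d * M <= 1 ->
  forall w, C w -> rn (w - z) < d -> rn (g w - g z) < e.
have [M MQ] : exists M, forall z, C z -> Q z M.
  apply: ucompact_uniform => // [z M M' MM' QM d d0 dM'|z Cz].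
    by apply: QM => //; apply: le_trans dM'; rewrite ler_wpM2l// ltW.
  have [d d0 dP] := gc z Cz (e / 2) (divr_gt0 e0 (ltr0n R 2)).
  exists (d / 2); first by rewrite divr_gt0.
  exists (2 / d) => w Cw wz d1 d10; rewrite mulrA ler_pdivrMr// mul1r => d1d v Cv vw.
  have gvz : rn (g v - g z) < e / 2.
    by apply: dP => //; have := rn_tri w v z; lra.
  have gwz : rn (g w - g z) < e / 2 by apply: dP => //; lra.
  by have := rn_tri (g z) (g v) (g w); have := rnBC (g z) (g w); lra.
have d0 : 0 < (`|M| + 1)^-1 by rewrite invr_gt0 ltr_wpDl.
have dM : (`|M| + 1)^-1 * M <= 1.
  rewrite mulrC ler_pdivrMr ?ltr_wpDl// mul1r (le_trans (ler_norm _))//.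
  by rewrite lerDl.
by exists (`|M| + 1)^-1 => // z w Cz Cw; exact: (MQ z Cz _ d0 dM).
Qed.

(* Holomorphy of [g] is not required on the circle of radius [s]: the circle
   means are locally constant off [s] and continuous in the radius. *)
Lemma mean_value g r s : 0 < r -> 0 <= s < r ->
  (forall z, rn z <= r -> forall e : R, 0 < e -> exists2 d : R, 0 < d &
     forall w, rn (w - z) < d -> rn (g w - g z) < e) ->
  (forall z, rn z <= r -> rn z != s -> z != 0 -> hol g z) ->
  mean g r = g 0.
Proof.
move=> r0 /andP[s0 sr] gc dg.
pose C := [set z : K | rn (z - 0) <= r].
have cC : ucompact C by exact: ucompact_ball.
have CE z : C z <-> rn z <= r by rewrite /C /= subr0.
have gcC z : C z -> forall e : R, 0 < e -> exists2 d : R, 0 < d &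
     forall w, C w -> rn (w - z) < d -> rn (g w - g z) < e.
  move=> /CE zr e e0; have [d d0 dP] := gc z zr e e0.
  by exists d => // w _; exact: dP.
have [B gB] : exists B, forall z, C z -> rn (g z) <= B.
  apply: (@ucompact_uniform _ _ C (fun z M => rn (g z) <= M)) => //.
    by move=> w M M' MM' /le_trans; exact.
  move=> z Cz; have [d d0 dP] := gcC z Cz 1 ltr01.
  exists d => //; exists (rn (g z) + 1) => w Cw /(dP w Cw) wz.
  by have := rn_dist (g w) (g z); lra.
have bg t : t <= r -> cbnd g t by move=> tr; exists B => z zt; apply/gB/CE; rewrite zt.
have ann a b : 0 < a -> a <= b <= r -> (b < s) || (s < a) -> mean g a = mean g b.
  move=> a0 /andP[ab br] sab; apply: (@mean_annulus _ _ _ _ B) => // z /andP[az zb].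
    apply: dg; first exact: le_trans br.
      apply/eqP => zs; move: sab az zb; rewrite zs => /orP[|]; lra.
    by apply/eqP => z0; move: az; rewrite z0 rn0; lra.
  by apply/gB/CE; exact: le_trans br.
apply/eqP; rewrite -subr_eq0; apply/eqP/rn_eq0/eqP; rewrite eq_le rn_ge0 andbT.
apply/ler_addgt0Pr => e e0; rewrite add0r.
have [h h0 hE] : exists2 h, 0 < h & h + h = e.
  by exists (e / 2); [rewrite divr_gt0|field].
have [d d0 dP] := ucompact_unif_cont cC h0 gcC.
have cont a b : 0 <= a <= r -> 0 <= b <= r -> `|a - b| < d ->
    rn (mean g a - mean g b) <= h.
  move=> /andP[a0 ar] /andP[b0 br] abd.
  rewrite /mean -LIMB; try by apply: bnd_csum => //; exact: bg.
  apply: LIM_le => n; rewrite /csum -mulrBr -sumrB.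
  have p2 : (0 : R) < 2 ^+ n by rewrite exprn_gt0.
  have q0 : 0 <= ((2 : R) ^+ n)^-1 by rewrite invr_ge0 ltW.
  rewrite rnM rn_rc ger0_norm// mulrC ler_pdivrMr// big_mkord.
  rewrite (le_trans (@rn_sum_const _ _ _ _ (h) _))// ?natr2X 1?mulrC//.
  move=> i; apply/ltW.
 apply: dP.
  - by apply/CE; rewrite rn_cnode.
  - by apply/CE; rewrite rn_cnode.
  - by rewrite /cnode -mulrBl rnM rn_cis mulr1 -rcN -rcD rn_rc.
have mean0 : mean g 0 = g 0.
  have g0 z : rn z = 0 -> g z = g 0 by move=> /rn_eq0 ->.
  by rewrite (eq_mean (lexx 0) g0) mean_cst.
rewrite -mean0.
have [s_eq0|s_gt0] := eqVneq s 0.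
  pose a := Num.min d r / 2.
  have ad : a < d by rewrite /a ltr_pdivrMr// mulr_natr mulr2n; have : Num.min d r <= d; [rewrite ge_min lexx|lra].
  have ar : a < r by rewrite /a ltr_pdivrMr// mulr_natr mulr2n; have : Num.min d r <= r; [rewrite ge_min lexx orbT|lra].
  have a0 : 0 < a by rewrite divr_gt0// lt_min d0.
  rewrite -(@ann a r)//; last by rewrite s_eq0 a0 orbT.
    apply: le_trans (cont a 0 _ _ _) _; try by rewrite ?lexx /= ltW.
    - by apply/andP; split; lra.
    - by rewrite subr0 gtr0_norm.
    - by lra.
  by apply/andP; split; lra.
have {}s_gt0 : 0 < s by rewrite lt0r s_gt0.
(* From radius 0 to [q] and from [s - q] to [s + q] the mean changes by at most [h] each; from [q]
   to [s - q] and from [s + q] to [r] it is constant. The divisor 4 ensures [2 * q < d] and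
   [q < s - q]. *)
pose q := Num.min (Num.min d s) (r - s) / 4.
have q0 : 0 < q by rewrite divr_gt0// !lt_min d0 s_gt0 subr_gt0.
have [qd qs qr] : [/\ 4 * q <= d, 4 * q <= s & 4 * q <= r - s].
  rewrite /q mulrC divfK//; split; first by rewrite !ge_min lexx.
    by rewrite !ge_min lexx orbT.
  by rewrite ge_min lexx orbT.
have E1 : rn (mean g q - mean g 0) <= h.
  apply: cont; try by apply/andP; split; lra.
  by rewrite subr0 gtr0_norm//; lra.
have E2 : mean g q = mean g (s - q).
  apply: ann => //; first by clear -qs q0 sr; apply/andP; split; lra.
  by apply/orP; left; clear -q0; lra.
have E3 : rn (mean g (s + q) - mean g (s - q)) <= h.
  apply: cont; try by apply/andP; split; lra.
  by rewrite (_ : _ - _ = 2 * q); [rewrite gtr0_norm//; lra|ring].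
have E4 : mean g (s + q) = mean g r.
  apply: ann; first by clear -q0 s_gt0; lra.
    by clear -qr q0; apply/andP; split; lra.
  by apply/orP; right; clear -q0; lra.
move: E3; rewrite E4 -E2 => E3.
apply: le_trans (rn_tri (mean g q) _ _) _.
by rewrite -hE lerD.
Qed.

(** Since [z / (z - w) = 1 + w / (z - w)], it remains to treat the second term; its mean does not
    depend on the radius beyond [rn w] and tends to 0 as the radius grows. *)
Lemma mean_kernel (w : K) r : rn w < r -> mean (fun z => z / (z - w)) r = 1.
Proof.
move=> wr; have r0 : 0 < r := le_lt_trans (rn_ge0 w) wr.
pose g z : K := w / (z - w).
have zw_neq0 z : rn w < rn z -> z - w != 0.
  by apply: contraTneq => /subr0_eq ->; rewrite ltxx.
have gB z r1 : rn w < r1 -> r1 <= rn z -> rn (g z) <= rn w / (r1 - rn w).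
  move=> wr1 r1z; rewrite /g rnM rnV ler_wpM2l ?rn_ge0//.
  have := rn_dist z w => ?; rewrite lef_pV2 ?posrE; lra.
have bg r1 : rn w < r1 -> cbnd g r1.
  by move=> wr1; exists (rn w / (r1 - rn w)) => z zr1; apply: gB; rewrite ?zr1.
have -> : mean (fun z => z / (z - w)) r = 1 + mean g r.
  rewrite -(mean_cst 1 r) -meanD//; [|exact: ltW|by exists 1 => z _; rewrite rn1|exact: bg].
  apply: eq_mean => [|z zr]; first exact: ltW.
  rewrite /g; have : z - w != 0 by apply: zw_neq0; rewrite zr.
  by move=> ?; field.
suff -> : mean g r = 0 by rewrite addr0.
apply: rn_eq0; apply/eqP; rewrite eq_le rn_ge0 andbT.
apply/ler_addgt0Pr => e e0; rewrite add0r.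
pose r2 := r + (rn w / e + rn w).
have w0 := rn_ge0 w.
have we0 : 0 <= rn w / e by rewrite divr_ge0// ltW.
have -> : mean g r = mean g r2.
  apply: (@mean_annulus _ _ _ _ (rn w / (r - rn w))) => // [|z /andP[rz _]|z /andP[rz _]].
  - by rewrite /r2; lra.
  - have zw : z - w != 0 by apply: zw_neq0; exact: lt_le_trans rz.
    apply: holM; first exact: hol_cst.
    by apply: holV.
  - exact: gB.
apply: mean_le => [|z zr2]; first by rewrite /r2; lra.
apply: le_trans (gB z r2 _ _) _; rewrite ?zr2 /r2//; first by lra.
rewrite ler_pdivrMr; last by lra.
have -> : e * (r + (rn w / e + rn w) - rn w) = rn w + e * r by field; lra.
by rewrite lerDl mulr_ge0// ltW.
Qed.

(** [mean_value] is applied to [z (f z - f w) / (z - w)], which extends continuously to [w] and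
    takes the value 0 at 0. The circle through [w] is the exceptional one allowed there;
    [mean_kernel] evaluates the term with [f w]. *)
Lemma cauchy_formula f r (w : K) : rn w < r ->
  (forall z, rn z <= r -> hol f z) ->
  f w = mean (fun z => f z * (z / (z - w))) r.
Proof.
move=> wr df; have r0 : 0 < r := le_lt_trans (rn_ge0 w) wr.
pose d := 'd f w 1.
pose g z : K := if z == w then d * w else (f z - f w) / (z - w) * z.
have dfw : hol f w by apply: df; exact: ltW.
have dg z : rn z <= r -> z != w -> hol g z.
  move=> zr zw; have zw0 : 0 < rn (z - w) by rewrite rn_gt0// subr_eq0.
  have dq : hol (fun z => (f z - f w) / (z - w) * z) z.
    apply: holM; last exact: hol_id.
    apply: holM; first by apply: holB; [exact: df|exact: hol_cst].
    apply: holV; last by rewrite subr_eq0.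
    by apply: holB; [exact: hol_id|exact: hol_cst].
  apply: (hol_near zw0 _ dq) => v vz; rewrite /g; case: eqVneq => // vw.
  by move: vz; rewrite vw rnBC ltxx.
have : mean g r = g 0.
  apply: (@mean_value g r (rn w)) => //; first by rewrite rn_ge0.
    move=> z zr e e0; have [->|zw] := eqVneq z w; last first.
      by apply: diff_cont => //; exact: dg.
    pose e1 := e / (2 * (rn w + 1)).
    have w0 := rn_ge0 w.
    have e10 : 0 < e1 by rewrite divr_gt0// mulr_gt0//; lra.
    have [c c0 cP] := diff_expand dfw e10.
    have d1 : 0 < rn d + 1 by have := rn_ge0 d; lra.
    exists (Num.min (Num.min c 1) (e / 2 / (rn d + 1))).
      by rewrite !lt_min c0 ltr01 !divr_gt0.
    move=> v; rewrite !lt_min => /andP[/andP[vc v1] vd].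
    rewrite /g eqxx; case: eqVneq => [_|vw]; first by rewrite subrr rn0.
    have vw0 : v - w != 0 by rewrite subr_eq0.
    have := cP (v - w) vc; rewrite (addrC w) subrK.
    have -> : 'd f w (v - w) = d * (v - w).
      have -> : 'd f w (v - w) = 'd f w ((v - w) *: (1 : K)).
        by congr ('d f w _); rewrite [RHS]mulr1.
      by rewrite linearZ mulrC.
    set D := f v - f w - _ => DB.
    have -> : (f v - f w) / (v - w) * v - d * w = D / (v - w) * v + d * (v - w).
      by rewrite /D; field.
    have DB' : rn (D / (v - w)) <= e1.
      by rewrite rnM rnV ler_pdivrMr// rn_gt0.
    have vB : rn v <= rn w + 1 by have := rn_dist v w; lra.
    have M1 : rn (D / (v - w) * v) <= e / 2.
      rewrite rnM; apply: (@le_trans _ _ (e1 * (rn w + 1))).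
        by rewrite ler_pM ?rn_ge0.
      by rewrite le_eqVlt; apply/orP; left; apply/eqP; rewrite /e1; field; lra.
    have M2 : rn (d * (v - w)) < e / 2.
      rewrite rnM; move: vd; rewrite ltr_pdivlMr//.
      by have := rn_ge0 (v - w); have := rn_ge0 d; nra.
    by have := rnD (D / (v - w) * v) (d * (v - w)); lra.
  move=> z zr zw _; apply: dg => //.
  by apply: contra zw => /eqP ->.
have -> : g 0 = 0.
  by rewrite /g; case: eqVneq => [<-|_]; rewrite mulr0.
have [B fB] : exists B : R, forall z, rn z <= r -> rn (f z) <= B.
  have [B BP] := ucompact_diff_bounded (@ucompact_ball R 0 r) (f := f)
    (ltac:(by move=> z; rewrite /= subr0; exact: df)).
  by exists B => z zr; apply: BP; rewrite /= subr0.
have kB z : rn z = r -> rn (z / (z - w)) <= r / (r - rn w).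
  move=> zr; rewrite rnM rnV zr ler_wpM2l//; first exact: ltW.
  by have := rn_dist z w; rewrite zr => ?; rewrite lef_pV2 ?posrE; lra.
have bk : cbnd (fun z : K => z / (z - w)) r by exists (r / (r - rn w)).
have -> : mean g r = mean (fun z => f z * (z / (z - w)) - f w * (z / (z - w))) r.
  apply: eq_mean => [|z zr]; first exact: ltW.
  rewrite /g ifN; last by apply: contraTneq wr => <-; rewrite zr ltxx.
  by ring.
rewrite meanB ?meanZ ?mean_kernel ?mulr1//; try exact: ltW.
- by move/eqP; rewrite subr_eq0 => /eqP.
- exists (B * (r / (r - rn w))) => z zr; rewrite rnM ler_pM ?rn_ge0 ?kB//.
  by rewrite fB ?zr.
- exact: cbndZ.
Qed.

(** Cauchy's integral for the [k]-th Taylor coefficient at 0. By [tcoef_indep] the radius can be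
    varied inside a disc of holomorphy, so coefficients are compared on small circles and estimated
    on large ones. *)
Definition tcoef f (k : nat) r : K := mean (fun z => f z / z ^+ k) r.

Lemma cbnd_tcoef f k r (B : R) : 0 < r -> (forall z, rn z = r -> rn (f z) <= B) ->
  forall z, rn z = r -> rn (f z / z ^+ k) <= B / r ^+ k.
Proof.
move=> r0 fB z zr; rewrite rnM rnV rnX zr ler_wpM2r ?fB//.
by rewrite invr_ge0 exprn_ge0// ltW.
Qed.

Lemma tcoef_le f k r (B : R) : 0 < r -> (forall z, rn z = r -> rn (f z) <= B) ->
  rn (tcoef f k r) <= B / r ^+ k.
Proof. by move=> r0 fB; apply: mean_le; [exact: ltW|exact: cbnd_tcoef]. Qed.

Lemma ball_bounded f r : (forall z, rn z <= r -> hol f z) ->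
  exists B : R, forall z, rn z <= r -> rn (f z) <= B.
Proof.
move=> df; have [|B BP] := ucompact_diff_bounded (@ucompact_ball R 0 r) (f := f).
  by move=> z; rewrite /= subr0; exact: df.
by exists B => z zr; apply: BP; rewrite /= subr0.
Qed.

Lemma tcoef_indep f k r1 r2 : 0 < r1 -> r1 <= r2 ->
  (forall z, rn z <= r2 -> hol f z) -> tcoef f k r1 = tcoef f k r2.
Proof.
move=> r10 r12 df; have [B fB] := ball_bounded df.
apply: (@mean_annulus _ _ _ _ (B / r1 ^+ k)) => // z /andP[r1z zr2].
  have z0 : z != 0 by apply: contraTneq r1z => ->; rewrite rn0 -ltNge.
  apply: holM; first exact: df.
  by apply: holV; [apply: holX; exact: hol_id|rewrite expf_neq0].
have B0 : 0 <= B by apply: le_trans (fB _ zr2); exact: rn_ge0.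
rewrite rnM rnV rnX ler_pM ?rn_ge0 ?invr_ge0 ?exprn_ge0 ?rn_ge0 ?fB//.
rewrite lef_pV2 ?posrE ?exprn_gt0//; last exact: lt_le_trans r1z.
by rewrite lerXn2r ?nnegrE ?rn_ge0// ltW.
Qed.

(** A finite geometric sum in the Cauchy kernel leaves exactly [f z * (w / z) ^+ n * (z / (z - w))]
    under the mean. *)
Lemma taylor_remainder f r (w : K) n (B : R) : rn w < r ->
  (forall z, rn z <= r -> hol f z) ->
  (forall z, rn z = r -> rn (f z) <= B) ->
  rn (f w - \sum_(0 <= k < n) tcoef f k r * w ^+ k)
    <= B * (rn w / r) ^+ n * (r / (r - rn w)).
Proof.
move=> wr df fB; have r0 : 0 < r := le_lt_trans (rn_ge0 w) wr.
have r0' := ltW r0.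
have kB z : rn z = r -> rn (z / (z - w)) <= r / (r - rn w).
  move=> zr; rewrite rnM rnV zr ler_wpM2l//.
  by have := rn_dist z w; rewrite zr => ?; rewrite lef_pV2 ?posrE; lra.
have b0 : cbnd (fun z => f z * (z / (z - w))) r.
  exists (B * (r / (r - rn w))) => z zr.
  by rewrite rnM ler_pM ?rn_ge0 ?kB ?fB.
have bk k : cbnd (fun z => w ^+ k * (f z / z ^+ k)) r.
  by apply: cbndZ; exists (B / r ^+ k); exact: cbnd_tcoef.
have -> : \sum_(0 <= k < n) tcoef f k r * w ^+ k =
    mean (fun z => \sum_(0 <= k < n) w ^+ k * (f z / z ^+ k)) r.
  rewrite mean_sum//; apply: eq_bigr => k _.
  rewrite meanZ// 1?mulrC//; exists (B / r ^+ k); exact: cbnd_tcoef.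
rewrite (cauchy_formula wr df) -meanB//; last first.
  elim: n => [|n [C IH]]; first by exists 0 => z _; rewrite big_geq// rn0.
  have [D DP] := bk n; exists (C + D) => z zr; rewrite big_nat_recr//=.
  by apply: le_trans (rnD _ _) _; rewrite lerD ?IH ?DP.
apply: mean_le => // z zr.
have zw : z - w != 0.
  by rewrite subr_eq0; apply: contraTneq wr => <-; rewrite zr ltxx.
have z0 : z != 0 by apply: contraTneq r0 => zz; rewrite -zr zz rn0 ltxx.
have -> : f z * (z / (z - w)) - \sum_(0 <= k < n) w ^+ k * (f z / z ^+ k) =
    f z * (w / z) ^+ n * (z / (z - w)).
  elim: n => [|n IH]; first by rewrite big_geq// subr0 expr0 mulr1.
  rewrite big_nat_recr//= opprD addrA IH exprS expr_div_n.
  have : z ^+ n != 0 by rewrite expf_neq0.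
  by move=> zn0; field; rewrite zw z0 zn0.
rewrite 2!rnM rnX (rnM w) rnV zr.
have wr0 : 0 <= (rn w / r) ^+ n by rewrite exprn_ge0// divr_ge0 ?rn_ge0.
by apply: ler_pM; rewrite ?kB ?mulr_ge0 ?rn_ge0// ler_wpM2r ?fB.
Qed.

End CauchyTaylor.

(** * Cauchy estimates and the identity theorem, by restriction to complex lines *)

Section HolomorphicEstimates.
Variable R : realType.
Local Notation K := (Cplx R).

Lemma max_principle (f : K -> K) (r B : R) : 0 < r ->
  (forall z, rn z <= r -> hol f z) ->
  (forall z, rn z = r -> rn (f z) <= B) -> rn (f 0) <= B.
Proof.
move=> r0 df fB; rewrite (@cauchy_formula _ f r 0)// ?rn0//.
apply: mean_le => [|z zr]; first exact: ltW.
rewrite subr0 divff ?mulr1 ?fB//.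
by apply: contraTneq r0 => z0; rewrite -zr z0 rn0 ltxx.
Qed.

Lemma tcoef0 (f : K -> K) r : 0 < r ->
  (forall z, rn z <= r -> hol f z) -> tcoef f 0 r = f 0.
Proof.
move=> r0 df; rewrite (@cauchy_formula _ f r 0)// ?rn0//.
apply: eq_mean => [|z zr]; first exact: ltW.
rewrite subr0 divff ?mulr1 ?expr0 ?divr1//.
by apply: contraTneq r0 => z0; rewrite -zr z0 rn0 ltxx.
Qed.

(** Both [a] and [d] describe the increment of [f] at one small real [t], with errors [C * t ^+ 2]
    and [h * t]; division by [t] bounds their distance. *)
Lemma tcoef1 (f : K -> K) r (d : K) : 0 < r ->
  (forall z, rn z <= r -> hol f z) ->
  (forall e : R, 0 < e -> exists2 s : R, 0 < s &
     forall t, rn t < s -> rn (f t - f 0 - d * t) <= e * rn t) ->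
  tcoef f 1 r = d.
Proof.
move=> r0 df fd; have [B fB] := ball_bounded df.
have B0 : 0 <= B by apply: le_trans (fB 0 _); rewrite ?rn_ge0 ?rn0 ?ltW.
set a := tcoef f 1 r.
apply/eqP; rewrite -subr_eq0; apply/eqP/rn_eq0/eqP; rewrite eq_le rn_ge0 andbT.
apply/ler_addgt0Pr => e e0; rewrite add0r.
have [h h0 hE] : exists2 h, 0 < h & h + h = e.
  by exists (e / 2); [rewrite divr_gt0|field].
have [s s0 sP] := fd h h0.
pose C := 2 * B / r ^+ 2.
have C0 : 0 <= C by rewrite divr_ge0 ?exprn_ge0 ?mulr_ge0// ltW.
have C1 : 0 < C + 1 by lra.
pose t := Num.min (Num.min (s / 2) (r / 2)) (h / (C + 1)).
have t0 : 0 < t by rewrite !lt_min !divr_gt0.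
have [ts tr th] : [/\ t <= s / 2, t <= r / 2 & t <= h / (C + 1)].
  by split; rewrite !ge_min lexx ?orbT.
have rt : rn (rc t) = t by rewrite rn_rc ger0_norm// ltW.
have tls : rn (rc t) < s by rewrite rt; lra.
have := sP (rc t) tls; rewrite rt => H1.
have tlr : rn (rc t) < r by rewrite rt; lra.
have fBr z : rn z = r -> rn (f z) <= B by move=> zr; apply: fB; rewrite zr.
have := taylor_remainder 2%N tlr df fBr; rewrite rt.
rewrite big_ltn// big_ltn// big_geq// tcoef0// expr0 mulr1 expr1 addr0 -/a => H2.
have H3 : B * (t / r) ^+ 2 * (r / (r - t)) <= C * t ^+ 2.
  have -> : C * t ^+ 2 = B * (t / r) ^+ 2 * 2 by rewrite /C; field; lra.
  have c0 : 0 <= B * (t / r) ^+ 2 by rewrite mulr_ge0// exprn_ge0// divr_ge0// ltW.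
  by rewrite ler_wpM2l// ler_pdivrMr; lra.
have H4 : rn ((a - d) * rc t) <= h * t + C * t ^+ 2.
  have -> : (a - d) * rc t = (f (rc t) - f 0 - d * rc t) - (f (rc t) - (f 0 + a * rc t)) by ring.
  by apply: le_trans (rnB _ _) _; lra.
move: H4; rewrite rnM rt expr2 mulrA -mulrDl ler_pM2r// => H4.
apply: le_trans H4 _.
have : C * t <= h; last by lra.
move: th; rewrite ler_pdivlMr// => th; have : C * t <= t * (C + 1); lra.
Qed.

Variable V : normedModType K.
Implicit Types (f : V -> K) (z v : V).

Lemma slice_diff f z v (r : R) : (forall u, rn (u - z) <= r -> hol f u) ->
  forall t : K, rn t * rn v <= r -> hol (fun s : K => f (z + s *: v)) t.
Proof.
by move=> df t tv; apply: diff_slice; apply: df; rewrite addrC addKr rnZ.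
Qed.

Lemma slice_deriv f z v (r : R) : 0 < r -> hol f z ->
  (forall t : K, rn t <= r -> hol (fun s : K => f (z + s *: v)) t) ->
  tcoef (fun s : K => f (z + s *: v)) 1 r = 'd f z v.
Proof.
move=> r0 dfz dh; apply: tcoef1 => // e e0.
have v1 : 0 < rn v + 1 by have := rn_ge0 v; lra.
have [d d0 dP] := diff_expand dfz (divr_gt0 e0 v1).
exists (d / (rn v + 1)); first by rewrite divr_gt0.
move=> t; rewrite ltr_pdivlMr// => td; rewrite scale0r addr0.
have td' : rn (t *: v) < d.
  by rewrite rnZ; apply: le_lt_trans td; rewrite ler_wpM2l ?rn_ge0//; lra.
have := dP (t *: v) td'; rewrite linearZ /= -[t *: 'd f z v]/(t * _) mulrC rnZ => H.
apply: le_trans H _; rewrite mulrAC -mulrA mulrA -mulrA.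
rewrite [leLHS](_ : _ = e * rn t * (rn v / (rn v + 1))); last by field; lra.
rewrite -[leRHS]mulr1 ler_wpM2l ?mulr_ge0 ?rn_ge0// ?ltW//.
by rewrite ltr_pdivrMr//; lra.
Qed.

(** Cauchy's estimate for the first coefficient of the slice [t |-> f (z + t *: v)], which stays in
    the ball for [rn t <= r / rn v]. *)
Lemma diff_bound f z v (r M : R) : 0 < r ->
  (forall u, rn (u - z) <= r -> hol f u /\ rn (f u) <= M) ->
  rn ('d f z v) <= M / r * rn v.
Proof.
move=> r0 df; have dfz : hol f z by apply: (df z _).1; rewrite subrr rn0 ltW.
have [->|v0] := eqVneq v 0; first by rewrite linear0 !rn0 mulr0.
have rv : 0 < rn v by rewrite rn_gt0.
have rrv : 0 < r / rn v by rewrite divr_gt0.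
have sl : forall t : K, rn t <= r / rn v -> rn t * rn v <= r.
  by move=> t; rewrite ler_pdivlMr.
rewrite -(@slice_deriv f z v (r / rn v))//; last first.
  by move=> t /sl; apply: slice_diff => u /df[].
apply: le_trans (@tcoef_le _ _ _ _ M _ _) _ => //.
  move=> t tr; apply: (df _ _).2; rewrite addrC addKr rnZ; apply: sl.
  by rewrite tr.
by rewrite expr1 invf_div mulrA (mulrAC M).
Qed.

(** The slice in direction [v] at [t = 1]: [taylor_remainder] with [n = 2] on the circle of radius
    [r / rn v >= 2], which makes the factor from the kernel at most 2. *)
Lemma diff_remainder f z v (r M : R) : 0 < r -> rn v <= r / 2 ->
  (forall u, rn (u - z) <= r -> hol f u /\ rn (f u) <= M) ->
  rn (f (z + v) - f z - 'd f z v) <= 2 * M / r ^+ 2 * rn v ^+ 2.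
Proof.
move=> r0 vr df; have dfz : hol f z by apply: (df z _).1; rewrite subrr rn0 ltW.
have [->|v0] := eqVneq v 0.
  by rewrite linear0 !rn0 addr0 subrr subr0 rn0 expr0n mulr0.
have rv : 0 < rn v by rewrite rn_gt0.
have rrv : 0 < r / rn v by rewrite divr_gt0.
have rrv2 : 2 <= r / rn v by rewrite ler_pdivlMr//; lra.
have M0 : 0 <= M by apply: le_trans (df z _).2; rewrite ?rn_ge0// subrr rn0 ltW.
have sl : forall t : K, rn t <= r / rn v -> rn t * rn v <= r.
  by move=> t; rewrite ler_pdivlMr.
pose h (s : K) := f (z + s *: v).
have dh : forall t : K, rn t <= r / rn v -> hol h t.
  by move=> t /sl; apply: slice_diff => u /df[].
have lt1 : rn (1 : K) < r / rn v by rewrite rn1; lra.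
have hM t : rn t = r / rn v -> rn (h t) <= M.
  by move=> tr; apply: (df _ _).2; rewrite addrC addKr rnZ; apply: sl; rewrite tr.
have := taylor_remainder 2%N lt1 dh hM; rewrite rn1.
rewrite big_ltn// big_ltn// big_geq// tcoef0// slice_deriv// expr0 expr1 !mulr1 addr0.
rewrite {1 2}/h scale1r scale0r addr0 opprD addrA => /le_trans; apply.
have -> : 2 * M / r ^+ 2 * rn v ^+ 2 = M * (1 / (r / rn v)) ^+ 2 * 2.
  by field; rewrite !gt_eqF.
have c0 : 0 <= M * (1 / (r / rn v)) ^+ 2.
  by rewrite mulr_ge0// exprn_ge0// divr_ge0// ltW.
by rewrite ler_wpM2l// ler_pdivrMr; lra.
Qed.

(* Locally bounded holomorphic functions have second-order remainders bounded
   uniformly, so that even a mere Banach limit of them is holomorphic. *)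
Lemma diff_LIM (F : nat -> V -> K) z (r M : R) : 0 < r ->
  (forall n u, rn (u - z) <= r -> hol (F n) u /\ rn (F n u) <= M) ->
  hol (fun u => LIM (fun n => F n u)) z.
Proof.
move=> r0 dF.
have bF u : rn (u - z) <= r -> bnd (fun n => F n u).
  by move=> uz; exists M => n; exact: (dF n u uz).2.
have bD v : bnd (fun n => 'd (F n) z v).
  by exists (M / r * rn v) => n; apply: diff_bound => // u; exact: dF.
have M0 : 0 <= M.
  by apply: le_trans (dF 0%N z _).2; rewrite ?rn_ge0// subrr rn0 ltW.
apply: (@diff_intro _ _ _ _ z (fun v => LIM (fun n => 'd (F n) z v)) (M / r)).
- move=> a u v; rewrite -[a *: LIM _]/(a * LIM _) -LIMZ// -LIMD//; last exact: bndZ.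
  by congr LIM; apply/funext => n; rewrite linearP.
- by move=> v; apply: LIM_le => n; apply: diff_bound => // u; exact: dF.
- move=> e e0; pose C := 2 * M / r ^+ 2.
  have C0 : 0 <= C by rewrite divr_ge0 ?exprn_ge0 ?mulr_ge0// ltW.
  have C1 : 0 < C + 1 by lra.
  exists (Num.min (r / 2) (e / (C + 1))); first by rewrite lt_min !divr_gt0.
  move=> w; rewrite lt_min => /andP[wr]; rewrite ltr_pdivlMr// => we.
  have w0 := rn_ge0 w.
  have zwz : rn (z + w - z) <= r by rewrite addrC addKr; lra.
  have zz : rn (z - z) <= r by rewrite subrr rn0 ltW.
  rewrite -!LIMB//; try exact: bF; last first.
    by apply: bndD; [exact: bF|apply: bndN; exact: bF].
  apply: LIM_le => n; apply: le_trans (diff_remainder r0 (ltW wr) (dF n)) _.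
  rewrite -/C expr2 mulrA ler_wpM2r//.
  by have : C * rn w <= rn w * (C + 1); lra.
Qed.

Lemma diff_mean (F : K -> V -> K) z (s r M : R) : 0 <= s -> 0 < r ->
  (forall t u, rn t = s -> rn (u - z) <= r ->
     hol (F t) u /\ rn (F t u) <= M) ->
  hol (fun u => mean (fun t => F t u) s) z.
Proof.
move=> s0 r0 dF; apply: (@diff_LIM (fun n u => csum (fun t => F t u) s n) z r M) => //.
move=> n u uz; split; last first.
  by apply: csum_le => // t ts; exact: (dF t u ts uz).2.
apply: holZ.
by apply: hol_sum => j; apply: (dF _ _ _ _).1 => //; exact: rn_cnode.
Qed.

Definition agree f g z := exists2 e : R, 0 < e & forall w, rn (w - z) < e -> f w = g w.

(** On the complex line through [z] and [u] the Taylor coefficients of the difference vanish, being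
    computed on a small circle where it is 0, and [t = 1] lies inside the disc of radius [rho > 1]
    where the expansion holds. *)
Lemma identity_ball f g z (r : R) :
  (forall u, rn (u - z) < r -> hol f u /\ hol g u) ->
  agree f g z -> forall u, rn (u - z) < r -> f u = g u.
Proof.
move=> dfg [s s0 fg] u uz; pose v := u - z.
have r0 : 0 < r by apply: le_lt_trans uz; exact: rn_ge0.
have [v0|v0] := eqVneq v 0.
  by apply: fg; rewrite -/v v0 rn0.
have rv : 0 < rn v by rewrite rn_gt0.
pose rho := (1 + r / rn v) / 2.
have rrv : 1 < r / rn v by rewrite ltr_pdivlMr// mul1r.
have rho1 : 1 < rho by rewrite /rho; lra.
have rhor : rho * rn v < r by rewrite -ltr_pdivlMr// /rho; lra.
pose h (t : K) := f (z + t *: v) - g (z + t *: v).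
have dh t : rn t <= rho -> hol h t.
  move=> tr; have tv : rn (z + t *: v - z) < r.
    rewrite addrC addKr rnZ; apply: le_lt_trans rhor.
    by rewrite ler_wpM2r ?rn_ge0.
  by apply: holB; apply: diff_slice; have [] := dfg _ tv.
have [B hB] := ball_bounded dh.
pose s1 := Num.min 1 (s / (2 * rn v)).
have s10 : 0 < s1 by rewrite lt_min ltr01 divr_gt0// mulr_gt0.
have a0 k : tcoef h k rho = 0.
  rewrite -(@tcoef_indep _ h k s1 rho)//; last first.
    by rewrite ge_min; apply/orP; left; exact: ltW.
  have h0 t : rn t = s1 -> h t / t ^+ k = 0.
    move=> ts; rewrite /h fg ?subrr ?mul0r// addrC addKr rnZ ts.
    apply: (@le_lt_trans _ _ (s / (2 * rn v) * rn v)).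
      by rewrite ler_wpM2r ?rn_ge0// ge_min lexx orbT.
    by rewrite (_ : _ * _ = s / 2); [lra|field; rewrite gt_eqF].
  by rewrite /tcoef (eq_mean _ h0) ?mean_cst// ltW.
have h1 : h 1 = 0.
  apply: rn_eq0; apply/eqP; rewrite eq_le rn_ge0 andbT.
  apply/ler_addgt0Pr => e e0; rewrite add0r.
  have q : 0 <= 1 / rho < 1.
    by apply/andP; split; [rewrite divr_ge0//; lra|rewrite ltr_pdivrMr; lra].
  have [n nP] := geometric_lt (B * (rho / (rho - 1))) q e0.
  have lt1 : rn (1 : K) < rho by rewrite rn1.
  have hBr t : rn t = rho -> rn (h t) <= B by move=> tr; apply: hB; rewrite tr.
  have := taylor_remainder n lt1 dh hBr; rewrite rn1.
  rewrite big1 ?subr0 => [|k _]; last by rewrite a0 mul0r.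
  move=> H.
  by apply: le_trans H _; rewrite mulrAC; apply/ltW/nP.
by move/eqP: h1; rewrite /h scale1r subr_eq0 /v addrC subrK => /eqP.
Qed.

Lemma ucompact_segment (x v : V) :
  ucompact ((fun t : R => x + rc t *: v) @` [set t : R | 0 <= t <= 1]).
Proof.
have cI : ucompact (@rc R @` [set t : R | 0 <= t <= 1]).
  apply: (@ucompact_closed _ _ [set z : K | rn (z - 0) <= 1]).
  - exact: ucompact_ball.
  - by move=> _ [t /andP[t0 t1] <-] /=; rewrite subr0 rn_rc ger0_norm.
  - move=> z zI; have im0 : complex.Im z = 0.
      apply/eqP; rewrite -normr_eq0 eq_le normr_ge0 andbT.
      apply/ler_addgt0Pr => e e0; rewrite add0r.
      have [_ [t _ <-] tz] := zI e e0.
      have := rn_Im (rc t - z); case: z tz {zI} => a b /= tz.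
      by rewrite sub0r normrN => /le_trans; apply; exact: ltW.
    have re_ t e : rn (rc t - z) < e -> `|t - complex.Re z| < e.
      by move=> tz; apply: le_lt_trans tz; have := rn_Re (rc t - z); case: z {zI im0}.
    exists (complex.Re z); last by case: z im0 {zI re_} => a b /= ->.
    apply/andP; split; apply/ler_addgt0Pr => e e0;
      have [_ [t /andP[t0 t1] <-] /re_] := zI e e0; rewrite ltr_norml; lra.
have -> : ((fun t : R => x + rc t *: v) @` [set t : R | 0 <= t <= 1]) =
    (fun s : K => x + s *: v) @` (@rc R @` [set t : R | 0 <= t <= 1]).
  by rewrite image_comp.
apply: ucompact_image => // z _ e e0.
have v1 : 0 < rn v + 1 by have := rn_ge0 v; lra.
exists (e / (rn v + 1)); first by rewrite divr_gt0.
move=> w _; rewrite ltr_pdivlMr// => wz.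
rewrite opprD addrACA subrr add0r -scalerBl rnZ; apply: le_lt_trans wz.
by rewrite ler_wpM2l ?rn_ge0//; lra.
Qed.

Lemma ucompact_radius (W : normedZmodType K) (C G : set W) : ucompact C ->
  (forall z : W, C z -> exists2 e : R, 0 < e & forall w, rn (w - z) < e -> G w) ->
  exists2 e : R, 0 < e & forall z : W, C z -> forall w, rn (w - z) < e -> G w.
Proof.
move=> cC CG.
pose Q (z : W) M := forall d, 0 < d -> d * M <= 1 -> forall w, rn (w - z) < d -> G w.
have [M MQ] : exists M, forall z : W, C z -> Q z M.
  apply: ucompact_uniform => // [z M M' MM' QM d d0 dM'|z Cz].
    by apply: QM => //; apply: le_trans dM'; rewrite ler_wpM2l// ltW.
  have [d d0 dP] := CG z Cz; exists (d / 2); first by rewrite divr_gt0.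
  exists (2 / d) => w Cw wz d1 d10; rewrite mulrA ler_pdivrMr// mul1r => d1d v vw.
  by apply: dP; have := rn_tri w v z; lra.
have d0 : 0 < (`|M| + 1)^-1 by rewrite invr_gt0 ltr_wpDl.
have dM : (`|M| + 1)^-1 * M <= 1.
  rewrite mulrC ler_pdivrMr ?ltr_wpDl// mul1r (le_trans (ler_norm _))//.
  by rewrite lerDl.
by exists (`|M| + 1)^-1 => // z Cz; exact: (MQ z Cz _ d0 dM).
Qed.

(** Continuation along a chain of balls: compactness of the segment gives them a common radius [e]
    inside [G], and [N] is so large that each centre lies in the preceding ball. *)
Lemma identity_segment f g (G : set V) (x y : V) : open G ->
  (forall u, G u -> hol f u /\ hol g u) ->
  (forall t : R, 0 <= t <= 1 -> G (x + rc t *: (y - x))) ->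
  agree f g x -> agree f g y.
Proof.
move=> /open_rn oG dfg xyG fgx.
have [|e e0 eG] := ucompact_radius (G := G) (@ucompact_segment x (y - x)).
  by move=> _ [t t01 <-]; exact: oG (xyG t t01).
pose N := (Num.bound (rn (y - x) / e)).+1.
have N0 : 0 < N%:R :> R by [].
have NP : rn (y - x) / N%:R < e.
  rewrite ltr_pdivrMr// mulrC -ltr_pdivrMr//.
  apply: le_lt_trans (ler_norm _) _.
  by apply: lt_le_trans (archi_boundP (normr_ge0 _)) _; rewrite ?ler_nat ?ger0_norm// divr_ge0 ?rn_ge0// ltW.
pose p j := x + rc (j%:R / N%:R) *: (y - x).
have step j : (j <= N)%N -> agree f g (p j).
  elim: j => [|j IH jN]; first by rewrite /p mul0r scale0r addr0.
  have jN' := IH (ltnW jN).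
  have pj : forall w, rn (w - p j) < e -> f w = g w.
    apply: identity_ball => // u uj; apply: dfg.
    apply: (eG (p j)) => //; exists (j%:R / N%:R) => //=.
    by rewrite divr_ge0// ler_pdivrMr// mul1r ler_nat ltnW.
  have pp : rn (p j.+1 - p j) < e.
    rewrite /p opprD addrACA subrr add0r -scalerBl -rcN -rcD -mulrBl -natr1 addrAC subrr add0r.
    by rewrite rnZ rn_rc ger0_norm ?divr_ge0// mulrC mulrA mulr1.
  exists (e - rn (p j.+1 - p j)); first by rewrite subr_gt0.
  by move=> w wp; apply: pj; have := rn_tri (p j.+1) w (p j); lra.
have := step N (leqnn N).
by rewrite /p divff ?gt_eqF// scale1r addrC subrK.
Qed.

End HolomorphicEstimates.

(** * The extension radius *)

Section ExtensionBall.
Variables (R : realType) (m : nat).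
Local Notation K := (Cplx R).
Local Notation V := ('rV[Cplx R]_m).
Variable D : set V.

Definition hol_on (A : set V) (f : V -> K) := forall z, A z -> hol f z.

(* The extension [F] need only agree with [f] near [z]: the ball may meet other
   parts of [D], where they can differ. *)
Definition ext_ball (z : V) (r : R) := forall f, hol_on D f ->
  exists2 F : V -> K, (forall w, rn (w - z) < r -> hol F w) & agree F f z.

End ExtensionBall.

(* Locked: unfolding the supremum makes unification of its instances diverge. *)
HB.lock Definition rad (R : realType) (m : nat) (D : set 'rV[Cplx R]_m)
    (z : 'rV[Cplx R]_m) : R :=
  sup [set r | 0 < r <= 1 /\ ext_ball D z r].

Section ExtensionRadius.
Variables (R : realType) (m : nat).
Local Notation V := ('rV[Cplx R]_m).
Variable D : set V.
Hypothesis D_open : open D.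

Local Notation ext_ball := (ext_ball D).
Local Notation rad := (rad D).

Lemma D_ball z : D z -> exists2 e : R, 0 < e & forall w, rn (w - z) < e -> D w.
Proof. by move: D_open => /open_rn; exact. Qed.

Lemma ext_ball_sub z (r : R) : 0 < r -> (forall w, rn (w - z) < r -> D w) -> ext_ball z r.
Proof.
move=> r0 zD f df; exists f; last by exists r.
by move=> w wz; apply/df/zD.
Qed.

Lemma ext_ball_le z r s : r <= s -> ext_ball z s -> ext_ball z r.
Proof.
move=> rs zs f /zs[F dF Ff]; exists F => // w wz.
by apply: dF; exact: lt_le_trans rs.
Qed.

(** An extension is tied to [f] only by its germ at the centre, so it takes the segment inside [D]
    to transport the equality of germs to [z']; lying in the ball would not suffice. *)
Lemma ext_ball_move z z' r : rn (z' - z) < r ->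
  (forall t : R, 0 <= t <= 1 -> D (z + rc t *: (z' - z))) ->
  ext_ball z r -> ext_ball z' (r - rn (z' - z)).
Proof.
move=> zr zD zext f df; have [F dF Ff] := zext f df.
exists F; first by move=> w wz'; apply: dF; have := rn_tri z' w z; lra.
apply: (@identity_segment _ _ F f (D `&` [set w | rn (w - z) < r]) z z') => //.
- apply: openI => //; apply/open_rn => w /= wz.
  exists (r - rn (w - z)); first by rewrite subr_gt0.
  by move=> u uw; have := rn_tri w u z; lra.
- by move=> u [Du /dF ?]; split => //; exact: df.
- move=> t t01; split; first exact: zD.
  rewrite /= addrC addKr rnZ rn_rc.
  have /andP[t0 t1] := t01; rewrite ger0_norm//.
  by apply: le_lt_trans zr; rewrite -[leRHS]mul1r ler_wpM2r ?rn_ge0.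
Qed.

Lemma rad_has_sup z : D z -> has_sup [set r | 0 < r <= 1 /\ ext_ball z r].
Proof.
move=> Dz; split; last by exists 1 => r [/andP[]].
have [e e0 eD] := D_ball Dz.
have m0 : 0 < Num.min e 1 by rewrite lt_min e0 ltr01.
exists (Num.min e 1); split; first by rewrite m0 ge_min lexx orbT.
apply: ext_ball_sub => // w wz; apply: eD.
by apply: lt_le_trans wz _; rewrite ge_min lexx.
Qed.

Lemma rad_ge z r : D z -> 0 < r <= 1 -> ext_ball z r -> r <= rad z.
Proof.
by move=> Dz r01 zr; rewrite unlock; apply: ub_le_sup => //; have [] := rad_has_sup Dz.
Qed.

Lemma rad_le z (B : R) : D z -> (forall r, 0 < r <= 1 -> ext_ball z r -> r <= B) ->
  rad z <= B.
Proof.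
move=> Dz H; rewrite unlock; apply: ge_sup; first by have [] := rad_has_sup Dz.
by move=> r [r01 zr]; exact: H.
Qed.

Lemma rad_le1 z : D z -> rad z <= 1.
Proof. by move=> Dz; apply: rad_le => // r /andP[]. Qed.

Lemma rad_gt0 z : D z -> 0 < rad z.
Proof.
move=> Dz; have [[r rP] _] := rad_has_sup Dz; have [/andP[r0 r1] zr] := rP.
by apply: (lt_le_trans r0); apply: rad_ge => //; rewrite r0 r1.
Qed.

Lemma rad_ext z r : D z -> r < rad z -> ext_ball z r.
Proof.
move=> Dz; rewrite unlock => rz; have [s [_ zs] rs] := sup_gt (proj1 (rad_has_sup Dz)) rz.
by apply: ext_ball_le zs; exact: ltW.
Qed.

Lemma segment_ball (z x y : V) (r : R) (t : R) : 0 <= t <= 1 ->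
  rn (x - z) < r -> rn (y - z) < r -> rn (x + rc t *: (y - x) - z) < r.
Proof.
move=> /andP[t0 t1] xz yz.
have -> : x + rc t *: (y - x) - z = rc (1 - t) *: (x - z) + rc t *: (y - z).
  by apply/rowP => i; rewrite !mxE rcD rcN rc1; ring.
apply: le_lt_trans (rnD _ _) _; rewrite !rnZ !rn_rc !ger0_norm ?subr_ge0//.
have [t1'|/eqP t1'] := eqVneq t 1; first by rewrite t1' subrr mul0r mul1r add0r.
have {t1'} : t < 1 by rewrite lt_neqAle; apply/andP; split => //; apply/eqP.
have := rn_ge0 (x - z); nra.
Qed.

Lemma rad_move z z' : D z' -> D z ->
  (forall t : R, 0 <= t <= 1 -> D (z + rc t *: (z' - z))) ->
  rad z <= rad z' + rn (z' - z).
Proof.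
move=> Dz' Dz seg; apply: rad_le => // r /andP[r0 r1] zr.
have [rz|zr'] := leP r (rn (z' - z)).
  by apply: le_trans rz _; rewrite lerDr ltW// rad_gt0.
rewrite -lerBlDr; apply: rad_ge => //; last exact: ext_ball_move.
by have := rn_ge0 (z' - z); move=> ?; apply/andP; split; lra.
Qed.

Lemma rad_lip z z' (e : R) : (forall w, rn (w - z) < e -> D w) ->
  rn (z' - z) < e -> `|rad z' - rad z| <= rn (z' - z).
Proof.
move=> eD z'z; have e0 : 0 < e by apply: le_lt_trans z'z; exact: rn_ge0.
have zz : rn (z - z) < e by rewrite subrr rn0.
have Dz := eD z zz; have Dz' := eD z' z'z.
rewrite ler_norml; apply/andP; split.
  have := @rad_move z z' Dz' Dz; rewrite lerNl opprB lerBlDl; apply.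
  by move=> t t01; apply: eD; exact: segment_ball.
have := @rad_move z' z Dz Dz'; rewrite lerBlDl rnBC; apply.
by move=> t t01; apply: eD; exact: segment_ball.
Qed.

Lemma geometric_sum_le (q : R) n : 0 <= q < 1 -> \sum_(0 <= k < n) q ^+ k <= (1 - q)^-1.
Proof.
move=> /andP[q0 q1]; rewrite -div1r ler_pdivlMr ?subr_gt0// mulrC.
have -> : (1 - q) * \sum_(0 <= k < n) q ^+ k = 1 - q ^+ n.
  elim: n => [|n IH]; first by rewrite big_geq// mulr0 expr0 subrr.
  by rewrite big_nat_recr//= mulrDr IH exprS; ring.
by rewrite gerBl exprn_ge0.
Qed.

End ExtensionRadius.

(** * The sub-mean inequality at roots of unity *)

Section DiscreteSubmean.
Variables (R : realType) (m : nat).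
Local Notation K := (Cplx R).
Local Notation V := ('rV[Cplx R]_m).
Variable D : set V.
Hypothesis D_open : open D.
Variables c b : V.
Hypothesis disc_sub : forall s : K, rn s <= 1 -> D (c + s *: b).

Definition disc_pt (s : K) : V := c + s *: b.

Lemma disc_ptB s t : rn (disc_pt s - disc_pt t) = rn (s - t) * rn b.
Proof. by rewrite /disc_pt opprD addrACA subrr add0r -scalerBl rnZ. Qed.

Lemma ucompact_disc : ucompact (disc_pt @` [set s : K | rn s <= 1]).
Proof.
apply: ucompact_image => [|z _ e e0].
  have -> : [set s : K | rn s <= 1] = [set s : K | rn (s - 0) <= 1].
    by apply/seteqP; split => s /=; rewrite subr0.
  exact: ucompact_ball.
have b1 : 0 < rn b + 1 by have := rn_ge0 b; lra.
exists (e / (rn b + 1)); first by rewrite divr_gt0.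
move=> w _; rewrite ltr_pdivlMr// disc_ptB => wz; apply: le_lt_trans wz.
by rewrite ler_wpM2l ?rn_ge0//; lra.
Qed.

Lemma ucompact_circle : ucompact [set s : K | rn s = 1].
Proof.
apply: (ucompact_closed (@ucompact_ball R 0 1)) => [s /= <-|z zC]; first by rewrite subr0.
apply/eqP; rewrite -subr_eq0 -normr_eq0 eq_le normr_ge0 andbT.
apply/ler_addgt0Pr => e e0; rewrite add0r; have [w /= w1 wz] := zC e e0.
have := rn_dist z w; have := rn_dist w z; have := rnBC w z.
by rewrite ler_norml w1; lra.
Qed.

Lemma disc_tube f : hol_on D f -> exists rho M : R, 0 < rho <= 1 /\
  forall s w, rn s <= 1 -> rn (w - disc_pt s) <= rho -> D w /\ rn (f w) <= M.
Proof.
move=> df.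
pose Q z M := forall d, 0 < d -> d * M <= 1 ->
  forall w, rn (w - z) < d -> D w /\ rn (f w) <= M.
have [M MQ] : exists M, forall z, (disc_pt @` [set s : K | rn s <= 1]) z -> Q z M.
  apply: ucompact_uniform => [|z M M' MM' QM d d0 dM'|z [s s1 <-]].
  - exact: ucompact_disc.
  - move=> w wz; have [|Dw wM] := QM d d0 _ w wz.
      by apply: le_trans dM'; rewrite ler_wpM2l// ltW.
    by split=> //; exact: le_trans MM'.
  have Dz := disc_sub s1; have [d1 d10 d1D] := D_ball D_open Dz.
  have [d2 d20 d2f] := diff_cont (df _ Dz) ltr01.
  pose d := Num.min d1 d2; have d0 : 0 < d by rewrite lt_min d10.
  exists (d / 2); first by rewrite divr_gt0.
  exists (Num.max (2 / d) (rn (f (disc_pt s)) + 1)) => w Cw wz e e0 eM v vw.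
  have ed : e * (2 / d) <= 1.
    by apply: le_trans eM; rewrite ler_wpM2l ?le_max ?lexx// ltW.
  have vd : rn (v - disc_pt s) < d.
    move: ed; rewrite mulrA ler_pdivrMr// mul1r => ed.
    by have := rn_tri w v (disc_pt s); lra.
  move: vd; rewrite lt_min => /andP[v1 v2]; split; first exact: d1D.
  rewrite le_max; apply/orP; right; have := d2f _ v2.
  by have := rn_dist (f v) (f (disc_pt s)); rewrite /disc_pt; lra.
(* [Q] is used with radius [2 * rho], so that its strict inequality covers the non-strict one
   claimed; the maximum with 1 keeps [rho] positive and at most 1. *)
pose rho := (Num.max M 1)^-1 / 2; have M1 : 0 < Num.max M 1 by rewrite lt_max ltr01 orbT.
have rho0 : 0 < rho by rewrite divr_gt0// invr_gt0.
have rhoM : 2 * rho * M <= 1.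
  have -> : 2 * rho * M = M / Num.max M 1 by rewrite /rho; field; rewrite gt_eqF.
  by rewrite ler_pdivrMr// mul1r le_max lexx.
have rho1 : rho <= 1.
  have : (Num.max M 1)^-1 <= 1 by rewrite invf_le1// le_max lexx orbT.
  by rewrite /rho; lra.
exists rho, M; split; first by rewrite rho0.
by move=> s w s1 ws; apply: (MQ (disc_pt s) _ (2 * rho)) => //; lra.
Qed.

Lemma shrunk_ball_arith (q q2 a1 a2 x y u : R) : 0 < q < 1 -> 0 <= x ->
  y <= q * a1 -> a1 - a2 <= x -> u <= y + x -> x < (q2 - q) * a2 / 2 -> u <= q2 * a2.
Proof.
move=> /andP[q0 q1] x0 ya a12 uyx xq.
have : q * (a1 - a2) <= q * x by rewrite ler_wpM2l// ltW.
have : q * x <= x by rewrite ler_piMl// ltW.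
by lra.
Qed.

(** The extensions vary with the point, yet one bound is needed for all. As [rad] is continuous, an
    extension chosen at one point of the circle also serves the nearby points, with the loss covered
    by [q < 1]; compactness does the rest. *)
Lemma circle_extension f (q : R) : hol_on D f -> 0 < q < 1 ->
  exists M : R, forall s, rn s = 1 -> exists F : V -> K,
    (forall w, rn (w - disc_pt s) <= q * rad D (disc_pt s) -> hol F w /\ rn (F w) <= M)
    /\ agree F f (disc_pt s).
Proof.
move=> df /andP[q0 q1].
pose Q s M := exists F : V -> K,
  (forall w, rn (w - disc_pt s) <= q * rad D (disc_pt s) -> hol F w /\ rn (F w) <= M)
  /\ agree F f (disc_pt s).
apply: (@ucompact_uniform _ _ [set s : K | rn s = 1] Q ucompact_circle).
  move=> s M M' MM' [F [dF Ff]]; exists F; split=> // w /dF[? FM].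
  by split=> //; exact: le_trans MM'.
move=> s /= s1; have s1' : rn s <= 1 by rewrite s1.
have Dz := disc_sub s1'; set z := disc_pt s; rewrite -/(disc_pt s) -/z in Dz.
(* Here [q < q2 < q1' < 1]: the extension exists on the ball of ratio [q1'], is bounded on the
   closed ball of ratio [q2], and [q2 - q] absorbs the displacement of the centre and the variation
   of [rad]. *)
pose q1' := (1 + q) / 2; pose q2 := (q + q1') / 2.
have qq2 : q < q2 by rewrite /q2 /q1'; lra.
have q2q1 : q2 < q1' by rewrite /q2 /q1'; lra.
have q11 : q1' < 1 by rewrite /q1'; lra.
have rad0 := rad_gt0 D_open Dz.
have qrad : q1' * rad D z < rad D z by rewrite gtr_pMl.
have [F dF [e1 e10 Ff]] : exists2 F : V -> K,
    (forall w, rn (w - z) < q1' * rad D z -> hol F w) & agree F f z.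
  exact: (rad_ext D_open Dz qrad df).
have q2rad : q2 * rad D z < q1' * rad D z by rewrite ltr_pM2r.
have [M MF] := ucompact_diff_bounded (@ucompact_polyball R m z (q2 * rad D z))
  (f := F) (fun w wz => dF w (le_lt_trans wz q2rad)).
have [e2 e20 e2D] := D_ball D_open Dz.
pose d := Num.min (Num.min e1 e2) ((q2 - q) * rad D z / 2).
have d0 : 0 < d by rewrite !lt_min e10 e20 divr_gt0// mulr_gt0// subr_gt0.
have b1 : 0 < rn b + 1 by have := rn_ge0 b; lra.
exists (d / (rn b + 1)); first by rewrite divr_gt0.
exists M => t /= t1; rewrite ltr_pdivlMr// => ts.
have tz : rn (disc_pt t - z) < d.
  rewrite disc_ptB; apply: le_lt_trans ts.
  by rewrite ler_wpM2l ?rn_ge0//; lra.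
have := tz; rewrite !lt_min => /andP[/andP[t_e1 t_e2] t_q].
exists F; split.
  move=> w wt; have wz : rn (w - z) <= q2 * rad D z.
    have := rad_lip D_open e2D t_e2; rewrite ler_norml => /andP[_ rt].
    apply: (shrunk_ball_arith _ (rn_ge0 _) wt rt (rn_tri _ _ _) t_q).
    by rewrite q0.
  split; last exact: MF.
  by apply: dF; exact: le_lt_trans wz q2rad.
exists (e1 - rn (disc_pt t - z)); first by rewrite subr_gt0.
move=> w wt; apply: Ff; apply: le_lt_trans (rn_tri (disc_pt t) _ _) _.
by rewrite -ltrBrDr.
Qed.

(* For small [sg] this is the homogeneous Taylor term of degree [k] of [f] at [x],
   evaluated at [v]. *)
Definition coef (f : V -> K) (k : nat) (sg : R) (x v : V) : K :=
  tcoef (fun t : K => f (x + t *: v)) k sg.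

Lemma coef_hol_base f k sg (x v : V) (rho M : R) : 0 < sg -> 0 < rho ->
  sg * rn v <= rho / 2 ->
  (forall w, rn (w - x) <= rho -> hol f w /\ rn (f w) <= M) ->
  hol (fun u => coef f k sg u v) x.
Proof.
move=> sg0 rho0 sv fM.
apply: (@diff_mean _ _ (fun t u => f (u + t *: v) / t ^+ k) x sg (rho / 2) (M / sg ^+ k)).
- exact: ltW.
- by rewrite divr_gt0.
move=> t u ts ux; have [fu uM] : hol f (u + t *: v) /\ rn (f (u + t *: v)) <= M.
  apply: fM; rewrite addrAC; apply: le_trans (rnD _ _) _.
  by rewrite rnZ ts; lra.
split.
  by apply: holM; [exact: diff_translate|exact: hol_cst].
by rewrite rnM rnV rnX ts ler_wpM2r// invr_ge0 exprn_ge0// ltW.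
Qed.

Lemma coef_hol_dir f k sg (x v : V) (rho r M : R) : 0 < sg -> 0 < r ->
  sg * (rn v + r) <= rho ->
  (forall w, rn (w - x) <= rho -> hol f w /\ rn (f w) <= M) ->
  hol (fun u => coef f k sg x u) v.
Proof.
move=> sg0 r0 sv fM.
apply: (@diff_mean _ _ (fun t u => f (x + t *: u) / t ^+ k) v sg r (M / sg ^+ k)) => //.
  exact: ltW.
move=> t u ts uv; have [fu uM] : hol f (x + t *: u) /\ rn (f (x + t *: u)) <= M.
  apply: fM; rewrite addrC addKr rnZ ts; apply: le_trans sv.
  by rewrite ler_wpM2l ?(ltW sg0)//; have := rn_dist u v; lra.
split.
  by apply: holM; [exact: diff_scale|exact: hol_cst].
by rewrite rnM rnV rnX ts ler_wpM2r// invr_ge0 exprn_ge0// ltW.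
Qed.

(** The circle may be enlarged without bound, and Cauchy's estimate then tends to 0. *)
Lemma tcoef_cst0 (a : K) k sg : 0 < sg -> tcoef (fun=> a) k.+1 sg = 0.
Proof.
move=> sg0; apply: rn_eq0; apply/eqP; rewrite eq_le rn_ge0 andbT.
apply/ler_addgt0Pr => e e0; rewrite add0r.
pose s := Num.max sg (rn a / e + 1).
have ae : 0 <= rn a / e by rewrite divr_ge0 ?rn_ge0// ltW.
have sgs : sg <= s by rewrite le_max lexx.
have aes : rn a / e + 1 <= s by rewrite le_max lexx orbT.
have s1 : 1 <= s by lra.
have s0 : 0 < s by lra.
have hc (z : K) : rn z <= s -> hol (fun=> a) z by move=> _; exact: hol_cst.
rewrite (tcoef_indep k.+1 sg0 sgs hc).
apply: le_trans (@tcoef_le _ _ _ _ (rn a) s0 _) _ => //.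
rewrite ler_pdivrMr ?exprn_gt0// mulrC -ler_pdivrMr//.
apply: (@le_trans _ _ s); first by lra.
by rewrite exprS ler_peMr ?exprn_ege1// ltW.
Qed.

(** The coefficient is computed from [f] on the circle of radius [sg], but the estimate comes from
    the extension [F] on its own ball. Both circles are replaced by the one of radius [s0], where
    [f] and [F] agree. *)
Lemma coef_bound f F k sg (x v : V) (rho r M : R) :
  0 < sg -> sg * rn v <= rho -> 0 < r ->
  (forall w, rn (w - x) <= rho -> hol f w) ->
  (forall w, rn (w - x) <= r -> hol F w /\ rn (F w) <= M) -> agree F f x ->
  rn (coef f k sg x v) <= M * (rn v / r) ^+ k.
Proof.
move=> sg0 sv r0 df dF [e e0 Ff].
have FM : rn (F x) <= M by apply: (dF x _).2; rewrite subrr rn0 ltW.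
have [v0|v0] := eqVneq v 0.
  have cE : (fun t : K => f (x + t *: v)) = fun=> f x.
    by apply/funext => t; rewrite v0 scaler0 addr0.
  rewrite /coef cE v0 rn0 mul0r; case: k => [|k].
    have hc (z : K) : rn z <= sg -> hol (fun=> f x) z by move=> _; exact: hol_cst.
    by rewrite expr0 mulr1 (tcoef0 sg0 hc) -Ff// subrr rn0.
  by rewrite tcoef_cst0// rn0 exprS mul0r mulr0.
have rv : 0 < rn v by rewrite rn_gt0.
have xt t : rn (x + t *: v - x) = rn t * rn v by rewrite addrC addKr rnZ.
have fh (t : K) : rn t <= sg -> hol (fun s : K => f (x + s *: v)) t.
  move=> ts; apply: diff_slice; apply: df; rewrite xt; apply: le_trans sv.
  by rewrite ler_wpM2r// ltW.
have Fh (t : K) : rn t <= r / rn v -> hol (fun s : K => F (x + s *: v)) t.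
  by rewrite ler_pdivlMr// => tr; apply: diff_slice; apply: (dF _ _).1; rewrite xt.
pose s0 := Num.min sg (Num.min (r / rn v) (e / (2 * rn v))).
have s00 : 0 < s0 by rewrite !lt_min sg0 !divr_gt0// mulr_gt0.
have [s0s s0r s0e] : [/\ s0 <= sg, s0 <= r / rn v & s0 <= e / (2 * rn v)].
  by split; rewrite !ge_min lexx ?orbT.
rewrite /coef -(tcoef_indep k s00 s0s fh).
have -> : tcoef (fun t : K => f (x + t *: v)) k s0 =
    tcoef (fun t : K => F (x + t *: v)) k s0.
  apply: eq_mean => [|t ts]; first exact: ltW.
  rewrite Ff// xt ts; move: s0e; rewrite ler_pdivlMr ?mulr_gt0//; lra.
rewrite (tcoef_indep k s00 s0r Fh).
have rrv : 0 < r / rn v by rewrite divr_gt0.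
apply: le_trans (@tcoef_le _ _ _ _ M rrv _) _.
  by move=> t tr; apply: (dF _ _).2; rewrite xt tr divfK// gt_eqF.
by rewrite -exprVn invf_div.
Qed.

Definition roots_pt (N j : nat) : K := cis (j%:R * (2 * pi) / N%:R).

(* The maximum principle is applied to the product of the Taylor terms of degree
   [k] over the rotated points, which at [s = 0] is an [N]-th power: taking
   [N]-th roots turns the product of radii into a geometric mean. *)
Lemma disc_submean (A r : R) (N : nat) : (0 < N)%N ->
  (forall s, rn s = 1 ->
     \sum_(0 <= j < N) - ln (rad D (disc_pt (roots_pt N j * s))) <= N%:R * A) ->
  0 < r < expR (- A) -> ext_ball D c r.
Proof.
move=> N0 HA /andP[r0 rA] f df.
have [rho [M0 [/andP[rho0 rho1] tube]]] := disc_tube df.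
have rA1 : r / expR (- A) < 1 by rewrite ltr_pdivrMr ?expR_gt0// mul1r.
have rA0 : 0 < r / expR (- A) by rewrite divr_gt0// expR_gt0.
have [q q01 rq] : exists2 q : R, 0 < q < 1 & r / expR (- A) < q.
  by exists ((1 + r / expR (- A)) / 2); [apply/andP; split; lra|lra].
have [M ME] := circle_extension df q01.
have /andP[q0 q1] := q01.
pose R1 := q * expR (- A).
have R10 : 0 < R1 by rewrite mulr_gt0// expR_gt0.
have rR1 : r < R1 by rewrite -ltr_pdivrMr ?expR_gt0.
have fh w : D w -> hol f w by exact: df.
have c0 : c = disc_pt 0 by rewrite /disc_pt scale0r addr0.
have rn00 : rn (0 : K) <= 1 by rewrite rn0.
have tubec w : rn (w - c) <= rho -> hol f w /\ rn (f w) <= M0.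
  by rewrite {1}c0 => /(tube 0 w rn00)[/fh].
(* The estimate at the centre has radius [R1], because by hypothesis [expR (- A)] is a lower bound
   for the geometric mean of [rad] over the rotated points. *)
have coefB k sg v : 0 < sg -> sg * rn v <= rho / 2 ->
    rn (coef f k sg c v) <= M * (rn v / R1) ^+ k.
  move=> sg0 sv; have svr : sg * rn v <= rho by lra.
  pose G (s : K) := \prod_(0 <= j < N) coef f k sg (disc_pt (roots_pt N j * s)) v.
  have rw j s : rn (roots_pt N j * s) = rn s by rewrite rnM rn_cis mul1r.
  have holG s : rn s <= 1 -> hol G s.
    move=> s1; apply: hol_prod => j.
    have -> : (fun w => coef f k sg (disc_pt (roots_pt N j * w)) v) =
        (fun w : K => (fun u => coef f k sg u v) (c + w *: (roots_pt N j *: b))).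
      by apply/funext => w; rewrite /disc_pt scalerA [w * _]mulrC.
    apply: (@diff_slice _ _ (fun u => coef f k sg u v)); rewrite scalerA [s * _]mulrC.
    apply: (@coef_hol_base f k sg (disc_pt (roots_pt N j * s)) v rho M0) => // w ws.
    have rs : rn (roots_pt N j * s) <= 1 by rewrite rw.
    by have [/fh] := tube _ _ rs ws.
  have GB s : rn s = 1 -> rn (G s) <= (M * (rn v / R1) ^+ k) ^+ N.
    move=> s1; pose x j := - ln (rad D (disc_pt (roots_pt N j * s))).
    have [C CE] : exists C : R, C = M * (rn v / q) ^+ k by eexists.
    have Cbd j : rn (coef f k sg (disc_pt (roots_pt N j * s)) v) <= C * expR (x j) ^+ k.
      have js1 : rn (roots_pt N j * s) = 1 by rewrite rw.
      have js1' : rn (roots_pt N j * s) <= 1 by rewrite js1.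
      have rad0 := rad_gt0 D_open (disc_sub js1').
      have [F [dF Ff]] := ME _ js1.
      have -> : C * expR (x j) ^+ k =
          M * (rn v / (q * rad D (disc_pt (roots_pt N j * s)))) ^+ k.
        rewrite CE -mulrA -exprMn /x expRN lnK//; congr (_ * _ ^+ _).
        by rewrite invfM mulrA.
      apply: (@coef_bound f F k sg _ v rho) => //; first by rewrite mulr_gt0.
      by move=> w /(tube _ _ js1')[/fh].
    have C0 : 0 <= C.
      rewrite -(pmulr_lge0 _ (exprn_gt0 k (expR_gt0 (x 0%N)))).
      by rewrite (le_trans _ (Cbd 0%N)) ?rn_ge0.
    have prodB n : rn (\prod_(0 <= j < n) coef f k sg (disc_pt (roots_pt N j * s)) v)
        <= C ^+ n * expR (\sum_(0 <= j < n) x j) ^+ k.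
      elim: n => [|n IH]; first by rewrite !big_geq// rn1 expR0 expr0 expr1n mulr1.
      rewrite !big_nat_recr//= rnM expRD exprMn exprSr mulrACA.
      by apply: ler_pM; rewrite ?rn_ge0.
    apply: le_trans (prodB N) _.
    have -> : (M * (rn v / R1) ^+ k) ^+ N =
        C ^+ N * expR (N%:R * A) ^+ k.
      rewrite [_%:R * A]mulrC expRM_natr -exprM mulnC exprM -exprMn; congr (_ ^+ _).
      rewrite CE -mulrA -exprMn; congr (_ * _ ^+ _).
      by rewrite /R1 expRN invfM invrK mulrA.
    rewrite ler_wpM2l ?exprn_ge0// lerXn2r ?nnegrE ?expR_ge0// ler_expR.
    exact: HA.
  have := max_principle ltr01 holG GB.
  have -> : G 0 = coef f k sg c v ^+ N.
    rewrite /G -[N in RHS]subn0 -prodr_const_nat; apply: eq_bigr => j _.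
    by rewrite mulr0 -c0.
  have [F [dF Ff]] := ME 1 (rn1 R).
  have M_ge0 : 0 <= M.
    apply: le_trans (dF (disc_pt 1) _).2; first exact: rn_ge0.
    rewrite subrr rn0 mulr_ge0 ?(ltW q0)//; apply/ltW/rad_gt0 => //.
    by apply: disc_sub; rewrite rn1.
  rewrite rnX ler_pXn2r ?nnegrE ?rn_ge0//.
  by rewrite mulr_ge0// exprn_ge0// divr_ge0 ?rn_ge0// ltW.
have M_ge0 : 0 <= M.
  have sg0 : 0 < rho / 2 by lra.
  have := coefB 0%N _ 0 sg0; rewrite rn0 mulr0 expr0 mulr1 => H.
  by apply: le_trans (H _); [exact: rn_ge0|exact: ltW].
(* One radius for all directions with [rn v <= R1 + 1], so that the Taylor terms are given by a
   single formula on the whole ball; the extra 1 is the room for differentiating in [v]. *)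
pose sg := rho / (2 * (R1 + 1)).
have sg0 : 0 < sg by rewrite divr_gt0// mulr_gt0//; lra.
have sgR : sg * (R1 + 1) = rho / 2 by rewrite /sg; field; lra.
have sg_le v : rn v <= R1 + 1 -> sg * rn v <= rho / 2.
  by move=> vR; rewrite -sgR ler_wpM2l// ltW.
have sg2 : sg <= 2 by have : sg <= sg * (R1 + 1); [rewrite ler_peMr ?ltW//; lra|lra].
pose S n v := \sum_(0 <= k < n) coef f k sg c v.
(* The sum of the series as a Banach limit of its partial sums: by [diff_LIM] a bound uniform in [n]
   near each point makes it holomorphic. *)
exists (fun w => LIM (fun n => S n (w + (- c)))).
  move=> w wr; apply: (@diff_translate _ _ _ (fun v => LIM (fun n => S n v))).
  rewrite -/(w - c); set v0 := w - c in wr *.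
  pose s := (R1 - rn v0) / 2; pose R2 := rn v0 + s.
  have s0 : 0 < s by rewrite /s; lra.
  have R21 : R2 < R1 by rewrite /R2 /s; lra.
  have R20 : 0 <= R2 by rewrite /R2; have := rn_ge0 v0; lra.
  apply: (@diff_LIM _ _ S v0 s (M * (1 - R2 / R1)^-1) s0) => n u uv.
  have uR2 : rn u <= R2 by rewrite /R2; have := rn_dist u v0; lra.
  split.
    apply: hol_sum => k; apply: (@coef_hol_dir f k sg c u rho 1 M0) => //.
    have : sg * (rn u + 1) <= sg * (R1 + 1) by rewrite ler_wpM2l ?ltW//; lra.
    by rewrite sgR; lra.
  have R2q : 0 <= R2 / R1 < 1.
    by apply/andP; split; [rewrite divr_ge0// ltW|rewrite ltr_pdivrMr// mul1r].
  apply: le_trans (rn_sum _ _ _) _.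
  apply: (@le_trans _ _ (\sum_(0 <= k < n) M * (R2 / R1) ^+ k)).
    apply: ler_sum => k _; apply: le_trans (coefB k sg u sg0 _) _.
      by apply: sg_le; lra.
    rewrite ler_wpM2l// lerXn2r ?nnegrE ?divr_ge0 ?rn_ge0 ?(ltW R10)//.
    by rewrite ler_wpM2r// invr_ge0 ltW.
  by rewrite -mulr_sumr ler_wpM2l//; exact: geometric_sum_le.
(* For [rn v < rho / 4] the slice through [w] is holomorphic on the disc of radius 2, so at [t = 1]
   the Taylor remainder is of order [(1 / 2) ^+ n]. *)
exists (rho / 4); first by rewrite divr_gt0.
move=> w; rewrite -/(w - c); set v := w - c => vr.
have ct (t : K) : rn t <= 2 -> rn (c + t *: v - c) <= rho.
  move=> t2; rewrite addrC addKr rnZ.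
  have : rn t * rn v <= 2 * rn v by rewrite ler_wpM2r ?rn_ge0.
  by lra.
pose h (t : K) := f (c + t *: v).
have holh (t : K) : rn t <= 2 -> hol h t.
  by move=> t2; apply: diff_slice; apply: (tubec _ _).1; exact: ct.
have hM (t : K) : rn t = 2 -> rn (h t) <= M0.
  by move=> t2; apply: (tubec _ _).2; apply: ct; rewrite t2.
have lt12 : rn (1 : K) < 2 by rewrite rn1; lra.
have h1 : h 1 = f w by rewrite /h /v scale1r addrC subrK.
have Sh n : rn (S n v - f w) <= M0 * 2 * (1 / 2) ^+ n.
  have := taylor_remainder n lt12 holh hM; rewrite h1 rn1.
  have -> : \sum_(0 <= k < n) tcoef h k 2 * 1 ^+ k = S n v.
    apply: eq_bigr => k _; rewrite expr1n mulr1 /coef.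
    by rewrite -(tcoef_indep k sg0 sg2 holh).
  rewrite rnBC => /le_trans; apply.
  have -> : 2 / (2 - 1) = 2 :> R by field.
  by rewrite mulrAC.
have M00 : 0 <= M0 by apply: le_trans (tubec c _).2; rewrite ?rn_ge0 ?subrr ?rn0 ?ltW.
have half01 : 0 <= (1 / 2 : R) < 1 by apply/andP; split; lra.
apply: LIM_cvg => [|e e0].
  exists (rn (f w) + M0 * 2) => n; apply: le_trans (rn_dist _ (f w)) _.
  rewrite addrC lerD2l; apply: le_trans (Sh n) _; rewrite ler_piMr ?mulr_ge0//.
  by have /andP[? ?] := half01; rewrite exprn_ile1// ltW.
have [n nP] := geometric_lt (M0 * 2) half01 e0.
by exists n => k kn; apply: le_trans (Sh k) _; apply/ltW/nP.
Qed.

End DiscreteSubmean.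

(** * Riemann sums over the circle and the Lebesgue integral *)

Section RiemannSums.
Variable R : realType.
Local Notation K := (Cplx R).
Local Notation mu := (@lebesgue_measure R).

Lemma cis_surj (z : K) : rn z = 1 -> exists2 s : R, 0 <= s & z = cis s.
Proof.
move=> z1; have := rn_sqr z; rewrite z1 expr1n; case: z z1 => a b z1 /= ab.
have a1 : -1 <= a <= 1.
  by have := rn_Re (Complex a b); rewrite z1 /= ler_norml.
have acK : cos (acos a) = a by rewrite acosK// in_itv.
have ac0 := acos_ge0 a1.
have sE : sin (acos a) = `|b|.
  rewrite sin_acos// -sqrtr_sqr; congr Num.sqrt; lra.
have [b0|b0] := leP 0 b.
  by exists (acos a) => //; rewrite /cis acK sE ger0_norm.
exists (2 * pi - acos a).
  by have := acos_lepi a1; have := pi_gt0 R; lra.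
rewrite cisD cis2pi mul1r /cis cosN sinN acK sE ltr0_norm// opprK //.
Qed.

Lemma integrable_cont (f : R -> R) (a b : R) : continuous f ->
  mu.-integrable `[a, b] (EFin \o f).
Proof.
move=> cf; apply: continuous_compact_integrable; first exact: segment_compact.
exact: continuous_subspaceT.
Qed.

Lemma Rintegral_step_ge (f : R -> R) (a b c : R) : continuous f -> 0 <= a <= b ->
  (forall t, a <= t <= b -> c <= f t) ->
  c * (b - a) <= \int[mu]_(t in `[0, b]) f t - \int[mu]_(t in `[0, a]) f t.
Proof.
move=> cf /andP[a0 ab] fc.
rewrite Rintegral_itvB ?bnd_simp//; last exact: integrable_cont.
have -> : c * (b - a) = \int[mu]_(t in `]a, b]) (fun=> c) t.
  rewrite Rintegral_cst//; congr (_ * _).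
  apply/esym; apply: etrans (congr1 fine (lebesgue_measure_itv `]a, b])) _.
  rewrite /= lte_fin; case: ltP => [//|ba] /=; apply/esym.
  by apply/eqP; rewrite subr_eq0 eq_le ab ba.
have sub : `]a, b] `<=` `[a, b].
  by move=> t /=; rewrite !in_itv /= => /andP[/ltW -> ->].
apply: le_Rintegral => //.
- apply: (@integrableS _ _ _ mu `[a, b]) => //.
  by apply: integrable_cont; exact: cst_continuous.
- by apply: (@integrableS _ _ _ mu `[a, b]) => //; exact: integrable_cont.
- by move=> t /sub /=; rewrite in_itv /=; exact: fc.
Qed.

(** A shift by one step permutes the nodes cyclically modulo the period [N%:R * h]. *)
Lemma periodic_sum (f : R -> R) (N : nat) (h s : R) (k : nat) :
  (forall t, f (t + N%:R * h) = f t) ->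
  \sum_(0 <= j < N) f (s + k%:R * h + j%:R * h) = \sum_(0 <= j < N) f (s + j%:R * h).
Proof.
move=> fper; elim: k s => [|k IH] s; first by rewrite mul0r addr0.
have -> : s + k.+1%:R * h = s + h + k%:R * h by rewrite -natr1; ring.
rewrite IH; case: N fper {IH} => [|N] fper; first by rewrite !big_geq.
rewrite big_nat_recr//= [RHS]big_nat_recl//= addrC; congr (_ + _).
  by rewrite mul0r addr0 -(fper s) -natr1; congr f; ring.
by apply: eq_bigr => j _; rewrite -natr1; congr f; ring.
Qed.

(** [N] is chosen before [s], because [disc_submean] needs one [N] for all starting points on the
    circle. [periodic_sum] brings [s] within a single step of 0, after which uniform continuity
    compares each sampled value with the integral over its interval. *)
Lemma riemann_circle (f : R -> R) (e : R) : continuous f ->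
  (forall t, f (t + 2 * pi) = f t) -> 0 < e ->
  exists2 N : nat, (0 < N)%N & forall s, 0 <= s ->
    \sum_(0 <= j < N) f (s + j%:R * (2 * pi / N%:R)) <=
    N%:R * ((2 * pi)^-1 * \int[mu]_(t in `[0, 2 * pi]) f t + e).
Proof.
move=> cf fper e0; have pi0 := pi_gt0 R.
(* The interval [[0, 2 pi]] is placed in [Cplx R] to bring it under the compactness lemmas for
   [rn]. *)
pose C := (fun t : R => 0 + rc t *: rc (2 * pi)) @` [set t : R | 0 <= t <= 1] : set K.
have cC : ucompact C by exact: ucompact_segment.
have CE t : 0 <= t <= 2 * pi -> C (rc t).
  move=> /andP[t0 t2]; exists (t / (2 * pi)).
    by apply/andP; split; [rewrite divr_ge0//; lra|rewrite ler_pdivrMr; lra].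
  by rewrite add0r -[_ *: _]/(_ * _) -rcM divfK// gt_eqF//; lra.
have [|d d0 dP] := ucompact_unif_cont (g := fun z : K => rc (f (complex.Re z)) : K) cC e0.
  move=> z _ e1 e10; have /cvgrPdist_lt/(_ e1 e10)/nbhs_ballP[d /= d0 dP] := cf (complex.Re z).
  exists d => // w _ wz; rewrite -rcN -rcD rn_rc distrC.
  apply: dP; rewrite /ball /= distrC; apply: le_lt_trans wz.
  by have := rn_Re (w - z); case: w z => ? ? [].
pose N := (Num.bound (2 * pi / d)).+1; exists N => // s s0.
have N0 : 0 < N%:R :> R by [].
pose h : R := 2 * pi / N%:R.
have h0 : 0 < h by rewrite divr_gt0//; lra.
have hd : h < d.
  rewrite /h ltr_pdivrMr// [ltRHS]mulrC -ltr_pdivrMr//.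
  have pd0 : 0 <= 2 * pi / d by rewrite divr_ge0 ?(ltW d0)// mulr_ge0// ltW.
  by apply: (lt_le_trans (archi_boundP pd0)); rewrite ler_nat.
have hN : N%:R * h = 2 * pi by rewrite /h mulrC divfK// gt_eqF.
have [k [s1 s1h sE]] : exists k : nat, exists2 s1 : R, 0 <= s1 <= h & s = s1 + k%:R * h.
  exists (Num.truncn (s / h)), (s - (Num.truncn (s / h))%:R * h); last by rewrite subrK.
  have := @truncn_itv _ (s / h); rewrite divr_ge0 ?(ltW h0)// => /(_ isT)/andP[].
  rewrite ler_pdivlMr// ltr_pdivrMr// -natr1 => ? ?.
  by apply/andP; split; lra.
rewrite -/h sE periodic_sum; last by move=> t; rewrite hN.
have step n : (n <= N)%N -> \sum_(0 <= j < n) f (s1 + j%:R * h) * h <=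
    \int[mu]_(t in `[0, n%:R * h]) f t + n%:R * h * e.
  elim: n => [|n IH] nN.
    by rewrite big_geq// !mul0r addr0 set_itv1 Rintegral_set1.
  rewrite big_nat_recr//=; have {}IH := IH (ltnW nN).
  have n0 : 0 <= n%:R * h by rewrite mulr_ge0// ltW.
  have nn : n%:R * h <= n.+1%:R * h by rewrite ler_wpM2r ?(ltW h0)// ler_nat.
  have nnN : n.+1%:R * h <= 2 * pi by rewrite -hN ler_wpM2r ?(ltW h0)// ler_nat.
  have nE : n.+1%:R * h = n%:R * h + h by rewrite -natr1; ring.
  have H : (f (s1 + n%:R * h) - e) * (n.+1%:R * h - n%:R * h) <=
      \int[mu]_(t in `[0, n.+1%:R * h]) f t - \int[mu]_(t in `[0, n%:R * h]) f t.
    apply: Rintegral_step_ge => //; first by rewrite n0.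
    move=> t /andP[t1 t2]; have /andP[s10 s11] := s1h.
    have C1 : C (rc t) by apply: CE; apply/andP; split; lra.
    have C2 : C (rc (s1 + n%:R * h)) by apply: CE; apply/andP; split; lra.
    have := dP _ _ C1 C2; rewrite -!rcN -!rcD !rn_rc /= => dd.
    have : f (s1 + n%:R * h) - f t < e.
      apply: le_lt_trans (ler_norm _) _; apply: dd.
      by rewrite ltr_norml; lra.
    by lra.
  have H2 : (f (s1 + n%:R * h) - e) * h <=
      \int[mu]_(t in `[0, n.+1%:R * h]) f t - \int[mu]_(t in `[0, n%:R * h]) f t.
    by move: H; rewrite {1}nE addrAC subrr add0r.
  have E1 : (f (s1 + n%:R * h) - e) * h = f (s1 + n%:R * h) * h - h * e by ring.
  have E2 : n.+1%:R * h * e = n%:R * h * e + h * e by rewrite nE; ring.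
  rewrite E2; lra.
have := step N (leqnn N); rewrite -mulr_suml hN => H.
rewrite -(ler_pM2r h0); apply: le_trans H _.
rewrite [leRHS]mulrAC hN le_eqVlt; apply/orP; left; apply/eqP.
by field; lra.
Qed.

End RiemannSums.

(** * The sub-mean inequality for minus the logarithm of the extension radius *)

Section LebesgueSubmean.
Variables (R : realType) (m : nat).
Local Notation K := (Cplx R).
Local Notation V := ('rV[Cplx R]_m).
Local Notation mu := (@lebesgue_measure R).

Definition rcont (u : V -> R) (z : V) := forall e : R, 0 < e ->
  exists2 d : R, 0 < d & forall w, rn (w - z) < d -> `|u w - u z| < e.

Lemma cis_cont (t e : R) : 0 < e -> exists2 d : R, 0 < d &
  forall s : R, `|s - t| < d -> rn (cis s - cis t) < e.
Proof.
move=> e0; have e2 : 0 < e / 2 by rewrite divr_gt0.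
have /cvgrPdist_lt/(_ _ e2)/nbhs_ballP[d1 /= d10 H1] := @continuous_cos R t.
have /cvgrPdist_lt/(_ _ e2)/nbhs_ballP[d2 /= d20 H2] := @continuous_sin R t.
exists (Num.min d1 d2); first by rewrite lt_min d10.
move=> s; rewrite lt_min => /andP[s1 s2].
have {}H1 := H1 s; have {}H2 := H2 s.
rewrite /ball /= distrC in H1; rewrite /ball /= distrC in H2.
apply: le_lt_trans (rn_ReIm _) _ => /=; rewrite [ltRHS]splitr.
by apply: ltrD; rewrite distrC; [exact: H1|exact: H2].
Qed.

Lemma circle_cont (u : V -> R) (x b : V) :
  (forall s : K, rn s = 1 -> rcont u (x + s *: b)) ->
  continuous (fun t : R => u (x + cis t *: b)).
Proof.
move=> uc t; apply/cvgrPdist_lt => e e0.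
have [d d0 dP] := uc (cis t) (rn_cis t) e e0.
have b1 : 0 < rn b + 1 by have := rn_ge0 b; lra.
have [d' d'0 d'P] := cis_cont t (divr_gt0 d0 b1).
apply/nbhs_ballP; exists d' => // s; rewrite /ball /= distrC => /d'P.
rewrite ltr_pdivlMr// => H; rewrite distrC; apply: dP.
rewrite opprD addrACA subrr add0r -scalerBl rnZ; apply: le_lt_trans H.
by rewrite ler_wpM2l ?rn_ge0// lerDl.
Qed.

Variable D : set V.
Hypothesis D_open : open D.

Lemma rad_cont z : D z -> rcont (rad D) z.
Proof.
move=> Dz e e0; have [d d0 dD] := D_ball D_open Dz.
exists (Num.min d e); first by rewrite lt_min d0.
move=> w; rewrite lt_min => /andP[wd we].
by apply: le_lt_trans we; exact: rad_lip wd.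
Qed.

Lemma lnrad_cont z : D z -> rcont (fun w => - ln (rad D w)) z.
Proof.
move=> Dz e e0.
have /cvgrPdist_lt/(_ e e0)/nbhs_ballP[d /= d0 dP] := continuous_ln (rad_gt0 D_open Dz).
have [d' d'0 d'P] := rad_cont Dz d0.
exists d' => // w /d'P wz; rewrite -opprD normrN distrC.
by apply: dP; rewrite -ball_normE /ball_ /= distrC.
Qed.

(** Otherwise some [r] lies strictly between [rad D c] and [expR (- (I + e))], and [disc_submean]
    gives extensions to the ball of radius [r], contrary to the supremum. As [rad <= 1], the mean
    [I] is nonnegative, which keeps [r <= 1] as the definition of [rad] requires. *)
Lemma rad_submean (c b : V) : (forall s : K, rn s <= 1 -> D (c + s *: b)) ->
  - ln (rad D c) <=
  (2 * pi)^-1 * \int[mu]_(t in `[0, 2 * pi]) - ln (rad D (c + cis t *: b)).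
Proof.
move=> disc; have pi0 := pi_gt0 R.
have Dc : D c by rewrite -[c]addr0 -(scale0r b); apply: disc; rewrite rn0.
have Dcis t : D (c + cis t *: b) by apply: disc; rewrite rn_cis.
pose f t := - ln (rad D (c + cis t *: b)).
have fc : continuous f.
  apply: (@circle_cont (fun w => - ln (rad D w))) => s s1; apply: lnrad_cont.
  by apply: disc; rewrite s1.
have fper t : f (t + 2 * pi) = f t by rewrite /f cisD cis2pi mulr1.
set I := _^-1 * _.
have I0 : 0 <= I.
  rewrite mulr_ge0 ?invr_ge0 ?mulr_ge0 ?(ltW pi0)//; apply: Rintegral_ge0 => t _.
  by rewrite oppr_ge0 ln_le0// rad_le1.
apply/ler_addgt0Pr => e e0.
have [N N0 NP] := riemann_circle fc fper e0.
rewrite -/I in NP; rewrite lerNl -ler_expR lnK; last exact: rad_gt0.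
rewrite leNgt; apply/negP => radA.
pose r := (rad D c + expR (- (I + e))) / 2.
have rad0 := rad_gt0 D_open Dc.
have A1 : expR (- (I + e)) <= 1 by rewrite -expR0 ler_expR; lra.
have r0 : 0 < r by rewrite /r; lra.
have rA : r < expR (- (I + e)) by rewrite /r; lra.
have radr : rad D c < r by rewrite /r; lra.
have ext : ext_ball D c r.
  apply: (@disc_submean _ _ _ D_open c b disc (I + e) r N N0); last by rewrite r0.
  move=> s s1; have [t t0 ->] := cis_surj s1.
  apply: le_trans (NP t t0); rewrite le_eqVlt; apply/orP; left; apply/eqP.
  apply: eq_bigr => j _; rewrite /f /disc_pt /roots_pt -cisD.
  by congr (- ln (rad D (c + cis _ *: b))); ring.
suff : r <= rad D c by rewrite leNgt radr.
by apply: rad_ge => //; rewrite r0 /=; lra.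
Qed.

End LebesgueSubmean.

(** * Lipschitz boundaries and the envelope of holomorphy *)

Section ConeCondition.
Variables (R : realType) (n : nat).
Local Notation K := (Cplx R).
Local Notation V := ('rV[Cplx R]_n.+1).

Definition interior_cone (D : set V) (p : V) (e : V) (s0 c : R) :=
  forall z y (t : R), closure D z -> rn (z - p) < s0 -> 0 < t < s0 ->
    rn (y - (z - rc t *: e)) < c * t -> D y.

Lemma rn_mulmx_le (U : 'M[K]_n.+1) (v : V) (k : 'I_n.+1) :
  rn ((v *m U) ord0 k) <= (\sum_i \sum_j rn (U i j)) * rn v.
Proof.
rewrite mxE; apply: le_trans (rn_sum _ _ _) _; rewrite mulr_suml.
apply: ler_sum => i _; rewrite rnM mulrC ler_pM ?rn_ge0 ?mx_rn_le//.
by rewrite (bigD1 k)//= lerDl sumr_ge0// => j _; exact: rn_ge0.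
Qed.

Lemma graph_norm_le (x : 'rV[K]_n) (t B : R) : 0 <= B ->
  (forall k, rn (x ord0 k) <= B) -> `|t| <= B -> graph_norm x t <= n.+1%:R * B.
Proof.
move=> B0 xB tB; rewrite /graph_norm.
have nB0 : 0 <= n.+1%:R * B by rewrite mulr_ge0.
rewrite -[leRHS]ger0_norm// -sqrtr_sqr ler_wsqrtr//.
have xB2 k : complex.Re (x ord0 k) ^+ 2 + complex.Im (x ord0 k) ^+ 2 <= B ^+ 2.
  by rewrite -rn_sqr lerXn2r ?nnegrE ?rn_ge0.
have tB2 : t ^+ 2 <= B ^+ 2.
  by rewrite -(real_normK (num_real t)) lerXn2r ?nnegrE.
apply: (@le_trans _ _ (n.+1%:R * B ^+ 2)).
  rewrite -natr1 mulrDl mul1r lerD//.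
  apply: (@le_trans _ _ (\sum_(k < n) B ^+ 2)); first exact: ler_sum.
  by rewrite sumr_const card_ord mulr_natl.
rewrite exprMn ler_wpM2r ?sqr_ge0// expr2 ler_peMr//.
by rewrite ler1n.
Qed.

(** Lowering the last imaginary part by [t * tau] gains that much in the graph inequality, while a
    displacement [u] changes its two sides by at most [C * rn u] together. Hence [c] is chosen with
    [C * c <= tau]. *)
Lemma lipschitz_cone (D : set V) (p : V) : lipschitz_boundary D -> boundary D p ->
  exists (e : V) (s0 c : R), [/\ rn e <= 1, 0 < s0, 0 < c, c <= 1 & interior_cone D p e s0 c].
Proof.
move=> Dlip Dp; have [U [a [r [Uu [K0 rK0] /nbhs_rn[s1 s10 Ds1]]]]] := Dlip p Dp.
have Uunit : U \in unitmx by exact: unitarymx_unit.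
(* The vector that [U] sends to [i] times the last basis vector; [tau] rescales it to norm at most
   1. *)
pose e0 : V := Complex 0 1 *: (delta_mx ord0 ord_max *m invmx U).
pose tau := (1 + rn e0)^-1.
have e01 : 0 < 1 + rn e0 by rewrite ltr_pwDl ?rn_ge0.
have tau0 : 0 < tau by rewrite invr_gt0.
pose e : V := rc tau *: e0.
have e1 : rn e <= 1.
  by rewrite rnZ rn_rc gtr0_norm// /tau mulrC ler_pdivrMr// mul1r lerDr.
have eU : e *m U = Complex 0 tau *: delta_mx ord0 ord_max.
  rewrite /e /e0 -!scalemxAl mulmxKV// scalerA; congr (_ *: _).
  by rewrite -[LHS]/(Complex (_ - _) (_ + _)); congr Complex => /=; ring.
pose CU := \sum_i \sum_j rn (U i j).
have CU0 : 0 <= CU by apply: sumr_ge0 => i _; apply: sumr_ge0 => j _; exact: rn_ge0.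
pose C := (`|K0| * n.+1%:R + 1) * CU.
have C0 : 0 <= C by rewrite mulr_ge0// addr_ge0// mulr_ge0.
pose c := Num.min 1 (tau / (C + 1)).
have C10 : 0 < C + 1 by rewrite ltr_wpDl.
have c0 : 0 < c by rewrite lt_min ltr01 divr_gt0.
have c1 : c <= 1 by rewrite ge_min lexx.
have cC : C * c <= tau.
  apply: (@le_trans _ _ ((C + 1) * (tau / (C + 1)))).
    by apply: ler_pM => //; [exact: ltW|by rewrite lerDl|by rewrite ge_min lexx orbT].
  by rewrite mulrCA divff ?mulr1// gt_eqF.
(* The points met below stay within [3 * s0] of [p], inside the neighbourhood where [D] is a
   subgraph. *)
pose s0 := s1 / 4; have s00 : 0 < s0 by rewrite divr_gt0.
exists e, s0, c; split=> // z y t Dz zp /andP[t0 ts0] yz.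
(* The graph inequality is available at points of [D], so [z] in the closure is replaced by [z'] in
   [D]; [eta] is at most the slack in the strict inequality for [y]. *)
pose eta := Num.min s0 (c * t - rn (y - (z - rc t *: e))).
have eta0 : 0 < eta by rewrite lt_min s00 subr_gt0.
have [z' Dz' z'z] := (closure_rn D z).1 Dz eta eta0.
move: z'z; rewrite lt_min => /andP[z'z1 z'z2].
pose u := y - z' + rc t *: e.
have uct : rn u < c * t.
  have -> : u = (y - (z - rc t *: e)) + (z - z').
    by apply/rowP => i; rewrite !mxE; ring.
  apply: le_lt_trans (rnD _ _) _; rewrite (rnBC z z').
  by rewrite addrC -ltrBrDr.
have z'p : rn (z' - p) < s1.
  apply: le_lt_trans (rn_tri z _ _) _.
  by move: z'z1 zp; rewrite /s0; clear -s10; lra.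
have yp : rn (y - p) < s1.
  apply: le_lt_trans (rn_tri (z - rc t *: e) _ _) _.
  have H : rn (z - rc t *: e - p) <= rn (z - p) + t.
    rewrite addrAC; apply: le_trans (rnB _ _) _; rewrite lerD2l rnZ rn_rc gtr0_norm//.
    by rewrite ler_piMr// ltW.
  have H2 : c * t <= t by rewrite ler_piMl// ltW.
  by move: H H2 yz zp ts0; rewrite /s0; clear -s10; lra.
have /= yE := Ds1 y yp; have /= z'E := Ds1 z' z'p.
set wy := (y - a) *m U in yE; set wz := (z' - a) *m U in z'E.
have wyE : wy = wz - rc t *: (Complex 0 tau *: delta_mx ord0 ord_max) + u *m U.
  rewrite /wy /wz -eU scalemxAl -mulmxBl -mulmxDl; congr (_ *m U).
  by apply/rowP => i; rewrite !mxE; ring.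
have uB k : rn ((u *m U) ord0 k) <= CU * rn u by exact: rn_mulmx_le.
have wlast : wy ord0 ord_max =
    wz ord0 ord_max - rc t * Complex 0 tau + (u *m U) ord0 ord_max.
  by rewrite wyE !mxE !eqxx mulr1.
have tauE : rc t * Complex 0 tau = Complex 0 (t * tau) :> K.
  by rewrite -[LHS]/(Complex (_ - _) (_ + _)); congr Complex => /=; ring.
have ReE : complex.Re (wy ord0 ord_max) =
    complex.Re (wz ord0 ord_max) + complex.Re ((u *m U) ord0 ord_max).
  rewrite wlast tauE; case: (wz _ _) ((u *m U) _ _) => ? ? [? ?] /=; ring.
have ImE : complex.Im (wy ord0 ord_max) =
    complex.Im (wz ord0 ord_max) - t * tau + complex.Im ((u *m U) ord0 ord_max).
  by rewrite wlast tauE; case: (wz _ _) ((u *m U) _ _) => ? ? [? ?].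
have colE : col' ord_max wy = col' ord_max wz + col' ord_max (u *m U).
  apply/rowP => k; rewrite [LHS]mxE wyE !mxE.
  by rewrite [lift _ _ == _]eq_sym (negbTE (neq_lift _ _)) andbF !mulr0 subr0.
apply/yE.
have B0 : 0 <= CU * rn u by rewrite mulr_ge0 ?rn_ge0.
have := rK0 (col' ord_max wz) (col' ord_max wy)
  (complex.Re (wz ord0 ord_max)) (complex.Re (wy ord0 ord_max)).
set rz := r _ _; set ry := r _ _; set gn := graph_norm _ _ => lipr.
have gnB : gn <= n.+1%:R * (CU * rn u).
  apply: graph_norm_le => //.
    by move=> k; rewrite colE opprD addrA subrr add0r !mxE rnN; have := uB (lift ord_max k); rewrite mxE.
  by rewrite ReE opprD addrA subrr add0r normrN; apply: le_trans (rn_Re _) (uB _).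
have gn0 : 0 <= gn by exact: sqrtr_ge0.
have lipr2 : rz - ry <= `|K0| * (n.+1%:R * (CU * rn u)).
  apply: le_trans (ler_norm _) _; apply: le_trans lipr _.
  apply: (@le_trans _ _ (`|K0| * gn)); first by rewrite ler_wpM2r// ler_norm.
  by rewrite ler_wpM2l.
have zlt := (z'E.1 Dz'); rewrite -/rz in zlt.
rewrite ImE.
have Imu : complex.Im ((u *m U) ord0 ord_max) <= CU * rn u.
  by apply: le_trans (ler_norm _) _; apply: le_trans (rn_Im _) (uB _).
have Cu : C * rn u <= tau * t.
  apply: (@le_trans _ _ (C * (c * t))); first by rewrite ler_wpM2l// ltW.
  by rewrite mulrA ler_wpM2r// ltW.
have CE : C * rn u = `|K0| * (n.+1%:R * (CU * rn u)) + CU * rn u by rewrite /C; ring.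
move: zlt lipr2 Imu Cu; rewrite CE [tau * t]mulrC; clear; lra.
Qed.

End ConeCondition.

(** * Connected open subsets of C^m as Riemann domains *)

Section Schlicht.
Variables (R : realType) (m : nat).
Local Notation V := ('rV[Cplx R]_m).
Variable A : set V.
Hypothesis A_open : open A.
Hypothesis A_conn : connected A.
Variable x0 : set_type A.

(** The inverse of a chart has to be a total function on C^m; off [A] it takes the default value
    [x0]. *)
Definition schlicht_in (z : V) : set_type A :=
  if pselect (A z) is left Az then exist _ z (mem_set Az) else x0.

Lemma schlicht_inK z : A z -> set_val (schlicht_in z) = z.
Proof. by rewrite /schlicht_in; case: pselect. Qed.

Lemma schlicht_valK (x : set_type A) : schlicht_in (set_val x) = x.
Proof. by apply: val_inj => /=; apply: schlicht_inK; exact: set_valP. Qed.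

Lemma schlicht_in_cont : {within A, continuous schlicht_in}.
Proof.
apply/subspace_sigL_continuousP.
suff -> : sigL A schlicht_in = id by move=> x.
by apply/funext => x; exact: schlicht_valK.
Qed.

Lemma schlicht_image : set_val @` [set: set_type A] = A.
Proof.
apply/seteqP; split=> [_ [x _ <-]|z Az]; first exact: set_valP.
by exists (schlicht_in z) => //; exact: schlicht_inK.
Qed.

Lemma schlicht_val_cont : continuous (set_val : set_type A -> V).
Proof. exact: initial_continuous. Qed.

Lemma schlicht_hausdorff : hausdorff_space (set_type A).
Proof.
move=> x y xy; apply: val_inj.
have hV : hausdorff_space V by exact: norm_hausdorff.
apply: hV => B C Bx Cy.
have [z [Bz Cz]] := xy _ _ (schlicht_val_cont Bx) (schlicht_val_cont Cy).
by exists (set_val z).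
Qed.

Lemma schlicht_connected : connected [set: set_type A].
Proof.
have <- : schlicht_in @` A = [set: set_type A].
  apply/seteqP; split=> // x _; exists (set_val x); first exact: set_valP.
  exact: schlicht_valK.
by apply: connected_continuous_connected => //; exact: schlicht_in_cont.
Qed.

Lemma schlicht_chart : chart_of (set_val : set_type A -> V) setT schlicht_in.
Proof.
split.
- exact: openT.
- by rewrite schlicht_image.
- by apply: continuous_subspaceT; exact: schlicht_val_cont.
- by rewrite schlicht_image; exact: schlicht_in_cont.
- by move=> x _; exact: schlicht_valK.
Qed.

Definition schlicht : riemann_domain R m :=
  @RiemannDomain R m (set_type A) set_val schlicht_hausdorff schlicht_connected
    (fun x => ex_intro _ setT (ex_intro _ schlicht_in (conj I schlicht_chart))).

Lemma schlicht_extension (D : set V) : D `<=` A ->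
  (forall f, hol_on D f -> exists2 g, hol_on A g & forall z, D z -> g z = f z) ->
  holomorphic_extension D (schlicht_in : V -> schlicht).
Proof.
move=> DA ext; split; first split.
- by apply: continuous_subspaceW DA _; exact: schlicht_in_cont.
- by move=> z /DA; exact: schlicht_inK.
move=> f df; have [|g dg gf] := ext f; first by move=> z Dz; apply/holP/df.
exists (g \o (set_val : set_type A -> V)); split; last first.
  by move=> z Dz; rewrite /= schlicht_inK ?gf//; exact: DA.
move=> U s [Uo piUo _ _ sU] z piUz; apply/holP.
have [d d0 dP] := (open_rn _).1 piUo z piUz.
apply: (@hol_near _ _ _ g _ z d d0) => [w /dP [x Ux xw]|].
  by rewrite /= -xw sU.
by case: piUz => x _ <-; apply: dg; exact: set_valP.
Qed.

End Schlicht.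

(** * Extension across the boundary point *)

Section CaseExtension.
Variables (R : realType) (m : nat).
Local Notation K := (Cplx R).
Local Notation V := ('rV[Cplx R]_m).

Lemma vertical_segment (w e : V) (t a : R) :
  w - rc t *: e + rc a *: (w - (w - rc t *: e)) = w - rc ((1 - a) * t) *: e.
Proof.
rewrite subKr scalerA -rcM -addrA -!scaleNr -scalerDl -!rcN -rcD.
by congr (_ + rc _ *: _); ring.
Qed.

Lemma vertical_shift (w p e : V) (s t : R) :
  w - rc s *: e - (p - rc t *: e) = (w - p) + rc (t - s) *: e.
Proof.
rewrite opprB [rc t *: e - p]addrC addrACA -scaleNr -scalerDl -rcN -rcD.
by congr (_ + rc _ *: _); ring.
Qed.

Lemma vertical_segment2 (z e : V) (a b t : R) :
  z - rc a *: e + rc t *: (z - rc b *: e - (z - rc a *: e)) =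
  z - rc (a - t * (a - b)) *: e.
Proof.
have H (x y : V) : z - y - (z - x) = x - y by rewrite opprB addrC addrA subrK.
have H2 (al be ta : K) :
    z - al *: e + ta *: (al *: e - be *: e) = z - (al - ta * (al - be)) *: e.
  by rewrite -scalerBl scalerA (scalerBl al) opprB addrA addrAC.
have -> : rc (a - t * (a - b)) = rc a - rc t * (rc a - rc b).
  by rewrite rcD rcN rcM rcD rcN.
exact: etrans (congr1 (fun X => z - rc a *: e + rc t *: X) (H _ _)) (H2 _ _ _).
Qed.

Lemma ball_connected (p : V) (s : R) : 0 < s -> connected [set w : V | rn (w - p) < s].
Proof.
move=> s0; pose I01 := [set t : R | 0 <= t <= 1].
have -> : [set w : V | rn (w - p) < s] =
    \bigcup_(w in [set w : V | rn (w - p) < s]) ((fun t : R => p + rc t *: (w - p)) @` I01).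
  apply/seteqP; split=> [w ws|w [v vs [t t01 <-]]].
    exists w => //; exists 1; first by rewrite /I01 /= ler01 lexx.
    by rewrite scale1r addrC subrK.
  by apply: segment_ball => //; rewrite subrr rn0.
apply: bigcup_connected.
  exists p => w _; exists 0; first by rewrite /I01 /= ler01 lexx.
  by rewrite scale0r addr0.
move=> w _; apply: connected_continuous_connected.
  have -> : I01 = `[0, 1]%classic by apply/seteqP; split=> t /=; rewrite in_itv.
  exact: segment_connected.
apply: continuous_subspaceT => t B /nbhs_rn[e e0 eB].
have v1 : 0 < rn (w - p) + 1 by rewrite ltr_wpDl ?rn_ge0.
apply/nbhs_ballP; exists (e / (rn (w - p) + 1)); first by rewrite /= divr_gt0.
move=> t'; rewrite -ball_normE /ball_ /= ltr_pdivlMr// distrC => tt'.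
apply: eB; rewrite opprD addrACA subrr add0r -scalerBl -rcN -rcD rnZ rn_rc.
by apply: le_lt_trans tt'; rewrite ler_wpM2l// lerDl.
Qed.

Variables (D : set V) (p e : V) (s0 c : R).
Hypothesis D_open : open D.
Hypothesis Dp : closure D p.
Hypothesis e1 : rn e <= 1.
Hypothesis cone : forall z y (t : R), closure D z -> rn (z - p) < s0 -> 0 < t < s0 ->
    rn (y - (z - rc t *: e)) < c * t -> D y.
Hypothesis c0 : 0 < c.

Lemma cone_center z t : closure D z -> rn (z - p) < s0 -> 0 < t < s0 -> D (z - rc t *: e).
Proof.
move=> Dz zp t01; apply: (cone Dz zp t01).
by rewrite subrr rn0 mulr_gt0//; have /andP[] := t01.
Qed.

(** [F] is known to agree with [f] only near [q]. Two segments in [D] carry the agreement to any [w]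
    of [D] near [p]: one from [q] to [w - rc t *: e], inside the ball that the cone at [p] provides,
    then one along [e] up to [w], inside the cone at [w]. *)
Lemma cone_ext_ball (t r : R) : 0 < t < s0 -> t < r -> ext_ball D (p - rc t *: e) r ->
  exists2 s : R, 0 < s & forall f, hol_on D f ->
    exists2 F : V -> K, (forall w, rn (w - p) < s -> hol F w) &
      forall w, rn (w - p) < s -> D w -> F w = f w.
Proof.
move=> ts0 tr ext; have /andP[t0 t_s0] := ts0; set q := p - rc t *: e in ext.
(* [r - t] keeps the ball about [p] inside the one about [q], [c * t] keeps the first segment in the
   cone at [p], and [s0] makes the cone at [w] available. *)
pose s := Num.min (r - t) (Num.min (c * t) s0).
have [sr sc ss0] : [/\ s <= r - t, s <= c * t & s <= s0].
  by rewrite /s; split; rewrite !ge_min lexx ?orbT.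
exists s; first by rewrite !lt_min subr_gt0 tr mulr_gt0//= (lt_trans t0).
move=> f df; have [F dF Ff] := ext f df.
have qp w : rn (w - q) <= rn (w - p) + t.
  apply: le_trans (rn_tri p _ _) _; rewrite lerD2l /q opprB addrC subrK.
  by rewrite rnZ rn_rc gtr0_norm// ler_piMr// ltW.
exists F.
  by move=> w ws; apply: dF; apply: le_lt_trans (qp w) _; rewrite -ltrBrDr; exact: lt_le_trans sr.
move=> w ws Dw.
have Dpp : rn (p - p) < s0 by rewrite subrr rn0; exact: lt_trans t_s0.
have wps0 : rn (w - p) < s0 by exact: lt_le_trans ss0.
pose G := D `&` [set u | rn (u - q) < r].
have Go : open G.
  apply: openI => //; apply/open_rn => u /= uq.
  exists (r - rn (u - q)); first by rewrite subr_gt0.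
  move=> v vu; apply: le_lt_trans (rn_tri u _ _) _.
  by rewrite -ltrBrDr.
have dFf u : G u -> hol F u /\ hol f u by move=> [/df ? /dF].
have seg1 : agree F f (w - rc t *: e).
  apply: (identity_segment Go dFf _ Ff) => a a01.
  have wq : w - rc t *: e - q = w - p by rewrite /q opprB addrA subrK.
  have aq : rn (q + rc a *: (w - rc t *: e - q) - q) <= rn (w - p).
    rewrite addrC addKr rnZ wq rn_rc; have /andP[a0 a1] := a01.
    by rewrite ger0_norm// ler_piMl ?rn_ge0.
  split; last first.
    apply: le_lt_trans aq _; apply: lt_le_trans ws _; apply: le_trans sr _.
    by rewrite gerBl ltW.
  apply: (cone Dp Dpp ts0); apply: le_lt_trans aq _; exact: lt_le_trans ws sc.
suff [d d0 dP] : agree F f w by apply: dP; rewrite subrr rn0.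
apply: (identity_segment Go dFf _ seg1) => a /andP[a0 a1].
rewrite vertical_segment.
(* The end point is [w] itself, which the cone, stated for [t > 0], does not cover; it is in [D] by
   assumption. *)
have [->|a_neq1] := eqVneq a 1.
  rewrite subrr mul0r scale0r subr0; split=> //=.
  by apply: le_lt_trans (qp w) _; rewrite -ltrBrDr; exact: lt_le_trans sr.
have a_lt1 : a < 1 by rewrite lt_neqAle a_neq1.
have at0 : 0 < (1 - a) * t by rewrite mulr_gt0// subr_gt0.
have at1 : (1 - a) * t <= t by rewrite ler_piMl ?(ltW t0)// gerBl.
split.
  apply: (cone_center _ wps0); last by rewrite at0 (le_lt_trans at1).
  exact: subset_closure Dw.
rewrite /=; have -> : w - rc ((1 - a) * t) *: e - q = (w - p) + rc (a * t) *: e.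
  by rewrite /q vertical_shift; congr (_ + rc _ *: _); ring.
apply: le_lt_trans (rnD _ _) _; rewrite rnZ rn_rc ger0_norm ?mulr_ge0 ?(ltW t0)//.
have : a * t * rn e <= t.
  by rewrite -[leRHS]mulr1 ler_pM ?mulr_ge0 ?(ltW t0) ?rn_ge0// ler_piMl// ltW.
move=> H; have := lt_le_trans ws sr; rewrite ltrBrDr.
by apply: le_lt_trans; rewrite lerD2l.
Qed.

Hypothesis D_conn : connected D.

(** [D] and a ball [W] about [p] form a connected open set to which every function extends
    single-valuedly. Maximality maps it to [E] over C^m, and the restriction of this map to [W] is
    the section. *)
Lemma ext_ball_in_envelope (E : riemann_domain R m) (j : V -> E) (t r : R) :
  is_envelope D j -> 0 < t < s0 -> t < r -> ext_ball D (p - rc t *: e) r ->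
  in_envelope D j p.
Proof.
move=> [_ Emax] ts0 tr ext.
have [s s_gt0 sP] := cone_ext_ball ts0 tr ext.
pose W := [set w : V | rn (w - p) < s]; pose A := D `|` W.
have Wo : open W.
  apply/open_rn => w /= ws; exists (s - rn (w - p)); first by rewrite subr_gt0.
  by move=> v vw; apply: le_lt_trans (rn_tri w _ _) _; rewrite -ltrBrDr.
have Wp : W p by rewrite /W /= subrr rn0.
have Ao : open A by exact: openU.
have Ac : connected A.
  apply: connectedU => //; last exact: ball_connected.
  have [w Dw ws] := (closure_rn D p).1 Dp s s_gt0.
  by exists w.
have Ap : A p by right.
pose x0 : set_type A := exist _ p (mem_set Ap).
have extA f : hol_on D f -> exists2 g, hol_on A g & forall z, D z -> g z = f z.
  move=> df; have [F dF Ff] := sP f df.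
  exists (fun z => if pselect (D z) then f z else F z); last first.
    by move=> z Dz; case: pselect.
  move=> z [Dz|Wz].
    have [d d0 dD] := D_ball D_open Dz.
    apply: (@hol_near _ _ _ f _ z d d0 _ (df z Dz)) => w /dD Dw.
    by case: pselect.
  have [d d0 dW] := (open_rn W).1 Wo z Wz.
  apply: (@hol_near _ _ _ F _ z d d0 _ (dF z Wz)) => w /dW Ww.
  by case: pselect => // Dw; exact: Ff.
have DA : D `<=` A by move=> z Dz; left.
have extY := @schlicht_extension R m A Ao Ac x0 D DA extA.
have [h [hc hproj hj]] := Emax _ _ extY.
exists W, (fun z => h (schlicht_in x0 z)); split.
- by split.
- split.
    apply: within_continuous_comp; first by move=> x _; exact: hc.
    have WA : W `<=` A by move=> z Wz; right.
    by apply: continuous_subspaceW WA _; exact: schlicht_in_cont.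
  by move=> z Wz; rewrite hproj; apply: schlicht_inK; right.
- by move=> z _ Dz; exact: hj.
Qed.

End CaseExtension.

(** * The peak function *)

Section PeakArithmetic.
Variable R : realType.
Implicit Types A B C x y u l a : R.

Lemma push_lower_arith A B C x (ep : R) :
  A <= B + x -> B <= C + ep -> 2 * ep < A -> x < ep / 2 -> ep / 2 <= C.
Proof. lra. Qed.

Lemma level_arith x y u l :
  (- x + u - 1) / l - (- y + u - 1) / l = (- x - - y) / l.
Proof. ring. Qed.

Lemma level_neg_arith u x : u <= x -> - x + u - 1 < 0.
Proof. lra. Qed.

Lemma bad_arith a x u l y : x <= u + l -> u - y + 1 <= - l * a ->
  - a * - l <= - x + (y + l) - 1.
Proof. lra. Qed.

Lemma good_arith u x y l : u <= x -> 2 * (y - u) <= l ->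
  - x + (y - l) - 1 <= - 2^-1 * l.
Proof. lra. Qed.

Lemma bad_cont_arith x y a : - (a / 2) < x - y -> - (a / 2) < y -> - a < x.
Proof. lra. Qed.

Lemma half_lt_arith a : 0 < a -> a / 2 < a.
Proof. lra. Qed.

Lemma close_arith x y a : 0 < a -> x <= y + a / 2 -> y <= x + a / 2 -> - a < x - y < a.
Proof. by move=> a0 H1 H2; apply/andP; split; lra. Qed.

Lemma ln_le_mono x y : 0 < x -> x <= y -> ln x <= ln y.
Proof. by move=> x0 xy; rewrite ler_ln ?posrE// (lt_le_trans x0). Qed.

End PeakArithmetic.

Section PeakFunction.
Variables (R : realType) (m : nat).
Local Notation V := ('rV[Cplx R]_m).
Variables (D : set V) (p e : V) (s0 c : R).
Hypothesis D_open : open D.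
Hypothesis e1 : rn e <= 1.
Hypothesis s0_gt0 : 0 < s0.
Hypothesis c_gt0 : 0 < c.
Hypothesis c_le1 : c <= 1.
Hypothesis cone : forall z y (t : R), closure D z -> rn (z - p) < s0 -> 0 < t < s0 ->
    rn (y - (z - rc t *: e)) < c * t -> D y.

(** Halving [Num.min s0 1] gives [eps k < s0], so that the cone applies, and [eps k <= 2^-1], so
    that [lam k] is positive. *)
Definition eps k : R := Num.min s0 1 / 2 / 2 ^+ k.

Definition peak_dom (z : V) := rn (z - p) < s0 /\ closure D z.

Definition push k (z : V) : V := z - rc (eps k) *: e.

Lemma eps_gt0 k : 0 < eps k.
Proof. by rewrite !divr_gt0 ?exprn_gt0// lt_min s0_gt0 ltr01. Qed.

Lemma eps_anti k l : (k <= l)%N -> eps l <= eps k.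
Proof.
move=> kl; rewrite /eps ler_wpM2l ?lef_pV2 ?posrE ?exprn_gt0//.
  by rewrite divr_ge0// le_min ltW//=.
by rewrite ler_weXn2l// ler1n.
Qed.

Lemma eps_lt k : eps k < s0 /\ eps k <= 2^-1.
Proof.
have := eps_anti (leq0n k); rewrite {2}/eps expr0 divr1.
have : Num.min s0 1 <= s0 by rewrite ge_min lexx.
have : Num.min s0 1 <= 1 by rewrite ge_min lexx orbT.
by move: s0_gt0; clear -D_open e1 s0_gt0 c_gt0 c_le1 cone; lra.
Qed.

Lemma eps_itv k : 0 < eps k < s0.
Proof. by rewrite eps_gt0 (eps_lt k).1. Qed.

Definition lam k : R := - ln (eps k).

Lemma lam_gt0 k : 0 < lam k.
Proof.
rewrite oppr_gt0 ln_lt0// eps_gt0/=; have [_ H] := eps_lt k.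
by apply: le_lt_trans H _; rewrite invf_lt1// ltr1n.
Qed.

Lemma lam_large (B : R) : exists k0, forall k, (k0 <= k)%N -> B <= lam k.
Proof.
have [k0 H] := @half_pow_lt R (Num.min s0 1 / 2) (expR (- B)) (expR_gt0 _).
exists k0 => k kk; rewrite /lam lerNr -(expRK (- B)).
rewrite ler_ln ?posrE ?eps_gt0 ?expR_gt0//.
by apply: le_trans (eps_anti kk) _; exact: ltW.
Qed.

Lemma push_in k z : peak_dom z -> D (push k z).
Proof.
move=> [zp Dz]; apply: (cone Dz zp (eps_itv k)).
by rewrite subrr rn0 mulr_gt0// eps_gt0.
Qed.

Lemma rad_push_ge k z : peak_dom z -> c * eps k <= rad D (push k z).
Proof.
move=> zC; have Dk := push_in k zC; have [zp Dz] := zC.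
have ck0 : 0 < c * eps k by rewrite mulr_gt0// eps_gt0.
apply: rad_ge => //; last first.
  by apply: (ext_ball_sub ck0) => w; exact: (cone Dz zp (eps_itv k)).
rewrite ck0; have [_ H] := eps_lt k.
apply: (@le_trans _ _ (1 * eps k)); first by rewrite ler_wpM2r// ltW// eps_gt0.
by rewrite mul1r; apply: le_trans H _; rewrite invf_le1// ler1n.
Qed.

(* Dividing by [lam k], which tends to infinity, makes all [z] with
   [rad (push k z)] comparable to [eps k] converge to 0; the [- 1] makes [level]
   negative. *)
Definition level k z : R := (- ln (rad D (push k z)) + ln (c * eps k) - 1) / lam k.

Lemma level_lt0 k z : peak_dom z -> level k z < 0.
Proof.
move=> zC; rewrite /level pmulr_llt0 ?invr_gt0 ?lam_gt0//.
have ck0 : 0 < c * eps k by rewrite mulr_gt0// eps_gt0.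
apply: level_neg_arith; rewrite ler_ln ?posrE//; first exact: rad_push_ge.
by apply: rad_gt0 => //; exact: push_in.
Qed.

Lemma level_cont k z : peak_dom z -> rcont (level k) z.
Proof.
move=> zC a a0; have Dk := push_in k zC.
have [d d0 dP] := lnrad_cont D_open Dk (mulr_gt0 a0 (lam_gt0 k)).
exists d => // w wz.
have wz' : rn (push k w - push k z) < d.
  by rewrite /push opprB addrA subrK.
have lk := lam_gt0 k.
rewrite /level level_arith.
rewrite normrM [X in _ * X]gtr0_norm ?invr_gt0//.
by rewrite ltr_pdivrMr//; exact: dP.
Qed.

(* The cutoff makes the supremum locally finite off [bad], hence continuous. *)
Definition peak_fun z : R :=
  sup (range (fun k => Num.max (level k z) (- 2^-1))).

Lemma level_max_lt0 k z : peak_dom z -> Num.max (level k z) (- 2^-1) < 0.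
Proof. by move=> zC; rewrite gt_max level_lt0//= oppr_lt0 invr_gt0. Qed.

Lemma peak_has_sup z : peak_dom z ->
  has_sup (range (fun k => Num.max (level k z) (- 2^-1))).
Proof.
move=> zC; split; first by exists (Num.max (level 0 z) (- 2^-1)), 0%N.
by exists 0 => _ [k _ <-]; exact/ltW/level_max_lt0.
Qed.

Lemma peak_ge k z : peak_dom z -> Num.max (level k z) (- 2^-1) <= peak_fun z.
Proof.
by move=> zC; apply: ub_le_sup; [have [] := peak_has_sup zC|exists k].
Qed.

Lemma peak_le z (B : R) : peak_dom z ->
  (forall k, Num.max (level k z) (- 2^-1) <= B) -> peak_fun z <= B.
Proof.
move=> zC H; apply: ge_sup; first by have [] := peak_has_sup zC.
by move=> _ [k _ <-].
Qed.

(** Within [peak_dom], the points where [peak_fun] vanishes. The factor 2 is a margin: one [eps k]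
    is lost in passing from [push k] to a later [push l], the other pays for moving [z] and for the
    lower bound that remains. *)
Definition bad z := forall k, rad D (push k z) <= 2 * eps k.

(** The numerator of [level k] is at least the constant [ln c - ln 2 - 1], and [lam k] tends to
    infinity. *)
Lemma peak_bad z : peak_dom z -> bad z -> peak_fun z = 0.
Proof.
move=> zC zbad; apply/eqP; rewrite eq_le; apply/andP; split.
  by apply: peak_le => // k; exact/ltW/level_max_lt0.
apply/ler_addgt0Pr => a a0.
have [k kP] := lam_large ((ln 2 - ln c + 1) / a).
rewrite -lerBlDr sub0r; apply: le_trans (peak_ge k zC).
have lk := lam_gt0 k.
rewrite le_max; apply/orP; left; rewrite /level.
rewrite ler_pdivlMr//.
have H1 : ln (rad D (push k z)) <= ln 2 + ln (eps k).
  have ek := eps_gt0 k; have ek2 : 0 < 2 * eps k by rewrite mulr_gt0.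
  rewrite -lnM ?posrE// ler_ln ?posrE//.
  by apply: rad_gt0 => //; exact: push_in.
have H2 : ln (c * eps k) = ln c + ln (eps k) by rewrite lnM ?posrE ?eps_gt0.
have H3 := kP k (leqnn k); rewrite ler_pdivrMr// in H3.
by rewrite H2; exact: bad_arith H1 H3.
Qed.

(** The moves from [push k q] to [push k z] and from there along [e] to [push l z] run on segments
    inside the cones at [q] and [z], so [rad_move] applies to each; they cost at most [eps k / 2]
    and [eps k]. *)
Lemma rad_push_lower q k : peak_dom q -> 2 * eps k < rad D (push k q) ->
  exists2 d : R, 0 < d & forall z l, peak_dom z -> rn (z - q) < d -> (k <= l)%N ->
    eps k / 2 <= rad D (push l z).
Proof.
move=> qC rk; have e0 := eps_gt0 k.
exists (Num.min (c * eps k) (eps k / 2)).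
  by rewrite lt_min mulr_gt0// divr_gt0.
move=> z l zC; rewrite lt_min => /andP[zq1 zq2] kl.
have [qp Dq] := qC; have [zp Dz] := zC.
have kq : push k z - push k q = z - q by rewrite /push opprB addrA subrK.
have step1 : rad D (push k q) <= rad D (push k z) + rn (z - q).
  rewrite -kq; apply: rad_move => //; try exact: push_in.
  move=> t /andP[t0 t1]; apply: (cone Dq qp (eps_itv k)).
  rewrite -/(push k q) kq addrC addKr rnZ rn_rc ger0_norm//.
  by apply: le_lt_trans zq1; rewrite ler_piMl ?rn_ge0.
have el := eps_anti kl; have el0 := eps_gt0 l.
have lk : push l z - push k z = rc (eps k - eps l) *: e.
  by rewrite /push vertical_shift subrr add0r.
have step2 : rad D (push k z) <= rad D (push l z) + eps k.
  apply: (@le_trans _ _ (rad D (push l z) + rn (push l z - push k z))).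
    apply: rad_move => //; try exact: push_in.
    move=> t /andP[t0 t1]; rewrite /push (vertical_segment2 z e (eps k) (eps l) t).
    have tl : t * (eps k - eps l) <= eps k - eps l.
      by rewrite ler_piMl// subr_ge0.
    have tl0 : 0 <= t * (eps k - eps l) by rewrite mulr_ge0// subr_ge0.
    have [ks0 _] := eps_lt k.
    apply: (cone_center cone c_gt0 Dz zp).
    by apply/andP; split; move: tl tl0 el0 ks0; clear -D_open e1 s0_gt0 c_gt0 c_le1 cone; lra.
  rewrite lerD2l lk rnZ rn_rc ger0_norm ?subr_ge0//.
  apply: (@le_trans _ _ (eps k - eps l)); first by rewrite ler_piMr// subr_ge0.
  by rewrite gerBl ltW.
exact: push_lower_arith step1 step2 rk zq2.
Qed.

(** With [rad] bounded below by [eps k / 2], the numerator of [level l] is at most a constant minus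
    [lam l]; once [lam l] is twice as large as this constant, the quotient is at most -1/2. *)
Lemma peak_good q : peak_dom q -> ~ bad q ->
  exists2 d : R, 0 < d & exists N, forall z l, peak_dom z -> rn (z - q) < d ->
    (N <= l)%N -> level l z <= - 2^-1.
Proof.
move=> qC /existsNP[k /negP]; rewrite -ltNge => rk.
have [d d0 dP] := rad_push_lower qC rk; exists d => //.
have [N NP] := lam_large (2 * (ln c - ln (eps k / 2))).
exists (maxn k N) => z l zC zq; rewrite geq_max => /andP[kl Nl].
have H := dP z l zC zq kl.
rewrite /level ler_pdivrMr ?lam_gt0//.
have ek2 : 0 < eps k / 2 by rewrite divr_gt0// eps_gt0.
have H1 : ln (eps k / 2) <= ln (rad D (push l z)).
  exact: ln_le_mono ek2 H.
have H2 : ln (c * eps l) = ln c - lam l by rewrite lnM ?posrE ?eps_gt0// /lam opprK.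
have H3 := NP l Nl.
by rewrite H2; exact: good_arith H1 H3.
Qed.

(** For large [k] the radius at [push k z] is at least a fixed [r1], while [2 * eps k] tends to
    0. *)
Lemma good_in z : D z -> rn (z - p) < s0 -> ~ bad z.
Proof.
move=> Dz zp zbad; have [r r0 rD] := D_ball D_open Dz.
pose r1 := Num.min (r / 2) 1.
have r10 : 0 < r1 by rewrite lt_min ltr01 divr_gt0.
have [r1r r11] : r1 <= r / 2 /\ r1 <= 1 by rewrite !ge_min !lexx orbT.
have [k kP] := @half_pow_lt R (Num.min s0 1 / 2) (r1 / 4) (divr_gt0 r10 (ltr0n R 4)).
rewrite -/(eps k) in kP.
have zC : peak_dom z by split=> //; exact: subset_closure Dz.
have : r1 <= rad D (push k z).
  apply: rad_ge; [exact: D_open|exact: push_in|by rewrite r10|].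
  apply: (ext_ball_sub r10) => w wz; apply: rD.
  apply: le_lt_trans (rn_tri (push k z) _ _) _.
  have : rn (push k z - z) <= eps k.
    rewrite /push addrC addKr rnN rnZ rn_rc gtr0_norm ?eps_gt0//.
    by rewrite ler_piMr// ltW// eps_gt0.
  by move: wz kP r1r r10; clear -D_open e1 s0_gt0 c_gt0 c_le1 cone; lra.
move=> r1k; have := le_trans r1k (zbad k).
by move: kP r10; clear -D_open e1 s0_gt0 c_gt0 c_le1 cone; lra.
Qed.

(** A supremum of infinitely many negative numbers could be 0; by [peak_good] the levels from [N] on
    do not exceed the cutoff, so a maximum of finitely many negative numbers bounds it. *)
Lemma peak_lt0 z : D z -> rn (z - p) < s0 -> peak_fun z < 0.
Proof.
move=> Dz zp; have zC : peak_dom z by split=> //; exact: subset_closure Dz.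
have [d d0 [N NP]] := peak_good zC (good_in Dz zp).
have zz : rn (z - z) < d by rewrite subrr rn0.
pose B := \big[Num.max/- 2^-1]_(k < N) level k z.
apply: (@le_lt_trans _ _ B).
  apply: peak_le => // k; rewrite ge_max; apply/andP; split.
    have [Nk|kN] := leqP N k.
      apply: le_trans (NP z k zC zz Nk) _; exact: bigmax_ge_id.
    exact: (le_bigmax _ (fun i : 'I_N => level i z) (Ordinal kN)).
  exact: bigmax_ge_id.
apply/bigmax_ltP; split; first by rewrite oppr_lt0 invr_gt0.
by move=> i _; exact: level_lt0.
Qed.

(** At a bad point the value 0 is the maximum, so a single level close to 0 gives continuity. At any
    other point only finitely many levels can exceed the cutoff nearby, and these are continuous. *)
Lemma peak_cont q (a : R) : peak_dom q -> 0 < a ->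
  exists2 d : R, 0 < d & forall z, peak_dom z -> rn (z - q) < d ->
    `|peak_fun z - peak_fun q| < a.
Proof.
move=> qC a0; have a2 : 0 < a / 2 by rewrite divr_gt0.
have le0 z : peak_dom z -> peak_fun z <= 0.
  by move=> zC; apply: peak_le => // k; exact/ltW/level_max_lt0.
have [qbad|qgood] := pselect (bad q).
  have q0 := peak_bad qC qbad.
  have [k kP] : exists k, - (a / 2) < Num.max (level k q) (- 2^-1).
    apply: contrapT => /forallNP H.
    have : peak_fun q <= - (a / 2).
      by apply: peak_le => // k; rewrite leNgt; apply/negP/H.
    by rewrite q0 leNgt oppr_lt0 a2.
  have [d d0 dP] := level_cont k qC a2.
  exists d => // z zC /dP zq; rewrite q0 subr0 ltr_norml.
  apply/andP; split; last by apply: le_lt_trans (le0 z zC) a0.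
  apply: lt_le_trans (peak_ge k zC); rewrite lt_max.
  move: kP; rewrite lt_max => /orP[H|H]; apply/orP; [left|right].
    by move: zq; rewrite ltr_norml => /andP[zq _]; exact: bad_cont_arith zq H.
  by apply: lt_trans H; rewrite ltrN2; exact: half_lt_arith.
have [d1 d10 [N NP]] := peak_good qC qgood.
have [d d0 dP] : exists2 d : R, 0 < d & forall k z, (k < N)%N -> rn (z - q) < d ->
    `|level k z - level k q| < a / 2.
  elim: N {NP} => [|N [d d0 dP]]; first by exists 1.
  have [d' d'0 d'P] := level_cont N qC a2.
  exists (Num.min d d'); first by rewrite lt_min d0.
  move=> k z; rewrite ltnS leq_eqVlt lt_min => /predU1P[->|kN] /andP[zd zd'].
    exact: d'P.
  exact: dP.
exists (Num.min d d1); first by rewrite lt_min d0.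
move=> z zC; rewrite lt_min => /andP[zd zd1].
(* A level of [x] below the cutoff needs no counterpart at [y], as [peak_fun y >= - 2^-1]. *)
have half_le x y : peak_dom x -> peak_dom y ->
    (forall k, level k x <= level k y + a / 2 \/ level k x <= - 2^-1) ->
    peak_fun x <= peak_fun y + a / 2.
  move=> xC yC H; apply: peak_le => // k.
  have := peak_ge k yC; rewrite !ge_max => /andP[yk yh].
  have yh2 : - 2^-1 <= peak_fun y + a / 2 by rewrite (le_trans yh)// lerDl ltW.
  apply/andP; split=> //; case: (H k) => Hk; apply: (le_trans Hk) => //.
  by rewrite lerD2r.
have levels k z' : (k < N)%N -> rn (z' - q) < d ->
    level k z' <= level k q + a / 2 /\ level k q <= level k z' + a / 2.
  move=> kN z'q; have := dP k z' kN z'q; rewrite ltr_norml => /andP[H1 H2].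
  by split; rewrite addrC -lerBlDr ltW// -ltrN2 opprB.
have qq : rn (q - q) < d1 by rewrite subrr rn0.
have zq : peak_fun z <= peak_fun q + a / 2.
  apply: half_le => // k; have [Nk|kN] := leqP N k; first by right; exact: NP.
  by left; have [] := levels k z kN zd.
have qz : peak_fun q <= peak_fun z + a / 2.
  apply: half_le => // k; have [Nk|kN] := leqP N k; first by right; exact: NP.
  by left; have [] := levels k z kN zd.
by rewrite ltr_norml; exact: close_arith.
Qed.

End PeakFunction.

(** * Plurisubharmonicity of the peak function *)

Section PeakPsh.
Variables (R : realType) (m : nat).
Local Notation K := (Cplx R).
Local Notation V := ('rV[Cplx R]_m).
Local Notation mu := (@lebesgue_measure R).

Lemma circle_mean_affine (f : R -> R) (a b : R) : continuous f ->
  (2 * pi)^-1 * \int[mu]_(t in `[0, 2 * pi]) (a * f t + b) =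
  a * ((2 * pi)^-1 * \int[mu]_(t in `[0, 2 * pi]) f t) + b.
Proof.
move=> cf; have pi0 := pi_gt0 R.
have caf : continuous (fun t => a * f t).
  by move=> t; apply: cvgMr; exact: cf.
rewrite RintegralD//; last 2 first.
- by apply: integrable_cont.
- by apply: integrable_cont; exact: cst_continuous.
rewrite RintegralZl//; last exact: integrable_cont.
have -> : \int[mu]_(t in `[0, 2 * pi]) b = b * (2 * pi).
  rewrite Rintegral_cst//; congr (_ * _).
  apply: etrans (congr1 fine (lebesgue_measure_itv `[0, 2 * pi])) _.
  by rewrite /= lte_fin mulr_gt0//= subr0.
have : 2 * pi != 0 :> R by rewrite mulf_neq0// gt_eqF.
by move=> pi20; field; lra.
Qed.

Lemma circle_mean_le (f g : R -> R) : continuous f -> continuous g ->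
  (forall t, f t <= g t) ->
  (2 * pi)^-1 * \int[mu]_(t in `[0, 2 * pi]) f t <=
  (2 * pi)^-1 * \int[mu]_(t in `[0, 2 * pi]) g t.
Proof.
move=> cf cg fg; rewrite ler_wpM2l ?invr_ge0 ?mulr_ge0 ?pi_ge0//.
by apply: le_Rintegral => //; exact: integrable_cont.
Qed.

Lemma circle_mean_EFin (f : R -> R) : continuous f ->
  (\int[mu]_(t in `[0%R, (2 * pi)%R]) (f t)%:E)%E =
  (\int[mu]_(t in `[0, 2 * pi]) f t)%:E.
Proof.
move=> cf; rewrite /Rintegral fineK//.
by apply: integrable_fin_num => //; exact: integrable_cont.
Qed.

Lemma line_rcont (u : V -> R) (a b : V) (z : K) (e : R) :
  rcont u (a + z *: b) -> 0 < e -> exists2 d : R, 0 < d &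
  forall w : K, rn (w - z) < d -> `|u (a + w *: b) - u (a + z *: b)| < e.
Proof.
move=> uc e0; have [d d0 dP] := uc e e0.
have b1 : 0 < rn b + 1 by rewrite ltr_wpDl ?rn_ge0.
exists (d / (rn b + 1)); first by rewrite divr_gt0.
move=> w; rewrite ltr_pdivlMr// => wz; apply: dP.
have -> : (a + w *: b) - (a + z *: b) = (w - z) *: b.
  by rewrite opprD addrACA subrr add0r -scalerBl.
rewrite rnZ; apply: le_lt_trans wz.
by rewrite ler_wpM2l ?rn_ge0// lerDl.
Qed.

Lemma dist_lt_sub (x y r : R) : `|x - y| < r - y -> x < r.
Proof. by rewrite ltr_norml ltrD2r => /andP[]. Qed.

Variables (D : set V) (p e : V) (s0 c : R).
Hypothesis D_open : open D.
Hypothesis e1 : rn e <= 1.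
Hypothesis s0_gt0 : 0 < s0.
Hypothesis c_gt0 : 0 < c.
Hypothesis c_le1 : c <= 1.
Hypothesis cone : forall z y (t : R), closure D z -> rn (z - p) < s0 -> 0 < t < s0 ->
    rn (y - (z - rc t *: e)) < c * t -> D y.

Local Notation rho := (peak_fun D e s0 c).
Local Notation U := [set z : V | rn (z - p) < s0].

Lemma U_open : open U.
Proof.
apply/open_rn => w /= ws; exists (s0 - rn (w - p)); first by rewrite subr_gt0.
by move=> v vw; apply: le_lt_trans (rn_tri w _ _) _; rewrite -ltrBrDr.
Qed.

Lemma peak_domI z : (U `&` D) z -> peak_dom D p s0 z.
Proof. by move=> [Uz Dz]; split=> //; exact: subset_closure Dz. Qed.

Lemma peak_rcont z : (U `&` D) z -> rcont rho z.
Proof.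
move=> UDz a a0.
have [d d0 dP] := peak_cont D_open e1 s0_gt0 c_gt0 c_le1 cone (peak_domI UDz) a0.
have [d' d'0 d'P] := (open_rn _).1 (openI U_open D_open) z UDz.
exists (Num.min d d'); first by rewrite lt_min d0.
move=> w; rewrite lt_min => /andP[wd /d'P UDw].
by apply: dP => //; exact: peak_domI.
Qed.

(** [push k] is a translation and takes the disc to a disc, which the cone keeps in [D]; [level k]
    is an increasing affine function of [- ln rad] there. *)
Lemma level_submean k (x b : V) : (forall s : K, rn s <= 1 -> (U `&` D) (x + s *: b)) ->
  level D e s0 c k x <=
  (2 * pi)^-1 * \int[mu]_(t in `[0, 2 * pi]) level D e s0 c k (x + cis t *: b).
Proof.
move=> disc; have push_disc s : push e s0 k x + s *: b = push e s0 k (x + s *: b).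
  by rewrite /push addrAC.
have xUD : (U `&` D) x by rewrite -[x]addr0 -(scale0r b); apply: disc; rewrite rn0.
have pin z : (U `&` D) z -> D (push e s0 k z).
  by move=> UDz; apply: (push_in s0_gt0 c_gt0 cone); exact: peak_domI.
have discD s : rn s <= 1 -> D (push e s0 k x + s *: b).
  by move=> s1; rewrite push_disc; apply: pin; exact: disc.
have sub := rad_submean D_open discD.
pose f t := - ln (rad D (push e s0 k x + cis t *: b)).
have cf : continuous f.
  apply: (@circle_cont _ _ (fun w => - ln (rad D w))) => s s1; apply: lnrad_cont => //.
  by apply: discD; rewrite s1.
have l0 := lam_gt0 s0_gt0 k.
pose beta := (ln (c * eps s0 k) - 1) / lam s0 k.
have levE z : level D e s0 c k z = (lam s0 k)^-1 * - ln (rad D (push e s0 k z)) + beta.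
  by rewrite /level /beta; move: (ln (rad D _)) (ln (c * _)) (lam _ _) => *; ring.
have -> : (fun t => level D e s0 c k (x + cis t *: b)) =
    (fun t => (lam s0 k)^-1 * f t + beta).
  by apply/funext => t; rewrite levE /f push_disc.
rewrite circle_mean_affine// levE lerD2r ler_wpM2l ?invr_ge0 ?(ltW l0)//.
Qed.

(** Each competitor in the supremum is at most its own mean, hence at most the mean of [rho]. *)
Lemma peak_submean (x b : V) : (forall s : K, rn s <= 1 -> (U `&` D) (x + s *: b)) ->
  rho x <= (2 * pi)^-1 * \int[mu]_(t in `[0, 2 * pi]) rho (x + cis t *: b).
Proof.
move=> disc.
have xUD : (U `&` D) x by rewrite -[x]addr0 -(scale0r b); apply: disc; rewrite rn0.
have onC s : rn s = 1 -> (U `&` D) (x + s *: b) by move=> s1; apply: disc; rewrite s1.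
have crho : continuous (fun t => rho (x + cis t *: b)).
  by apply: circle_cont => s s1; apply: peak_rcont; exact: onC.
have cisUD t : (U `&` D) (x + cis t *: b) by apply: onC; exact: rn_cis.
apply: (peak_le D_open s0_gt0 c_gt0 c_le1 cone (peak_domI xUD)) => k; rewrite ge_max; apply/andP; split.
  apply: le_trans (level_submean k disc) _; apply: circle_mean_le => //.
    apply: circle_cont => s s1; apply: (level_cont D_open s0_gt0 c_gt0 cone).
    by apply: peak_domI; exact: onC.
  move=> t; have := peak_ge D_open s0_gt0 c_gt0 c_le1 cone k (peak_domI (cisUD t)).
  by rewrite ge_max => /andP[].
(* The constant is written as an affine function of slope 0, so that [circle_mean_affine] computes
   its mean. *)
have -> : - 2^-1 = (2 * pi)^-1 * \int[mu]_(t in `[0, 2 * pi]) (0 * (fun=> 0) t + (- 2^-1)).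
  by rewrite circle_mean_affine ?mul0r ?add0r//; exact: cst_continuous.
apply: circle_mean_le => // [t|t]; first exact: cst_continuous.
rewrite mul0r add0r.
have := peak_ge D_open s0_gt0 c_gt0 c_le1 cone 0 (peak_domI (cisUD t)).
by rewrite ge_max => /andP[].
Qed.

Lemma peak_usc : usc_on (U `&` D) (fun z => (rho z)%:E).
Proof.
move=> x UDx; split; first exact: ltry.
move=> a; rewrite lte_fin => xa.
have xa0 : 0 < a - rho x by rewrite subr_gt0.
have [d d0 dP] := peak_rcont UDx xa0.
apply/nbhs_rn; exists d => // w /dP; rewrite lte_fin ltr_norml => /andP[_].
by rewrite ltrD2r.
Qed.

Lemma peak_line_usc (a b : V) :
  usc_on [set z : K | (U `&` D) (a + z *: b)] (fun z => (rho (a + z *: b))%:E).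
Proof.
move=> z UDz; split; first exact: ltry.
move=> r xr.
have r0 : 0 < r - rho (a + z *: b) by rewrite subr_gt0; exact: xr.
have [d d0 dP] := line_rcont (peak_rcont (UDz : (U `&` D) (a + z *: b))) r0.
apply/nbhs_rn; exists d; first exact: d0.
move=> w wz; exact: (dist_lt_sub (dP w wz)).
Qed.

(** Centre and radius of a disc in the line are absorbed into base point and direction, which
    reduces [subharmonic_on] to the unit discs of [peak_submean]. *)
Lemma circle_ptE (a b : V) (z : K) (r t : R) :
  a + circle_pt z r t *: b = (a + z *: b) + cis t *: (rc r *: b).
Proof.
have -> : circle_pt z r t = z + cis t * rc r.
  rewrite /circle_pt; congr (_ + _); rewrite /cis /rc.
  by rewrite -[RHS]/(Complex (_ - _) (_ + _)); congr Complex => /=; ring.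
by rewrite scalerDl addrA scalerA.
Qed.

Lemma peak_psh : psh_on (U `&` D) (fun z => (rho z)%:E).
Proof.
split; first exact: peak_usc.
move=> a b; split; first exact: peak_line_usc.
move=> z r r0 disc.
pose x := a + z *: b; pose b' := rc r *: b.
have disc' s : rn s <= 1 -> (U `&` D) (x + s *: b').
  move=> s1; have -> : x + s *: b' = a + (z + s * rc r) *: b.
    by rewrite scalerDl addrA scalerA.
  apply: (disc (z + s * rc r)); rewrite addrC addKr rnE rc_le rnM rn_rc gtr0_norm//.
  by rewrite ler_piMl// ltW.
have crho : continuous (fun t => rho (x + cis t *: b')).
  by apply: circle_cont => s s1; apply/peak_rcont/disc'; rewrite s1.
have -> : (fun t => (rho (a + circle_pt z r t *: b))%:E) =
    (fun t => (rho (x + cis t *: b'))%:E).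
  by apply/funext => t; rewrite circle_ptE.
rewrite circle_mean_EFin// -EFinM lee_fin.
have pi0 := pi_gt0 R; rewrite -ler_pdivlMl ?mulr_gt0//.
exact: peak_submean.
Qed.

Lemma peak_within_cont : {within U `&` closure D, continuous rho}.
Proof.
apply/subspace_continuousP => z zC; apply/cvgrPdist_lt => a a0.
have [d d0 dP] := peak_cont D_open e1 s0_gt0 c_gt0 c_le1 cone (zC : peak_dom D p s0 z) a0.
suff near_z : \forall w \near (z : V), (U `&` closure D) w -> `|rho z - rho w| < a.
  exact: near_z.
apply/nbhs_rn; exists d; first exact: d0.
by move=> w wz wC; rewrite distrC; exact: dP.
Qed.

Lemma peak_set : bad D e s0 p -> closure D p -> in_local_psh_peak_set D p.
Proof.
move=> pbad Dp; exists U, rho.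
have Up : U p by rewrite /= subrr rn0.
split.
- by split=> //; exact: U_open.
- exact: peak_within_cont.
- by move=> z Uz Dz; exact: (peak_lt0 D_open e1 s0_gt0 c_gt0 c_le1 cone).
- exact: peak_psh.
- by apply: (peak_bad D_open s0_gt0 c_gt0 c_le1 cone).
Qed.

End PeakPsh.

Theorem theorem1p3 (R : realType) (n : nat) (Omega : set (CC R n.+1))
    (Omega_domain : domain Omega) (Omega_bounded : bounded_set Omega)
    (Omega_lipschitz : lipschitz_boundary Omega)
    (E : riemann_domain R n.+1) (j : CC R n.+1 -> E)
    (E_envelope : is_envelope Omega j)
    (p : CC R n.+1) (p_boundary : boundary Omega p) :
  in_envelope Omega j p \/ in_local_psh_peak_set Omega p.
Proof.
have [Oo Oc] := Omega_domain; have [Op _] := p_boundary.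
have [e [s0 [c [e1 s00 c0 c1 cone]]]] := lipschitz_cone Omega_lipschitz p_boundary.
have [[t [r [ts0 tr ext]]]|noext] := pselect (exists t r : R,
    [/\ 0 < t < s0, t < r & ext_ball Omega (p - rc t *: e) r]).
  by left; exact: (ext_ball_in_envelope Oo Op e1 cone c0 Oc E_envelope ts0 tr ext).
(* Without such a ball no radius above [eps k] is admissible at [push k p], so
   [rad <= eps k <= 2 * eps k] for every [k], and [p] is [bad]. *)
right; apply: (peak_set Oo e1 s00 c0 c1 cone) => // k.
have ek := eps_itv s00 k.
have Dk : Omega (push e s0 k p).
  by apply: (push_in s00 c0 cone); split=> //; rewrite subrr rn0.
apply: (@le_trans _ _ (eps s0 k)); last first.
  by have /andP[? _] := ek; rewrite ler_peMl ?ltW// ltr1n.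
apply: (rad_le Oo Dk) => r /andP[r0 r1] ext; rewrite leNgt; apply/negP => er.
by apply: noext; exists (eps s0 k), r.
Qed.
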